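(* Let $T(n)$ denote the number of ways to place $n$ mutually non-attacking queens on the $n\times n$ toroidal chessboard. Then, for $n \equiv 1,5 \pmod 6$, $$T(n) = \left((1+o(1))\frac{n}{e^3}\right)^n ,$$ where $o(1)$ denotes a quantity tending to $0$ as $n\to\infty$ through integers $n\equiv 1,5 \pmod 6$.
   Context: On the $n\times n$ toroidal chessboard with rows and columns indexed by $\mathbb{Z}/n\mathbb{Z}$, a toroidal $n$-queens configuration is a set of $n$ squares $(i,j)\in(\mathbb{Z}/n\mathbb{Z})^2$ such that no two distinct squares of the set share the same row $i$, the same column $j$, the same value of $i+j \bmod n$, or the same value of $i-j \bmod n$. $T(n)$ is the number of such sets. *)

(* Defs.v *)
From mathcomp Require Import all_boot all_order all_algebra.
From mathcomp Require Import all_classical all_reals all_analysis.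

Set Implicit Arguments.
Unset Strict Implicit.
Unset Printing Implicit Defensive.

Import Order.TTheory GRing.Theory Num.Theory.
Import numFieldNormedType.Exports.

(* Z/n is represented by 'I_n with explicit congruences mod n: MathComp's ring
   'Z_n does not denote Z/n for n = 0, 1.  The differences are taken in int, as
   subtraction on nat is truncated. *)
Definition attacks (n : nat) (s t : 'I_n * 'I_n) : bool :=
  [|| s.1 == t.1,
      s.2 == t.2,
      s.1 + s.2 == t.1 + t.2 %[mod n]
    | (s.1%:Z - s.2%:Z == t.1%:Z - t.2%:Z %[mod n%:Z])%Z].

Definition toroidal_queens (n : nat) (Q : {set 'I_n * 'I_n}) : bool :=
  (#|Q| == n) &&
  [forall s in Q, forall t in Q, (s != t) ==> ~~ attacks s t].

Definition T (n : nat) : nat :=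
  #|[set Q : {set 'I_n * 'I_n} | toroidal_queens Q]|.

(* Main.v *)
Require Import Defs.
From HB Require Import structures.
From mathcomp Require Import all_boot all_order all_algebra.
From mathcomp Require Import ring lra zify.

Set Implicit Arguments.
Unset Strict Implicit.
Unset Printing Implicit Defensive.

Import Order.TTheory GRing.Theory Num.Theory.

Local Open Scope ring_scope.

(** Upper bound.  Fill the board by repeatedly choosing a uniformly random queen
    among those attacking no earlier one.  The outcomes are disjoint events, so the
    probabilities of the configurations sum to at most 1.  For a fixed configuration,
    concavity of the logarithm bounds its probability from below by replacing the
    number of choices available when k queens are missing by its average over all
    k-subsets, which is at most k (1 + k^3/n^2).  Hence T(n) is at most the product
    of the factors 1 + k^3/n^2 for k <= n, that is ((1+o(1)) n/e^3)^n.

    Lower bound.  Write a configuration as an exact cover of the 4n lines by queens.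
    Random colours on the lines select a sparse template, a union of orbits under
    quarter turns, such that every queen belongs to many exchanges with the template
    and the lines left free are pseudorandom.  A random greedy process on the free
    lines follows its expected trajectory (an exponential potential is a
    supermartingale), which counts about (n/e^3)^n partial configurations missing
    only few lines.  Each of them can be completed: the leave is an integer
    combination of few queens, since the only obstructions are two linear moments and
    a quadratic one; the negative queens of that combination are replaced, by
    four-dimensional cube identities, with queens which the template can supply in
    exchange for some of its orbits.  A completed configuration arises from at most
    n^(n-k) partial ones of size k, and n-k is so small that this factor is
    negligible. *)

(** * Lines and configurations *)

Section Lines.
Variable K : finComUnitRingType.
Implicit Types (q : K * K) (x y z : K) (j : 'I_4).

(** The invertibility of 2 makes any two types of lines coordinates on the board. With 3 also
    invertible, the squares of all residues sum to 0, so the full board satisfies the quadratic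
    relation that every queen satisfies. The leave of the greedy process has no structure, so the
    template has to be set aside beforehand, rich enough to serve every possible leave and too
    sparse to be felt in the count. This decides the scales. With x colours an orbit is selected
    with probability x^-4, and the 512 cells needed by a gadget agree with probability x^-512. The
    process stops with s^29 free lines of each type, while n has the order of s^30; taking s = x^600
    leaves room for the loss x^512. The template costs a fraction of order x^-4 of the lines, so n-k
    is at most n/x^3; as log n is at most x/20, the factor n^(n-k) is e^O(n/x^2). Orbits under
    quarter turns cover lines in blocks symmetric under sign and under exchange of the two axes, or
    of the two diagonals. An exchange is then an identity between eight axis blocks and eight
    diagonal blocks. *)

Definition phi j q : K :=
  match val j with 0 => q.1 | 1 => q.2 | 2 => q.1 + q.2 | _ => q.1 - q.2 end.

Definition vec := {ffun 'I_4 * K -> int}.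

Definition dl (j : nat) z : vec := [ffun l => ((val l.1 == j) && (l.2 == z))%:Z].

Definition cov q : vec :=
  dl 0 q.1 + dl 1 q.2 + dl 2 (q.1 + q.2) + dl 3 (q.1 - q.2).

Lemma vecD (f g : vec) l : (f + g) l = f l + g l. Proof. by rewrite ffunE. Qed.
Lemma vecN (f : vec) l : (- f) l = - f l. Proof. by rewrite ffunE. Qed.
Lemma vec0 l : (0 : vec) l = 0. Proof. by rewrite ffunE. Qed.
Definition vecE := (vecD, vecN, vec0).

Lemma dlE (j : nat) z l : dl j z l = ((val l.1 == j) && (l.2 == z))%:Z.
Proof. by rewrite ffunE. Qed.

Lemma covE q l : cov q l = (phi l.1 q == l.2)%:Z.
Proof.
case: l => j z; rewrite /cov !vecE !dlE /= /phi.
case: j => [[|[|[|[|//]]]] //= _]; rewrite ?add0r ?addr0 eq_sym //.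
Qed.

Definition csum (s : seq (K * K)) : vec := \sum_(q <- s) cov q.

Lemma csum0 : csum [::] = 0. Proof. exact: big_nil. Qed.
Lemma csum_cons q s : csum (q :: s) = cov q + csum s. Proof. exact: big_cons. Qed.
Lemma csum_cat s t : csum (s ++ t) = csum s + csum t. Proof. exact: big_cat. Qed.

Definition nonzero q := [&& q.1 != 0, q.2 != 0, q.1 + q.2 != 0 & q.1 - q.2 != 0].

Lemma avoid (s : seq K) : (size s < #|K|)%N -> exists z, z \notin s.
Proof.
move=> h; have [z _ zs] : exists2 z, z \in K & z \notin s.
  apply/subsetPn; apply: contraL h => /subset_leq_card h.
  by rewrite -leqNgt (leq_trans h) // card_size.
by exists z.
Qed.

End Lines.

Lemma sub_neq0l (V : zmodType) (x y z : V) : x != y -> z = x - y -> z != 0.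
Proof. by move=> h ->; rewrite subr_eq0. Qed.

Lemma sub_neq0r (V : zmodType) (x y z : V) : x != y -> z = y - x -> z != 0.
Proof. by move=> h ->; rewrite subr_eq0 eq_sym. Qed.

(** The facts supplied by [avoid] have the form [x != y]; a non-vanishing goal is closed when [ring]
    recognises its term as plus or minus such a difference. *)
Ltac nz := match goal with
  | |- is_true (_ && _) => apply/andP; split; nz
  | |- is_true (_ != 0) => first [ assumption
     | match goal with H : is_true (_ != _) |- _ =>
         first [ by apply: (sub_neq0l H); ring | by apply: (sub_neq0r H); ring ] end ]
  end.

Section Configurations.
Variable K : finComUnitRingType.
Local Notation line := ('I_4 * K)%type.
Local Notation queen := (K * K)%type.
Implicit Types (S M : {set queen}) (v : line) (q : queen).

Definition cov_count S v := #|[set q in S | phi v.1 q == v.2]|.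
Definition conf : {set {set queen}} := [set S | [forall v, cov_count S v == 1%N]].

Lemma conf_card S : S \in conf -> #|S| = #|K|.
Proof.
rewrite inE => /forallP h; rewrite -sum1_card (partition_big (phi ord0) predT) //=.
rewrite -sum1_card; apply: eq_bigr => x _.
rewrite -[RHS](eqP (h (ord0, x))) /cov_count -sum1_card.
by apply: eq_bigl => q; rewrite inE.
Qed.

Lemma bin_le_exp (n m : nat) : ('C(n, m) <= n ^ m)%N.
Proof.
apply: (@leq_trans (n ^_ m)); first by rewrite -bin_ffact leq_pmulr // fact_gt0.
elim: m => [|m IH]; first by rewrite ffactn0.
by rewrite ffactnSr expnSr leq_mul // leq_subr.
Qed.

(** Pairs [M \subset S] are counted twice. A subset of [S] is counted through its complement, of
    size n-k, which gives the exponent n-k instead of k. *)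
Lemma extend_count (k : nat) (P : {set {set queen}}) : (k <= #|K|)%N ->
  (forall M, M \in P -> #|M| = k) ->
  (forall M, M \in P -> exists2 S, S \in conf & M \subset S) ->
  (#|P| <= #|conf| * #|K| ^ (#|K| - k))%N.
Proof.
move=> kn hk hP.
apply: (@leq_trans (\sum_(S in conf) #|[set M in P | M \subset S]|)%N).
  rewrite (eq_bigr (fun S : {set queen} => \sum_(M in P) (M \subset S))%N); last first.
    move=> S _; rewrite -sum1_card big_mkcond [RHS]big_mkcond; apply: eq_bigr => M _.
    by rewrite in_set; case: (M \in P); case: (M \subset S).
  rewrite exchange_big -sum1_card /=; apply: leq_sum => M /hP[S hS MS].
  by rewrite (bigD1 S) //= MS.
rewrite -sum_nat_const; apply: leq_sum => S hS.
apply: (@leq_trans #|[set M : {set queen} | M \subset S & #|M| == k]|).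
  by apply: subset_leq_card; apply/subsetP => M; rewrite !inE => /andP[/hk -> ->] /=.
by rewrite cards_draws (conf_card hS) -bin_sub //; exact: bin_le_exp.
Qed.

End Configurations.

(** * Residues modulo n and toroidal configurations *)

Section Residues.
Variable k : nat.
Local Notation K := 'Z_k.+2.

Lemma card_residues : #|K| = k.+2.
Proof. by rewrite card_ord. Qed.

Lemma residue_unit m : coprime k.+2 m -> (m%:R : K) \is a GRing.unit.
Proof. by move=> h; rewrite unitZpE. Qed.

Lemma residue_cyclic l : (k.+2 <= 2 ^ l)%N -> forall x : K, exists2 m, (m < 2 ^ l)%N & x = m%:R.
Proof.
move=> h x; exists (val x); first exact: leq_trans (ltn_ord x) h.
by rewrite Zp_nat valZpK.
Qed.

(** As integers, the products [t * c] of two solutions have the same remainder mod n, so [t] is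
    determined by the quotient, which takes at most c values. *)
Lemma residue_solutions (c : nat) (b : K) : (0 < c)%N -> (#|[set t : K | t *+ c == b]| <= c)%N.
Proof.
move=> c0; have vE (t : K) : val (t *+ c) = (t * c %% k.+2)%N by rewrite Zp_mulrn.
have lt (t : K) : (t * c %/ k.+2 < c)%N.
  by rewrite ltn_divLR // mulnC ltn_pmul2l.
pose f (t : K) : 'I_c := Ordinal (lt t).
rewrite -[leqRHS]card_ord -(card_in_imset (f := f)); first exact: max_card.
move=> t t'; rewrite !inE => /eqP h /eqP h' [e]; apply: val_inj => /=.
have m : (t * c %% k.+2 = t' * c %% k.+2)%N by rewrite -!vE h h'.
have : (t * c = t' * c)%N by rewrite (divn_eq (t * c) k.+2) (divn_eq (t' * c) k.+2) e m.
by move/eqP; rewrite eqn_pmul2r // => /eqP.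
Qed.

Lemma attacksE (s t : 'I_k.+2 * 'I_k.+2) :
  attacks s t = [exists j, phi j (s : K * K) == phi j (t : K * K)].
Proof.
have e2 : (s.1 + s.2 == t.1 + t.2 %[mod k.+2])%N = ((s.1 : K) + s.2 == (t.1 : K) + t.2) by [].
have e3 : (s.1%:Z - s.2%:Z == t.1%:Z - t.2%:Z %[mod k.+2%:Z])%Z = ((s.1 : K) - s.2 == (t.1 : K) - t.2).
  have -> : ((s.1 : K) - s.2 == (t.1 : K) - t.2) = ((s.1 : K) + t.2 == (t.1 : K) + s.2).
    by rewrite subr_eq addrAC eq_sym subr_eq eq_sym.
  have -> : ((s.1 : K) + t.2 == (t.1 : K) + s.2) = (s.1 + t.2 == t.1 + s.2 %[mod k.+2])%N by [].
  rewrite eqz_mod_dvd -eqz_nat -!modz_nat !PoszD -[RHS]/(_ == _ %[mod _])%Z eqz_mod_dvd.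
  by congr (_ %| _)%Z; ring.
rewrite /attacks e2 e3; apply/or4P/existsP => [[] h|[[[|[|[|[|//]]]] hj] /eqP]]; rewrite /phi /=.
- by exists (Ordinal (isT : 0 < 4)%N).
- by exists (Ordinal (isT : 1 < 4)%N).
- by exists (Ordinal (isT : 2 < 4)%N).
- by exists (Ordinal (isT : 3 < 4)%N).
- by move=> ->; constructor 1.
- by move=> ->; constructor 2.
- by move=> ->; constructor 3.
- by move=> ->; constructor 4.
Qed.

Lemma toroidal_conf (S : {set 'I_k.+2 * 'I_k.+2}) : toroidal_queens S = (S \in conf K).
Proof.
apply/idP/idP => [/andP[/eqP sS /forall_inP hS]|hS].
  have inj j : {in S &, injective (phi j : K * K -> K)}.
    move=> s t sS' tS e; apply/eqP; apply: contraT => st.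
    have := forall_inP (hS s sS') t tS; rewrite st /= attacksE => /existsPn /(_ j).
    by rewrite e eqxx.
  rewrite inE; apply/forallP => -[j x]; rewrite eqn_leq; apply/andP; split.
    apply/card_le1_eqP => s t; rewrite !inE /= => /andP[sS' /eqP h] /andP[tS /eqP h'].
    by apply: (inj j) => //; rewrite h h'.
  (* There are n queens with n distinct values, so every line of type [j] is met. *)
  have full : [set phi j (s : K * K) | s in S] = [set: K].
    apply/eqP; rewrite eqEcard subsetT /= cardsT card_residues card_in_imset ?sS //.
  have : x \in [set: K] by [].
  rewrite -full => /imsetP[s sS' e]; rewrite card_gt0; apply/set0Pn; exists s.
  by rewrite !inE sS' /= e.
apply/andP; split; first by rewrite (conf_card hS) card_residues.
apply/forall_inP => s sS; apply/forall_inP => t tS; apply/implyP => st.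
rewrite attacksE; apply/existsPn => j; apply: contraNN st => /eqP e.
move: hS; rewrite inE => /forallP /(_ (j, phi j (s : K * K))) /eqP h.
have /card_le1_eqP le1 : (cov_count S (j, phi j (s : K * K)) <= 1)%N by rewrite h.
by apply/eqP; apply: le1; rewrite !inE /= ?sS ?tS ?e eqxx.
Qed.

Lemma T_conf : T k.+2 = #|conf K|.
Proof. by rewrite /T; apply: eq_card => S; rewrite inE toroidal_conf. Qed.

End Residues.

(** * Cube gadgets and the lattice generated by queens *)

From Stdlib Require Import ZArith.
From mathcomp Require Import ssrZ.

(* The sixteen vertices of a four-dimensional cube of queens: the even vertices cover
   the same lines as the odd ones. *)
Definition mask4 := (bool * bool * bool * bool)%type.

Definition vertex (M : zmodType) (a : M * M) (t : M * M * M * M) (b : mask4) : M * M :=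
  (a.1 + t.1.1.2 *+ b.1.1.2 + t.1.2 *+ b.1.2 + t.2 *+ b.2,
   a.2 + t.1.1.1 *+ b.1.1.1 - t.1.2 *+ b.1.2 + t.2 *+ b.2).

(** The origin is left out: that vertex is the queen to be replaced. The odd vertices are [e1], ...,
    [e4] and [triples]. *)
Definition evens : seq mask4 :=
  [:: (true, true, false, false); (true, false, true, false); (true, false, false, true);
      (false, true, true, false); (false, true, false, true); (false, false, true, true);
      (true, true, true, true)].
Definition triples : seq mask4 :=
  [:: (false, true, true, true); (true, false, true, true); (true, true, false, true);
      (true, true, true, false)].
Definition e1 : mask4 := (true, false, false, false).
Definition e2 : mask4 := (false, true, false, false).
Definition e3 : mask4 := (false, false, true, false).
Definition e4 : mask4 := (false, false, false, true).

Section Gadget.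
Variable M : zmodType.
Implicit Types (a : M * M) (r : M * M * M * M) (t : M).

(* The integers are an arbitrary choice for which [gad_check] succeeds: as [t] varies,
   the cells that the negative queens need from the template stay distinct. *)
Definition cube0 t := (t *+ 647, t *+ 790, t *+ 264, t *+ 927).
Definition shifted a t (e : mask4) := vertex a (cube0 t) e.
(** One side of each further cube undoes the displacement made by [cube0], so the vertex in that
    direction is the prescribed end whatever [t] is, while all other queens move with [t]. *)
Definition cube1 r t := (r.1.1.1 - t *+ 647, t *+ 319, t *+ 878, t *+ 387).
Definition cube2 r t := (t *+ 784, r.1.1.2 - t *+ 790, t *+ 646, t *+ 437).
Definition cube3 r t := (t *+ 846, t *+ 490, r.1.2 - t *+ 264, t *+ 488).
Definition cube4 r t := (t *+ 757, t *+ 758, t *+ 891, r.2 - t *+ 927).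

(* Replacing [a] by queens [gad_end a r] through its four lines: one cube at [a] and
   one further cube for each of its four neighbours. *)
Definition gad_pos a r t : seq (M * M) :=
  [seq vertex a (cube0 t) b | b <- evens]
  ++ [seq vertex (shifted a t e1) (cube1 r t) b | b <- evens]
  ++ [seq vertex (shifted a t e2) (cube2 r t) b | b <- evens]
  ++ [seq vertex (shifted a t e3) (cube3 r t) b | b <- evens]
  ++ [seq vertex (shifted a t e4) (cube4 r t) b | b <- evens].

Definition gad_neg a r t : seq (M * M) :=
  [seq vertex a (cube0 t) b | b <- triples]
  ++ [seq vertex (shifted a t e1) (cube1 r t) b | b <- [:: e2, e3, e4 & triples]]
  ++ [seq vertex (shifted a t e2) (cube2 r t) b | b <- [:: e1, e3, e4 & triples]]
  ++ [seq vertex (shifted a t e3) (cube3 r t) b | b <- [:: e1, e2, e4 & triples]]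
  ++ [seq vertex (shifted a t e4) (cube4 r t) b | b <- [:: e1, e2, e3 & triples]].

Definition gad_end a r : seq (M * M) :=
  [:: (a.1, a.2 + r.1.1.1); (a.1 + r.1.1.2, a.2); (a.1 + r.1.2, a.2 - r.1.2);
      (a.1 + r.2, a.2 + r.2)].

Definition coords (q : M * M) : seq M := [:: q.1; q.2; q.1 + q.2; q.1 - q.2].

(** The axis lines, up to sign, covered by the four template orbits that are exchanged to obtain
    [q]; [diag_cells] lists their diagonal lines. *)
Definition axis_cells (q : M * M) : seq M :=
  [:: q.1; q.1 *+ 3; q.2; q.2 *+ 3; q.1 + q.2; (q.1 + q.2) *+ 2; q.1 - q.2; (q.1 - q.2) *+ 2].
Definition diag_cells (q : M * M) : seq M :=
  [:: q.1 *+ 2; q.1 *+ 4; q.2 *+ 2; q.2 *+ 4; q.1 + q.2; (q.1 + q.2) *+ 3; q.1 - q.2;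
      (q.1 - q.2) *+ 3].

(** All entries are nonzero exactly when the elements of [s] are pairwise distinct up to sign. *)
Fixpoint gaps (s : seq M) : seq M :=
  if s is x :: s' then [seq x - y | y <- s'] ++ [seq x + y | y <- s'] ++ gaps s' else [::].

Definition gad_forms a r t : seq M :=
  flatten [seq coords q | q <- gad_pos a r t ++ gad_neg a r t]
  ++ gaps (flatten [seq axis_cells q | q <- gad_neg a r t])
  ++ gaps (flatten [seq diag_cells q | q <- gad_neg a r t]).

Definition root_forms a r : seq M := flatten [seq coords q | q <- a :: gad_end a r].

End Gadget.

(* Integral linear forms in the two coordinates of [a], the four of [r], and [t]. *)
Definition zform : zmodType := (Z * Z * Z * Z * Z * Z * Z)%type.
Definition X0 : zform := (1, 0, 0, 0, 0, 0, 0)%Z.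
Definition Y0 : zform := (0, 1, 0, 0, 0, 0, 0)%Z.
Definition R0 : zform * zform * zform * zform :=
  ((0, 0, 1, 0, 0, 0, 0), (0, 0, 0, 1, 0, 0, 0), (0, 0, 0, 0, 1, 0, 0), (0, 0, 0, 0, 0, 1, 0))%Z.
Definition T0 : zform := (0, 0, 0, 0, 0, 0, 1)%Z.

(** The multipliers have only the prime factors 2 and 3, which are units, so these multiples vanish
    only if [F] does. *)
Definition mulz_forms (F : zform) : seq zform :=
  [:: F; F *+ 2; F *+ 3; F *+ 4; F *+ 6; - F; - (F *+ 2); - (F *+ 3); - (F *+ 4); - (F *+ 6)].

Definition unit_forms : seq zform :=
  flatten [seq mulz_forms F | F <- root_forms (X0, Y0) R0].

Definition form_eqb (F G : zform) : bool :=
  let: (a1, a2, a3, a4, a5, a6, a7) := F in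
  let: (b1, b2, b3, b4, b5, b6, b7) := G in
  [&& Z.eqb a1 b1, Z.eqb a2 b2, Z.eqb a3 b3, Z.eqb a4 b4, Z.eqb a5 b5, Z.eqb a6 b6 & Z.eqb a7 b7].

(* A form is harmless if it involves [t], or if it is a small multiple of a root form,
   which does not vanish. *)
Definition form_ok (F : zform) : bool :=
  ~~ Z.eqb F.2 0 || has (form_eqb F) unit_forms.

Fixpoint gaps_all (M : zmodType) (p : pred M) (s : seq M) : bool :=
  if s is x :: s' then
    [&& all (fun y => p (x - y)) s', all (fun y => p (x + y)) s' & gaps_all p s']
  else true.

(** The first clause is stricter than [form_ok]: every coordinate of a negative queen must involve
    [t], so that it hits a forbidden value for few [t] only. *)
Definition gad_check : bool :=
  let N := gad_neg (X0, Y0) R0 T0 in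
  [&& all (fun F : zform => ~~ Z.eqb F.2 0) (flatten [seq coords q | q <- N]),
      all form_ok (flatten [seq coords q | q <- gad_pos (X0, Y0) R0 T0 ++ N]),
      gaps_all form_ok (flatten [seq axis_cells q | q <- N])
    & gaps_all form_ok (flatten [seq diag_cells q | q <- N])].

Lemma gad_checkT : gad_check.
Proof. by vm_compute. Qed.

From mathcomp Require Import all_boot all_order all_algebra.
From mathcomp Require Import ring lra zify ssrZ.
Import Order.TTheory GRing.Theory Num.Theory.

Section Lattice.
Variable K : finComUnitRingType.
Implicit Types (q : K * K) (x y z w a b c : K) (f g : vec K).
Hypothesis u2 : (2 : K) \is a GRing.unit.
Hypothesis bigK : (100 < #|K|)%N.

Lemma avoid100 (s : seq K) : (size s <= 100)%N -> exists z, z \notin s.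
Proof. by move=> h; apply: avoid; exact: leq_ltn_trans bigK. Qed.

(* [f] is a difference of two sums of at most [k] queens that avoid the zero lines. *)
Definition rep (k : nat) f := exists P N : seq (K * K),
  [/\ f = csum P - csum N, all (@nonzero K) P, all (@nonzero K) N,
      (size P <= k)%N & (size N <= k)%N].

Lemma rep_eq k f g : f = g -> rep k f -> rep k g. Proof. by move=> ->. Qed.

Lemma rep_leq k l f : (k <= l)%N -> rep k f -> rep l f.
Proof.
move=> kl [P [N [h1 h2 h3 h4 h5]]]; exists P, N; split=> //; exact: leq_trans kl.
Qed.

Lemma rep0 : rep 0 0.
Proof. by exists [::], [::]; split; rewrite // subrr. Qed.

Lemma repD k l f g : rep k f -> rep l g -> rep (k + l) (f + g).
Proof.
move=> [P [N [-> h2 h3 h4 h5]]] [P' [N' [-> h2' h3' h4' h5']]].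
exists (P ++ P'), (N ++ N'); rewrite !all_cat h2 h3 h2' h3' !size_cat !leq_add //.
by split=> //; rewrite !csum_cat opprD addrACA.
Qed.

Lemma repN k f : rep k f -> rep k (- f).
Proof.
by move=> [P [N [-> h2 h3 h4 h5]]]; exists N, P; split=> //; rewrite opprB.
Qed.

Definition second_diff (j : nat) z a b : vec K :=
  dl j z - dl j (z + a) - dl j (z + b) + dl j (z + a + b).

(** The zero lines belong to the central queen of the template and must never be used. *)
Definition good z a b := [&& z != 0, z + a != 0, z + b != 0 & z + a + b != 0].

Lemma second_diffC j z a b : second_diff j z a b = second_diff j z b a.
Proof. by rewrite /second_diff (addrAC z a b) (addrAC (dl j z)). Qed.

Lemma goodC z a b : good z a b = good z b a.
Proof. by rewrite /good (addrAC z a b); case: (z != 0) => //=; rewrite andbCA. Qed.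

Lemma second_diff0 j z a : second_diff j z a 0 = 0.
Proof. by apply/ffunP=> l; rewrite /second_diff !addr0 !vecE; ring. Qed.

(* Four queens at the corners of a parallelogram in the diagonal coordinates. *)
Lemma second_diff_unit z w a b : good z a b -> good w (- a) b ->
  [&& z + w != 0, z + w + 2 * b != 0, z - w != 0 & z - w + 2 * a != 0] ->
  rep 2 (second_diff 2 z a b + second_diff 3 w (- a) b).
Proof.
move=> /and4P[g1 g2 g3 g4] /and4P[d1 d2 d3 d4] /and4P[e1 e2 e3 e4].
pose x := (z + w) / 2; pose y := (z - w) / 2.
have u2n (t : K) : t != 0 -> t / 2 != 0.
  by apply: contraNN => /eqP h; rewrite -(divrK u2 t) h mul0r.
have xyE : x + y = z.
  by rewrite /x /y -mulrDl (_ : z + w + (z - w) = z * 2) ?mulrK //; ring.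
have xyF : x - y = w.
  by rewrite /x /y -mulrBl (_ : z + w - (z - w) = w * 2) ?mulrK //; ring.
exists [:: (x, y); (x + b, y + a)], [:: (x, y + a); (x + b, y)].
have E1 : x + (y + a) = z + a by rewrite addrA xyE.
have E2 : x - (y + a) = w - a by rewrite opprD addrA xyF.
have E3 : x + b + y = z + b by rewrite addrAC xyE.
have E4 : x + b - y = w + b by rewrite addrAC xyF.
have E5 : x + b + (y + a) = z + a + b by rewrite addrACA xyE (addrC b) addrA.
have E6 : x + b - (y + a) = w - a + b by rewrite opprD addrACA xyF (addrC b) addrA.
have x0 : x != 0 by apply: u2n.
have y0 : y != 0 by apply: u2n.
have x1 : x + b != 0.
  have -> : x + b = (z + w + 2 * b) / 2 by rewrite mulrDl (mulrC 2) mulrK.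
  exact: u2n.
have y1 : y + a != 0.
  have -> : y + a = (z - w + 2 * a) / 2 by rewrite mulrDl (mulrC 2) mulrK.
  exact: u2n.
split=> //=; last 2 first.
- by rewrite /nonzero /= xyE xyF E5 E6 x0 y0 x1 y1 g1 d1 g4 d4.
- by rewrite /nonzero /= E1 E2 E3 E4 x0 y0 x1 y1 g2 d2 g3 d3.
rewrite !csum_cons !csum0 /cov /= xyE xyF E1 E2 E3 E4 E5 E6 /second_diff.
by apply/ffunP=> l; rewrite !vecE; ring.
Qed.

(** Two parallelograms with the same [w] are subtracted; their second differences of type 3
    cancel. *)
Lemma second_diff_shift z z' a b : good z a b -> good z' a b ->
  rep 4 (second_diff 2 z a b - second_diff 2 z' a b).
Proof.
move=> g g'.
(* Four values are excluded for [good w (- a) b], and four side conditions of [second_diff_unit] for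
   each of [z] and [z']. *)
have [w] := @avoid100 [:: 0; a; - b; a - b; - z; - z - 2 * b; - z'; - z' - 2 * b;
  z; z + 2 * a; z'; z' + 2 * a] isT.
rewrite !inE !negb_or => /andP[w1 /andP[w2 /andP[w3 /andP[w4 /andP[w5 /andP[w6
 /andP[w7 /andP[w8 /andP[w9 /andP[w10 /andP[w11 w12]]]]]]]]]]].
have gw : good w (- a) b by rewrite /good; nz.
have h (t : K) : w != - t -> w != - t - 2 * b -> w != t -> w != t + 2 * a ->
    [&& t + w != 0, t + w + 2 * b != 0, t - w != 0 & t - w + 2 * a != 0].
  by move=> t1 t2 t3 t4; nz.
have e1 := second_diff_unit g gw (h z w5 w6 w9 w10).
have e2 := repN (second_diff_unit g' gw (h z' w7 w8 w11 w12)).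
by apply: rep_eq (repD e1 e2); apply/ffunP=> l; rewrite !vecE; ring.
Qed.

(** Moving [z] to a generic [t] beforehand removes the side conditions of [second_diff_unit]. *)
Lemma second_diff_swap z w a b : good z a b -> good w (- a) b ->
  rep 6 (second_diff 2 z a b + second_diff 3 w (- a) b).
Proof.
move=> g gw.
have [t] := @avoid100 [:: 0; - a; - b; - a - b; - w; - w - 2 * b;
  w; w - 2 * a] isT.
rewrite !inE !negb_or => /andP[w1 /andP[w2 /andP[w3 /andP[w4 /andP[w5 /andP[w6
 /andP[w7 w8]]]]]]].
have gt : good t a b by rewrite /good; nz.
have h : [&& t + w != 0, t + w + 2 * b != 0, t - w != 0 & t - w + 2 * a != 0] by nz.
by apply: rep_eq (repD (second_diff_shift g gt) (second_diff_unit gt gw h)); apply/ffunP=> l;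
  rewrite !vecE; ring.
Qed.

Lemma exgood2 a b c : exists z, good z a b && good (z + b) a c.
Proof.
have [z] := @avoid100 [:: 0; - a; - b; - a - b; - b - a; - b - c; - b - a - c] isT.
rewrite !inE !negb_or => /andP[w1 /andP[w2 /andP[w3 /andP[w4 /andP[w5 /andP[w6 w7]]]]]].
by exists z; rewrite /good; nz.
Qed.

Lemma exgood a b : exists z, good z a b.
Proof. by have [z /andP[? _]] := exgood2 a b 0; exists z. Qed.

(** Based at [z] and [z + b], the second differences with steps [b] and [c] telescope exactly to the
    one with step [b + c]; three shifts bring all of them to such base points. *)
Lemma second_diff_bilin z1 z2 z3 a b c : good z1 a b -> good z2 a c -> good z3 a (b + c) ->
  rep 12 (second_diff 2 z1 a b + second_diff 2 z2 a c - second_diff 2 z3 a (b + c)).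
Proof.
move=> g1 g2 g3; have [z /andP[h1 h2]] := exgood2 a b c.
have h3 : good z a (b + c).
  move: h1 h2 => /and4P[a1 a2 a3 a4] /and4P[b1 b2 b3 b4].
  by rewrite /good a1 a2 !addrA b3 (addrAC z a b) b4.
have e := repD (repD (second_diff_shift g1 h1) (second_diff_shift g2 h2)) (second_diff_shift h3 g3).
apply: rep_eq e; apply/ffunP=> l; rewrite /second_diff !vecE.
rewrite !addrA (addrAC z a b); ring.
Qed.

(* Halving [k] repeatedly moves it from one side of the second difference to the
   other at logarithmic cost. *)
Lemma second_diff_dbl (l k : nat) z z' b : (k < 2 ^ l)%N -> good z k%:R b -> good z' 1 (k%:R * b) ->
  rep (48 * l) (second_diff 2 z k%:R b - second_diff 2 z' 1 (k%:R * b)).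
Proof.
elim: l k z z' b => [|l IH] k z z' b.
  rewrite expn0 ltnS leqn0 => /eqP -> _ _.
  by rewrite mul0r second_diff0 second_diffC second_diff0 subrr muln0; exact: rep0.
move=> kl g g'.
have [z1 h1] := exgood (k./2)%:R b.
have [z2 h2] := exgood (k./2)%:R (b + b).
have [z3 h3] := exgood 1 ((k./2)%:R * (b + b)).
have [z4 h4] := exgood ((k./2)%:R + (k./2)%:R) b.
have [z5 h5] := exgood (odd k)%:R b.
have [z6 h6] := exgood 1 ((odd k)%:R * b).
have kE : k%:R = (k./2)%:R + (k./2)%:R + (odd k)%:R :> K.
  by rewrite -!natrD addnn addnC odd_double_half.
have kl' : (k./2 < 2 ^ l)%N.
  by move: kl; rewrite expnS; have := odd_double_half k; clear; lia.
have hodd : rep 0 (second_diff 2 z5 (odd k)%:R b - second_diff 2 z5 1 ((odd k)%:R * b)).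
  case: (odd k) => /=; last first.
    by rewrite mul0r second_diff0 second_diffC second_diff0 subrr; exact: rep0.
  by rewrite mulr1n mul1r subrr; exact: rep0.
have h5' : good z5 1 ((odd k)%:R * b) \/ second_diff 2 z5 1 ((odd k)%:R * b) = 0.
  case: (odd k) (h5) => /=; first by rewrite !mulr1n mul1r; left.
  by right; rewrite mul0r second_diff0.
have e1 : rep 12 (second_diff 2 z4 ((k./2)%:R + (k./2)%:R) b + second_diff 2 z5 (odd k)%:R b
    - second_diff 2 z k%:R b).
  rewrite ![second_diff 2 _ _ b]second_diffC kE; apply: second_diff_bilin; rewrite 1?goodC //.
  by rewrite -kE.
have e2 : rep 12 (second_diff 2 z1 (k./2)%:R b + second_diff 2 z1 (k./2)%:R b
    - second_diff 2 z4 ((k./2)%:R + (k./2)%:R) b).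
  by rewrite ![second_diff 2 _ _ b]second_diffC; apply: second_diff_bilin; rewrite // goodC.
have e3 := second_diff_bilin h1 h1 h2.
have e4 := IH _ _ _ _ kl' h2 h3.
have e5 : rep 12 (second_diff 2 z3 1 ((k./2)%:R * (b + b)) + second_diff 2 z5 1 ((odd k)%:R * b)
   - second_diff 2 z' 1 (k%:R * b)).
  have E : k%:R * b = (k./2)%:R * (b + b) + (odd k)%:R * b by rewrite kE; ring.
  case: h5' => [h5'|h5'].
    by rewrite E; apply: second_diff_bilin; rewrite // -E.
  case: (boolP (odd k)) h5 h5' E => o h5 h5' E.
    by rewrite E; apply: second_diff_bilin; rewrite -?E // mulr1n mul1r; move: h5; rewrite mulr1n.
  rewrite mul0r addr0 in E.
  rewrite h5' addr0; apply: rep_leq (_ : 4 <= 12)%N _ => //.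
  by rewrite E; apply: second_diff_shift => //; rewrite -E.
have e := repD (repD (repD (repD (repN e1) (repN e2)) e3) e4) (repD hodd e5).
apply: rep_leq (rep_eq _ e); first by clear; lia.
by apply/ffunP=> t; rewrite !vecE; ring.
Qed.

End Lattice.

(** * Moments, the invariants of the lattice of queens *)

Section Moment.
Variable K : finComUnitRingType.
Implicit Types (q : K * K) (x y z w a b c G : K) (f g : vec K).

Section Weight.
Variable w : nat -> K -> K.

Definition moment f : K := \sum_(p : 'I_4 * K) w p.1 p.2 *~ f p.

Lemma momentD f g : moment (f + g) = moment f + moment g.
Proof.
by rewrite /moment -big_split /=; apply: eq_bigr => p _; rewrite vecE mulrzDr.
Qed.

Lemma momentN f : moment (- f) = - moment f.
Proof.
by rewrite /moment -sumrN; apply: eq_bigr => p _; rewrite vecE mulrNz.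
Qed.

Lemma moment0 : moment 0 = 0.
Proof. by rewrite /moment big1 // => p _; rewrite vecE mulr0z. Qed.

Lemma moment_dl (j : nat) z : (j < 4)%N -> moment (dl j z) = w j z.
Proof.
move=> j4; rewrite /moment (bigD1 (Ordinal j4, z)) //= dlE /= !eqxx mulr1z big1 ?addr0 // => -[i y].
rewrite xpair_eqE dlE /= => /negbTE h.
by rewrite -[_ && _]/((i == Ordinal j4) && (y == z)) h mulr0z.
Qed.

Lemma moment_sum (I : Type) (s : seq I) (F : I -> vec K) :
  moment (\sum_(i <- s) F i) = \sum_(i <- s) moment (F i).
Proof.
by elim: s => [|i s IH]; rewrite !(big_nil, big_cons) ?moment0 // momentD IH.
Qed.

Hypothesis w_cov : forall x y, w 0 x + w 1 y + w 2 (x + y) + w 3 (x - y) = 0.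

Lemma moment_cov q : moment (cov q) = 0.
Proof. by rewrite /cov !momentD !moment_dl. Qed.

Lemma moment_csum s : moment (csum s) = 0.
Proof. by rewrite moment_sum big1 // => q _; exact: moment_cov. Qed.

Lemma moment_rep k f : rep k f -> moment f = 0.
Proof. by move=> [P [N [-> _ _ _ _]]]; rewrite momentD momentN !moment_csum subrr. Qed.

End Weight.

(** The parallelogram law: 2x^2 + 2y^2 = (x+y)^2 + (x-y)^2. *)
Definition quad (j : nat) z : K := if (j < 2)%N then - (2 * z ^+ 2) else z ^+ 2.

Lemma quad_cov x y : quad 0 x + quad 1 y + quad 2 (x + y) + quad 3 (x - y) = 0.
Proof. by rewrite /quad /=; ring. Qed.

Lemma quad_sd z a b : moment quad (second_diff 2 z a b) = 2 * (a * b).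
Proof. by rewrite /second_diff !(momentD, momentN) !moment_dl // /quad /=; ring. Qed.

End Moment.

Section Reduction.
Variable K : finComUnitRingType.
Implicit Types (q : K * K) (x y z w a b c G : K) (f g : vec K).
Hypothesis u2 : (2 : K) \is a GRing.unit.
Hypothesis bigK : (100 < #|K|)%N.
Variable l : nat.
Hypothesis hcyc : forall x, exists2 k : nat, (k < 2 ^ l)%N & x = k%:R.

(* Modulo queens a second difference depends only on the product of its two steps;
   [f] is equivalent to the one with product [G]. *)
Definition reduces (k : nat) f G := forall z, good z 1 G -> rep k (f - second_diff 2 z 1 G).

Lemma reduces_leq k k' f G : (k <= k')%N -> reduces k f G -> reduces k' f G.
Proof. by move=> h r z /r; exact: rep_leq. Qed.

Lemma reduces_rep k k' f g G : rep k f -> reduces k' g G -> reduces (k + k') (f + g) G.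
Proof. by move=> h r z /r e; rewrite -addrA; exact: repD. Qed.

Lemma reduces0 : reduces 0 0 0.
Proof. by move=> z _; rewrite second_diff0 subrr; exact: rep0. Qed.

Lemma reducesD k k' f g G G' : reduces k f G -> reduces k' g G' ->
  reduces (k + k' + 12) (f + g) (G + G').
Proof.
move=> h1 h2 z hz.
have [z1 g1] := exgood bigK 1 G; have [z2 g2] := exgood bigK 1 G'.
have := repD (repD (h1 _ g1) (h2 _ g2)) (second_diff_bilin u2 bigK g1 g2 hz).
by apply: rep_eq; apply/ffunP=> p; rewrite !vecE; ring.
Qed.

Lemma reducesN k f G : reduces k f G -> reduces (k + 12) (- f) (- G).
Proof.
move=> h z hz.
have [z1 g1] := exgood bigK 1 G; have [z2 g2] := exgood bigK 1 (G + - G).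
have := repN (repD (h _ g1) (second_diff_bilin u2 bigK g1 hz g2)).
by apply: rep_eq; rewrite subrr second_diff0; apply/ffunP=> p; rewrite !vecE; ring.
Qed.

Lemma reduces_sd2 z a b : good z a b -> reduces (48 * l) (second_diff 2 z a b) (a * b).
Proof.
move=> g z' g'; have [k kl E] := hcyc a.
by move: g g'; rewrite E => g g'; exact: second_diff_dbl.
Qed.

Lemma reduces_sd3 w a b : good w a b -> reduces (48 * l + 18) (second_diff 3 w a b) (a * b).
Proof.
move=> g; have [z gz] := exgood bigK (- a) b.
have gw : good w (- - a) b by rewrite opprK.
have := reduces_rep (second_diff_swap u2 bigK gz gw) (reducesN (reduces_sd2 gz)).
rewrite opprK mulNr opprK addrAC subrr add0r => h.
by apply: reduces_leq h; clear; lia.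
Qed.

Lemma reduces_sd (j : nat) w a b : (j == 2) || (j == 3) -> good w a b ->
  reduces (48 * l + 18) (second_diff j w a b) (a * b).
Proof.
case/orP=> /eqP -> g; last exact: reduces_sd3.
by apply: reduces_leq (reduces_sd2 g); clear; lia.
Qed.

(** A difference of two lines of one type can be translated at the cost of a second difference.
    Hence a sum of differences telescopes to a single one with the total displacement, which is zero
    in the application. *)
Lemma reduces_diffs (j : nat) (ps : seq (K * K)) z : (j == 2) || (j == 3) ->
  all (fun p => (p.1 != 0) && (p.2 != 0)) ps ->
  z != 0 -> z + \sum_(p <- ps) (p.1 - p.2) != 0 ->
  exists G, reduces (size ps * (96 * l + 84))
    (\sum_(p <- ps) (dl j p.1 - dl j p.2)
      - (dl j (z + \sum_(p <- ps) (p.1 - p.2)) - dl j z)) G.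
Proof.
move=> hj; elim: ps z => [|[s t] ps IH] z /=.
  by move=> _ _ _; exists 0; rewrite !big_nil addr0 subrr subr0; exact: reduces0.
move=> /andP[/andP[/= s0 t0] aps] z0; rewrite !big_cons /=.
set D := \sum_(p <- ps) _ => z1.
(* The tail is folded at a generic base point [w] and then carried to [z], so that no intermediate
   line is a zero line. *)
have [w] := @avoid100 K bigK ([:: 0; - D; - D - (s - t)]) isT.
rewrite !inE !negb_or => /and3P[w1 w2 w3].
have w4 : w + D != 0 by nz.
have [G hG] := IH w aps w1 w4.
have g1 : good t (s - t) (w + D - t) by rewrite /good; nz.
have g2 : good w (s - t + D) (z - w) by rewrite /good; nz.
have h1 := reducesN (reduces_sd hj g1).
have h2 := reducesN (reduces_sd hj g2).
exists (G + - ((s - t) * (w + D - t)) + - ((s - t + D) * (z - w))).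
move=> y hy; have := reducesD (reducesD hG h1) h2 hy => r.
apply: rep_leq (rep_eq _ r); first by clear; lia.
congr (_ - _); rewrite /second_diff -/D.
have -> : t + (s - t) = s by ring.
have -> : t + (w + D - t) = w + D by ring.
have -> : s + (w + D - t) = w + (s - t + D) by ring.
have -> : w + (z - w) = z by ring.
have -> : w + (s - t + D) + (z - w) = z + (s - t + D) by ring.
by apply/ffunP=> p; rewrite !vecE; ring.
Qed.

(* Pairing the lines reduces everything to one second difference, whose product is
   then forced to vanish by the quadratic moment. *)
Lemma lattice_rep (ts : seq ((K * K) * (K * K))) :
  (2 * size ts + 3 < #|K|)%N ->
  all (fun t => [&& t.1.1 != 0, t.1.2 != 0, t.2.1 != 0 & t.2.2 != 0]) ts ->
  \sum_(t <- ts) (t.2.1 - t.1.1 - t.1.2) = 0 ->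
  \sum_(t <- ts) (t.2.2 - t.1.1 + t.1.2) = 0 ->
  \sum_(t <- ts) (t.2.1 ^+ 2 + t.2.2 ^+ 2 - 2 * t.1.1 ^+ 2 - 2 * t.1.2 ^+ 2) = 0 ->
  rep ((size ts).+1 * (400 * l + 400))
    (\sum_(t <- ts) (dl 0 t.1.1 + dl 1 t.1.2 + dl 2 t.2.1 + dl 3 t.2.2)).
Proof.
move=> hsz hall hS hD hQ.
(* With an auxiliary column [y] and row [x], the queens (r, y) and (x, c) minus (x, y) cover row r
   and column c of a quadruple. Only differences of diagonals are then left. *)
have [y] : exists y, y \notin 0 :: [seq - t.1.1 | t <- ts] ++ [seq t.1.1 | t <- ts].
  apply: avoid; apply: leq_trans hsz; rewrite /= size_cat !size_map; clear; lia.
rewrite inE mem_cat !negb_or => /and3P[y0 /mapP yr /mapP yr'].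
have [x] : exists x, x \notin [:: 0; y; - y] ++ [seq - t.1.2 | t <- ts] ++ [seq t.1.2 | t <- ts].
  apply: avoid; apply: leq_trans hsz; rewrite /= size_cat !size_map; clear; lia.
rewrite !mem_cat !inE !negb_or => /and3P[/and3P[x0 xy xy'] /mapP xc /mapP xc'].
pose f2 := [seq (t.2.1, t.1.1 + y) | t <- ts] ++ [seq (x + y, x + t.1.2) | t <- ts].
pose f3 := [seq (t.2.2, t.1.1 - y) | t <- ts] ++ [seq (x - y, x - t.1.2) | t <- ts].
have E2 : \sum_(p <- f2) (p.1 - p.2) = 0.
  rewrite big_cat !big_map /= -big_split /= -[RHS]hS.
  by apply: eq_bigr => t _; ring.
have E3 : \sum_(p <- f3) (p.1 - p.2) = 0.
  rewrite big_cat !big_map /= -big_split /= -[RHS]hD.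
  by apply: eq_bigr => t _; ring.
have n1 t : t \in ts -> [/\ t.1.1 + y != 0, x + t.1.2 != 0, t.1.1 - y != 0 & x - t.1.2 != 0].
  move=> ht; split; [rewrite addrC addr_eq0|rewrite addr_eq0|rewrite subr_eq0 eq_sym|rewrite subr_eq0].
  - by apply/eqP=> e; apply: yr; exists t.
  - by apply/eqP=> e; apply: xc; exists t.
  - by apply/eqP=> e; apply: yr'; exists t.
  - by apply/eqP=> e; apply: xc'; exists t.
have xy1 : x + y != 0 by nz.
have xy2 : x - y != 0 by nz.
have A2 : all (fun p => (p.1 != 0) && (p.2 != 0)) f2.
  rewrite all_cat !all_map; apply/andP; split; apply/allP=> t ht /=.
    by have [-> _ _ _] := n1 t ht; have /and4P[_ _ -> _] := allP hall t ht.
  by have [_ -> _ _] := n1 t ht; rewrite xy1.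
have A3 : all (fun p => (p.1 != 0) && (p.2 != 0)) f3.
  rewrite all_cat !all_map; apply/andP; split; apply/allP=> t ht /=.
    by have [_ _ -> _] := n1 t ht; have /and4P[_ _ _ ->] := allP hall t ht.
  by have [_ _ _ ->] := n1 t ht; rewrite xy2.
have e2 : y + \sum_(p <- f2) (p.1 - p.2) != 0 by rewrite E2 addr0.
have e3 : y + \sum_(p <- f3) (p.1 - p.2) != 0 by rewrite E3 addr0.
have [G2 h2] := reduces_diffs (isT : (2 == 2) || (2 == 3))%N A2 y0 e2.
have [G3 h3] := reduces_diffs (isT : (3 == 2) || (3 == 3))%N A3 y0 e3.
have h := reducesD h2 h3; move: h; rewrite E2 E3 !addr0 !subrr !subr0 !size_cat !size_map.
rewrite !big_cat !big_map /= -!big_split /=.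
set f := (X in reduces _ X _); set G := G2 + G3 => h.
have r0 : rep (2 * size ts) (\sum_(t <- ts) (cov (t.1.1, y) + cov (x, t.1.2) - cov (x, y))).
  exists ([seq (t.1.1, y) | t <- ts] ++ [seq (x, t.1.2) | t <- ts]), [seq (x, y) | t <- ts].
  rewrite !size_cat !size_map; split; try (clear; lia).
  - rewrite csum_cat /csum !big_map -sumrN -!big_split /=.
    by apply: eq_bigr.
  - rewrite all_cat !all_map; apply/andP; split; apply/allP=> t ht /=;
      have [a1 a2 a3 a4] := n1 t ht; have /and4P[b1 b2 _ _] := allP hall t ht.
      by rewrite /nonzero /= a1 a3 b1 y0.
    by rewrite /nonzero /= a2 a4 b2 x0.
  - by rewrite all_map; apply/allP=> t _; rewrite /nonzero /= x0 y0 xy1 xy2.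
have [z gz] := exgood bigK 1 G.
have r := repD r0 (h z gz).
set L := (X in rep _ X).
have EL : \sum_(t <- ts) (cov (t.1.1, y) + cov (x, t.1.2) - cov (x, y)) + f = L.
  rewrite /f /L -!big_split /=; apply: eq_bigr => t _; rewrite /cov /=.
  by apply/ffunP=> p; rewrite !vecE; ring.
rewrite addrA EL in r.
have G0 : G = 0.
  have := moment_rep (@quad_cov K) r; rewrite momentD momentN quad_sd mul1r /L moment_sum.
  rewrite (eq_bigr (fun t => t.2.1 ^+ 2 + t.2.2 ^+ 2 - 2 * t.1.1 ^+ 2 - 2 * t.1.2 ^+ 2)).
    by rewrite hQ sub0r => /eqP; rewrite oppr_eq0 => /eqP e; rewrite -(mulKr u2 G) e mulr0.
  by move=> t _; rewrite !momentD !moment_dl // /quad /=; ring.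
move: r; rewrite G0 second_diff0 subr0; apply: rep_leq; move: (size ts) => m; clear; nia.
Qed.

End Reduction.

Section CubeIdentity.
Variable K : finComUnitRingType.
Implicit Types (a : K * K) (r t : K * K * K * K) (tau : K).

Lemma cov_vertex a t (b : mask4) :
  cov (vertex a t b) =
    dl 0 (a.1 + t.1.1.2 *+ b.1.1.2 + t.1.2 *+ b.1.2 + t.2 *+ b.2)
  + dl 1 (a.2 + t.1.1.1 *+ b.1.1.1 - t.1.2 *+ b.1.2 + t.2 *+ b.2)
  + dl 2 (a.1 + a.2 + t.1.1.1 *+ b.1.1.1 + t.1.1.2 *+ b.1.1.2 + t.2 *+ b.2 *+ 2)
  + dl 3 (a.1 - a.2 - t.1.1.1 *+ b.1.1.1 + t.1.1.2 *+ b.1.1.2 + t.1.2 *+ b.1.2 *+ 2).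
Proof.
rewrite /cov /vertex /=.
have E2 (x y u1 u2 u3 u4 : K) :
  x + u2 + u3 + u4 + (y + u1 - u3 + u4) = x + y + u1 + u2 + u4 *+ 2 by ring.
have E3 (x y u1 u2 u3 u4 : K) :
  x + u2 + u3 + u4 - (y + u1 - u3 + u4) = x - y - u1 + u2 + u3 *+ 2 by ring.
by congr (_ + _ + dl 2 _ + dl 3 _); [exact: E2 | exact: E3].
Qed.

Definition vsum (a : K * K) t (s : seq mask4) : vec K := \sum_(b <- s) cov (vertex a t b).

Lemma csum_vertex a t s : csum [seq vertex a t b | b <- s] = vsum a t s.
Proof. by rewrite /csum big_map. Qed.

(** Each of the four sides of the cube preserves one type of line. For a given type, the even and
    the odd vertices are therefore matched along the side that preserves it. *)
Lemma cube_sum a t :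
  cov a + vsum a t evens = vsum a t [:: e1, e2, e3, e4 & triples].
Proof.
have -> : cov a = cov (vertex a t (false, false, false, false)).
  by rewrite /vertex /= !mulr0n subr0 !addr0; case: (a).
apply/ffunP=> p.
pose A b2 b3 b4 := dl 0 (a.1 + t.1.1.2 *+ nat_of_bool b2 + t.1.2 *+ nat_of_bool b3 + t.2 *+ nat_of_bool b4) p.
pose B b1 b3 b4 := dl 1 (a.2 + t.1.1.1 *+ nat_of_bool b1 - t.1.2 *+ nat_of_bool b3 + t.2 *+ nat_of_bool b4) p.
pose C b1 b2 b4 := dl 2 (a.1 + a.2 + t.1.1.1 *+ nat_of_bool b1 + t.1.1.2 *+ nat_of_bool b2 + t.2 *+ nat_of_bool b4 *+ 2) p.
pose D b1 b2 b3 := dl 3 (a.1 - a.2 - t.1.1.1 *+ nat_of_bool b1 + t.1.1.2 *+ nat_of_bool b2 + t.1.2 *+ nat_of_bool b3 *+ 2) p.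
have F b1 b2 b3 b4 : cov (vertex a t (b1, b2, b3, b4)) p
    = A b2 b3 b4 + B b1 b3 b4 + C b1 b2 b4 + D b1 b2 b3.
  by rewrite cov_vertex !vecD.
rewrite vecD /vsum; move: A B C D F => A B C D; move: (vertex a t) => V F.
have G s : (\sum_(b <- s) cov (V b)) p = \sum_(b <- s) cov (V b) p.
  by elim: s => [|b s IH]; rewrite !(big_nil, big_cons) ?vecE // IH.
rewrite !G F /evens /triples /e1 /e2 /e3 /e4 !big_cons !big_nil !F.
by ring.
Qed.

Lemma cube_sum1 a t : cov a + vsum a t evens
  = cov (vertex a t e1) + vsum a t [:: e2, e3, e4 & triples].
Proof. by rewrite cube_sum /vsum big_cons. Qed.

Lemma cube_sum2 a t : cov a + vsum a t evens
  = cov (vertex a t e2) + vsum a t [:: e1, e3, e4 & triples].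
Proof. by rewrite cube_sum /vsum [in LHS]big_cons [in LHS]big_cons addrCA [in RHS]big_cons. Qed.

Lemma cube_sum3 a t : cov a + vsum a t evens
  = cov (vertex a t e3) + vsum a t [:: e1, e2, e4 & triples].
Proof.
rewrite cube_sum /vsum; do 3 rewrite [in LHS]big_cons; do 2 rewrite [in RHS]big_cons.
by move: (\sum_(b <- _) _) => S; apply/ffunP=> p; rewrite !vecD; ring.
Qed.

Lemma cube_sum4 a t : cov a + vsum a t evens
  = cov (vertex a t e4) + vsum a t [:: e1, e2, e3 & triples].
Proof.
rewrite cube_sum /vsum; do 4 rewrite [in LHS]big_cons; do 3 rewrite [in RHS]big_cons.
by move: (\sum_(b <- _) _) => S; apply/ffunP=> p; rewrite !vecD; ring.
Qed.

(** The cube at [a] trades [a] for its four neighbours, and each further cube trades a neighbour for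
    an end; the neighbours cancel in the sum of the five identities. *)
Lemma gad_sum a r tau :
  cov a + csum (gad_pos a r tau) = csum (gad_end a r) + csum (gad_neg a r tau).
Proof.
have h0 : cov a + vsum a (cube0 tau) evens = cov (shifted a tau e1) + (cov (shifted a tau e2)
    + (cov (shifted a tau e3) + (cov (shifted a tau e4) + vsum a (cube0 tau) triples))).
  by rewrite cube_sum /vsum 4!big_cons.
have h1 := cube_sum1 (shifted a tau e1) (cube1 r tau).
have h2 := cube_sum2 (shifted a tau e2) (cube2 r tau).
have h3 := cube_sum3 (shifted a tau e3) (cube3 r tau).
have h4 := cube_sum4 (shifted a tau e4) (cube4 r tau).
have E (x u v : K) : x + u + (v - u) = x + v by ring.
have E' (x u v : K) : x - u - (v - u) = x - v by ring.
have g1 : vertex (shifted a tau e1) (cube1 r tau) e1 = (a.1, a.2 + r.1.1.1).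
  by rewrite /vertex /shifted /vertex /= ?(mulr0n, mulr1n, subr0, addr0) E.
have g2 : vertex (shifted a tau e2) (cube2 r tau) e2 = (a.1 + r.1.1.2, a.2).
  by rewrite /vertex /shifted /vertex /= ?(mulr0n, mulr1n, subr0, addr0) E.
have g3 : vertex (shifted a tau e3) (cube3 r tau) e3 = (a.1 + r.1.2, a.2 - r.1.2).
  by rewrite /vertex /shifted /vertex /= ?(mulr0n, mulr1n, subr0, addr0) E E'.
have g4 : vertex (shifted a tau e4) (cube4 r tau) e4 = (a.1 + r.2, a.2 + r.2).
  by rewrite /vertex /shifted /vertex /= ?(mulr0n, mulr1n, subr0, addr0) !E.
rewrite g1 in h1; rewrite g2 in h2; rewrite g3 in h3; rewrite g4 in h4.
rewrite /gad_pos /gad_neg !csum_cat !csum_vertex /gad_end !csum_cons csum0.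
move: h0 h1 h2 h3 h4.
do 5 move: (vsum _ _ evens) => ?; do 5 move: (vsum _ _ _) => ?.
move: (shifted _ _ _) (shifted _ _ _) (shifted _ _ _) (shifted _ _ _) => s1 s2 s3 s4.
move: (cov _) (cov _) (cov _) (cov _) (cov _) (cov _) (cov _) (cov _) (cov _) => *.
apply/ffunP=> p.
repeat match goal with H : _ = _ |- _ => move: (congr1 (fun f : vec K => f p) H); clear H; rewrite /= !vecE end.
by clear; lia.
Qed.

End CubeIdentity.

(** * Evaluation of the linear forms and counting of gadget parameters *)

Section GadgetMap.
Variables (M M' : zmodType) (f : {additive M -> M'}).
Definition map2 (q : M * M) : M' * M' := (f q.1, f q.2).
Definition map4 (r : M * M * M * M) : M' * M' * M' * M' :=
  (f r.1.1.1, f r.1.1.2, f r.1.2, f r.2).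

Lemma map_vertex a t b : map2 (vertex a t b) = vertex (map2 a) (map4 t) b.
Proof. by rewrite /map2 /vertex /= !raddfD !raddfN !raddfMn. Qed.

Lemma map_cubes r t : ((map4 (cube0 t) = cube0 (f t)) * (map4 (cube1 r t) = cube1 (map4 r) (f t))
  * (map4 (cube2 r t) = cube2 (map4 r) (f t)) * (map4 (cube3 r t) = cube3 (map4 r) (f t))
  * (map4 (cube4 r t) = cube4 (map4 r) (f t)))%type.
Proof.
by rewrite /map4 /cube0 /cube1 /cube2 /cube3 /cube4 /= !raddfB !raddfMn.
Qed.

Lemma map_gad_pos a r t : [seq map2 q | q <- gad_pos a r t] = gad_pos (map2 a) (map4 r) (f t).
Proof.
rewrite /gad_pos !map_cat -!map_comp /shifted.
by congr (_ ++ _ ++ _ ++ _ ++ _); apply: eq_map => b; rewrite /= !map_vertex !map_cubes.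
Qed.

Lemma map_gad_neg a r t : [seq map2 q | q <- gad_neg a r t] = gad_neg (map2 a) (map4 r) (f t).
Proof.
rewrite /gad_neg !map_cat -!map_comp /shifted.
by congr (_ ++ _ ++ _ ++ _ ++ _); apply: eq_map => b; rewrite /= !map_vertex !map_cubes.
Qed.

Lemma map_coords q : [seq f x | x <- coords q] = coords (map2 q).
Proof. by rewrite /coords /= !raddfD raddfN. Qed.

Lemma map_axis q : [seq f x | x <- axis_cells q] = axis_cells (map2 q).
Proof. by rewrite /axis_cells /= !raddfMn !raddfD !raddfN. Qed.

Lemma map_diag q : [seq f x | x <- diag_cells q] = diag_cells (map2 q).
Proof. by rewrite /diag_cells /= !raddfMn !raddfD !raddfN. Qed.

Lemma map_gaps s : [seq f x | x <- gaps s] = gaps [seq f x | x <- s].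
Proof.
elim: s => //= x s IH; rewrite !map_cat IH -!map_comp; congr (_ ++ _ ++ _);
  by apply: eq_map => y /=; rewrite ?raddfB ?raddfD.
Qed.

Lemma map_flatten_coords (g : M * M -> seq M) (h : M' * M' -> seq M') s :
  (forall q, [seq f x | x <- g q] = h (map2 q)) ->
  [seq f x | x <- flatten [seq g q | q <- s]] = flatten [seq h q | q <- [seq map2 q | q <- s]].
Proof.
move=> e; rewrite map_flatten -!map_comp; congr flatten; exact: eq_map.
Qed.

Lemma map_gad_forms a r t :
  [seq f x | x <- gad_forms a r t] = gad_forms (map2 a) (map4 r) (f t).
Proof.
have e1 (s : seq (M * M)) : [seq f x | x <- flatten [seq coords q | q <- s]]
    = flatten [seq coords q | q <- [seq map2 q | q <- s]].
  exact: map_flatten_coords map_coords.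
have e2 (s : seq (M * M)) : [seq f x | x <- flatten [seq axis_cells q | q <- s]]
    = flatten [seq axis_cells q | q <- [seq map2 q | q <- s]].
  exact: map_flatten_coords map_axis.
have e3 (s : seq (M * M)) : [seq f x | x <- flatten [seq diag_cells q | q <- s]]
    = flatten [seq diag_cells q | q <- [seq map2 q | q <- s]].
  exact: map_flatten_coords map_diag.
rewrite /gad_forms -map_gad_pos -map_gad_neg.
move: (gad_pos a r t) (gad_neg a r t) => P N.
by rewrite [LHS]map_cat e1 -(map_cat map2); congr cat; rewrite [LHS]map_cat !map_gaps e2 e3.
Qed.

Lemma map_root_forms a r : [seq f x | x <- root_forms a r] = root_forms (map2 a) (map4 r).
Proof.
rewrite /root_forms (map_flatten_coords _ map_coords); congr flatten.
by congr map; rewrite /gad_end /= /map2 /= !raddfD !raddfN.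
Qed.

End GadgetMap.

Definition apart (M : zmodType) (x y : M) : bool := (x != y) && (x != - y).

Lemma gaps_apart (M : zmodType) (s : seq M) :
  all (fun v => v != 0) (gaps s) = pairwise (@apart M) s.
Proof.
elim: s => //= x s IH; rewrite !all_cat IH !all_map andbA; congr (_ && _).
rewrite -all_predI; apply: eq_all => y /=.
by rewrite /apart subr_eq0 addr_eq0.
Qed.

Lemma gaps_allE (M : zmodType) (p : pred M) (s : seq M) : gaps_all p s = all p (gaps s).
Proof. by elim: s => //= x s ->; rewrite !all_cat !all_map. Qed.

Lemma gad_forms_all (M : zmodType) (p : pred M) a r t : all p (gad_forms a r t) =
  [&& all p (flatten [seq coords q | q <- gad_pos a r t ++ gad_neg a r t]),
      gaps_all p (flatten [seq axis_cells q | q <- gad_neg a r t])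
    & gaps_all p (flatten [seq diag_cells q | q <- gad_neg a r t])].
Proof.
rewrite /gad_forms; move: (gad_pos a r t) (gad_neg a r t) => P N.
by rewrite [LHS]all_cat [X in _ && X]all_cat !gaps_allE.
Qed.

Section Eval.
Variable K : finComUnitRingType.
Hypothesis u2 : (2 : K) \is a GRing.unit.
Hypothesis u3 : (3 : K) \is a GRing.unit.
Hypothesis hsol : forall (c : nat) (b : K), (0 < c)%N -> (#|[set t : K | t *+ c == b]| <= c)%N.
Variables (a : K * K) (r : K * K * K * K).

Definition zK (z : Z) : K := (int_of_Z z)%:~R.

Lemma zKB : {morph zK : x y / x - y}.
Proof. by move=> x y; rewrite /zK raddfB /= rmorphB. Qed.

Definition evl (t : K) (F : zform) : K :=
  zK F.1.1.1.1.1.1 * a.1 + zK F.1.1.1.1.1.2 * a.2 + zK F.1.1.1.1.2 * r.1.1.1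
  + zK F.1.1.1.2 * r.1.1.2 + zK F.1.1.2 * r.1.2 + zK F.1.2 * r.2 + zK F.2 * t.

Lemma evl_additive t : zmod_morphism (evl t).
Proof. by move=> F G; rewrite /evl /= !zKB; ring. Qed.

HB.instance Definition _ t := GRing.isZmodMorphism.Build zform K (evl t) (evl_additive t).

Lemma zK0 : zK Z0 = 0. Proof. by []. Qed.
Lemma zK1 : zK (Zpos xH) = 1. Proof. by []. Qed.

Lemma evl_gad_forms t : gad_forms a r t = [seq evl t F | F <- gad_forms (X0, Y0) R0 T0].
Proof.
rewrite map_gad_forms; congr gad_forms.
- by rewrite /map2 /X0 /Y0 /= /evl /= zK0 zK1; case: (a) => x y /=; congr (_, _); ring.
- by rewrite /map4 /R0 /= /evl /= zK0 zK1; case: (r) => [[[x y] z] w] /=; congr (_, _, _, _); ring.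
- by rewrite /T0 /= /evl /= zK0 zK1; ring.
Qed.

Lemma evl_gad_neg t : gad_neg a r t = [seq map2 (evl t) q | q <- gad_neg (X0, Y0) R0 T0].
Proof.
rewrite map_gad_neg; congr gad_neg.
- by rewrite /map2 /X0 /Y0 /= /evl /= zK0 zK1; case: (a) => x y /=; congr (_, _); ring.
- by rewrite /map4 /R0 /= /evl /= zK0 zK1; case: (r) => [[[x y] z] w] /=; congr (_, _, _, _); ring.
- by rewrite /T0 /= /evl /= zK0 zK1; ring.
Qed.

Lemma evl_root_forms t : root_forms a r = [seq evl t F | F <- root_forms (X0, Y0) R0].
Proof.
rewrite map_root_forms; congr root_forms.
- by rewrite /map2 /X0 /Y0 /= /evl /= zK0 zK1; case: (a) => x y /=; congr (_, _); ring.
- by rewrite /map4 /R0 /= /evl /= zK0 zK1; case: (r) => [[[x y] z] w] /=; congr (_, _, _, _); ring.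
Qed.

Lemma form_eqbP F G : form_eqb F G -> F = G.
Proof.
case: F => [[[[[[f1 f2] f3] f4] f5] f6] f7]; case: G => [[[[[[g1 g2] g3] g4] g5] g6] g7] /=.
case/and5P=> /Z.eqb_eq -> /Z.eqb_eq -> /Z.eqb_eq -> /Z.eqb_eq -> /and3P[].
by move=> /Z.eqb_eq -> /Z.eqb_eq -> /Z.eqb_eq ->.
Qed.

Lemma hsolz (c : Z) (b : K) : ~~ Z.eqb c 0 ->
  (#|[set t : K | (zK c * t)%R == b]| <= absz (int_of_Z c))%N.
Proof.
move=> c0; have : int_of_Z c != 0.
  by apply: contraNN c0 => /eqP h; apply/Z.eqb_eq; rewrite -(int_of_ZK c) h.
rewrite /zK; case: (int_of_Z c) => k k0 /=.
  rewrite (_ : [set _ | _] = [set t : K | t *+ k == b]); last first.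
    by apply/setP=> t; rewrite !inE -pmulrn mulr_natl.
  by apply: hsol; rewrite lt0n.
rewrite (_ : [set _ | _] = [set t : K | t *+ k.+1 == - b]); last first.
  by apply/setP=> t; rewrite !inE NegzE mulrNz -pmulrn mulNr mulr_natl eqr_oppLR.
exact: hsol.
Qed.

Lemma evl_count (F : zform) (b : K) : ~~ Z.eqb F.2 0 ->
  (#|[set t : K | evl t F == b]| <= absz (int_of_Z F.2))%N.
Proof.
move=> h; apply: leq_trans (hsolz (b - evl 0 F) h).
apply: subset_leq_card; apply/subsetP=> t; rewrite !inE => /eqP <-.
by rewrite /evl; apply/eqP; ring.
Qed.

Definition rooted := all (fun v : K => v != 0) (root_forms a r).

Lemma unit_forms_neq0 t F : rooted -> has (form_eqb F) unit_forms -> evl t F != 0.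
Proof.
move=> hr /hasP[G hG /form_eqbP ->] {F}.
have /flatten_mapP[F hF {}hG] := hG.
have nF : evl t F != 0.
  by move: hr; rewrite /rooted (evl_root_forms t) all_map => /allP; apply.
have unz (x : K) k : (k%:R : K) \is a GRing.unit -> x != 0 -> x *+ k != 0.
  by move=> uk; apply: contraNN => /eqP h; rewrite -(mulrK uk x) mulr_natr h mul0r.
have u4 : (4 : K) \is a GRing.unit by rewrite (_ : 4 = 2 * 2) ?unitrMl // -natrM.
have u6 : (6 : K) \is a GRing.unit by rewrite (_ : 6 = 2 * 3) ?unitrMl // -natrM.
suff /allP h : all (fun G => evl t G != 0) (mulz_forms F) by exact: h.
rewrite /mulz_forms [all _ _]/= !raddfN !raddfMn /= !oppr_eq0.
have nF' : - evl t F != 0 by rewrite oppr_eq0.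
by rewrite nF !(unz _ 2) // !(unz _ 3) // !(unz _ 4) // !(unz _ 6).
Qed.

End Eval.

Definition gad_bound : nat :=
  (\sum_(F <- gad_forms (X0, Y0) R0 T0) absz (int_of_Z F.2))%N.

Definition gad_coord_bound : nat :=
  (\sum_(F <- flatten [seq coords q | q <- gad_neg (X0, Y0) R0 T0]) absz (int_of_Z F.2))%N.

Lemma card_has_le (T : finType) (I : eqType) (s : seq I) (P : I -> pred T) (w : I -> nat) :
  (forall i, i \in s -> (#|[set t | P i t]| <= w i)%N) ->
  (#|[set t | has (fun i => P i t) s]| <= \sum_(i <- s) w i)%N.
Proof.
elim: s => [|i s IH] h; first by rewrite big_nil leqn0 cards_eq0; apply/eqP/setP=> t; rewrite !inE.
rewrite big_cons (_ : [set t | _] = [set t | P i t] :|: [set t | has (fun i => P i t) s]).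
  apply: leq_trans (leq_card_setU _ _) _; apply: leq_add; first by apply: h; rewrite inE eqxx.
  by apply: IH => j hj; apply: h; rewrite inE hj orbT.
by apply/setP=> t; rewrite !inE.
Qed.

Section Count.
Variable K : finComUnitRingType.
Hypothesis u2 : (2 : K) \is a GRing.unit.
Hypothesis u3 : (3 : K) \is a GRing.unit.
Hypothesis hsol : forall (c : nat) (b : K), (0 < c)%N -> (#|[set t : K | t *+ c == b]| <= c)%N.
Variables (a : K * K) (r : K * K * K * K).
Hypothesis hr : rooted a r.

Definition spread (t : K) := all (fun v : K => v != 0) (gad_forms a r t).

(** By [gad_checkT] a form either involves [t], and then vanishes for at most as many [t] as the
    absolute value of its coefficient, or is a multiple of a root form and never vanishes. *)
Lemma fine_count : (#|[set t | ~~ spread t]| <= gad_bound)%N.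
Proof.
rewrite (_ : [set t | _] = [set t | has (fun F => evl a r t F == 0) (gad_forms (X0, Y0) R0 T0)]).
  apply: (@card_has_le _ _ _ (fun F t => evl a r t F == 0) (fun F => absz (int_of_Z F.2))).
  move=> F hF; have : form_ok F.
    have /and4P[_ c1 c2 c3] := gad_checkT; have /allP h : all form_ok (gad_forms (X0, Y0) R0 T0); last exact: h.
    by rewrite gad_forms_all; apply/and3P; split.
  case/orP=> h; first exact: evl_count.
  apply: leq_trans (_ : 0 <= _)%N => //; rewrite leqn0 cards_eq0; apply/eqP/setP=> t.
  by rewrite !inE; apply/negbTE; exact: unit_forms_neq0.
apply/setP=> t; rewrite !inE /spread evl_gad_forms all_map -has_predC.
by apply: eq_has => F /=; rewrite negbK.
Qed.

(** Every coordinate of a negative queen involves [t]; the factor 2 accounts for the values [u] and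
    [- u]. *)
Lemma fresh_count (U : seq K) :
  (#|[set t | has (fun x => has (fun u => ~~ apart x u) U)
        (flatten [seq coords q | q <- gad_neg a r t])]|
   <= gad_coord_bound * (2 * size U))%N.
Proof.
pose S := flatten [seq coords q | q <- gad_neg (X0, Y0) R0 T0].
rewrite (_ : [set t | _] = [set t | has (fun F => has (fun u => ~~ apart (evl a r t F) u) U) S]).
  rewrite /gad_coord_bound big_distrl /=.
  apply: (@card_has_le _ _ _ (fun F t => has (fun u => ~~ apart (evl a r t F) u) U)
    (fun F => absz (int_of_Z F.2) * (2 * size U))%N).
  move=> F hF; have /and4P[c0 _ _ _] := gad_checkT.
  have {c0}c1 := allP c0 F hF; clear hF.
  have -> : (absz (int_of_Z F.2) * (2 * size U) = \sum_(u <- U) 2 * absz (int_of_Z F.2))%N.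
    by rewrite big_const_seq count_predT iter_addn_0; clear; lia.
  apply: (@card_has_le _ _ _ (fun u t => ~~ apart (evl a r t F) u) (fun u => 2 * absz (int_of_Z F.2))%N).
  move=> u _; rewrite (_ : [set t | _] = [set t | evl a r t F == u] :|: [set t | evl a r t F == - u]).
    by apply: leq_trans (leq_card_setU _ _) _; rewrite mul2n -addnn; apply: leq_add; exact: evl_count.
  by apply/setP=> t; rewrite !inE /apart negb_and !negbK.
apply/setP=> t; rewrite !inE evl_gad_neg /S.
rewrite -(map_flatten_coords _ (map_coords (evl a r t))) has_map.
by [].
Qed.

End Count.

(** * The template and the completion of partial configurations *)

Section Orbits.
Variable K : finComUnitRingType.
Hypothesis u2 : (2 : K) \is a GRing.unit.
Implicit Types (q : K * K) (x y u v : K).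

Definition orbit4 q : seq (K * K) := [:: q; (- q.2, q.1); (- q.1, - q.2); (q.2, - q.1)].

(** The blocks of lines invariant under quarter turns: an orbit covers two axis blocks and two
    diagonal blocks, each depending on its parameter up to sign only. *)
Definition axisv y : vec K := dl 0 y + dl 0 (- y) + dl 1 y + dl 1 (- y).
Definition diagv y : vec K := dl 2 y + dl 2 (- y) + dl 3 y + dl 3 (- y).

Lemma axisvN y : axisv (- y) = axisv y.
Proof. by apply/ffunP=> p; rewrite /axisv opprK !vecE; ring. Qed.
Lemma diagvN y : diagv (- y) = diagv y.
Proof. by apply/ffunP=> p; rewrite /diagv opprK !vecE; ring. Qed.

Lemma csum_orbit4 q :
  csum (orbit4 q) = axisv q.1 + axisv q.2 + diagv (q.1 + q.2) + diagv (q.1 - q.2).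
Proof.
rewrite /orbit4 !csum_cons csum0 /cov /axisv /diagv /= !opprK.
have -> : - q.2 + q.1 = q.1 - q.2 by ring.
have -> : - q.2 - q.1 = - (q.1 + q.2) by ring.
have -> : - q.1 - q.2 = - (q.1 + q.2) by ring.
have -> : - q.1 + q.2 = - (q.1 - q.2) by ring.
have -> : q.2 - q.1 = - (q.1 - q.2) by ring.
have -> : q.2 + q.1 = q.1 + q.2 by ring.
by apply/ffunP=> p; rewrite !vecE; ring.
Qed.

Definition tri x : seq (K * K) := orbit4 (x, x *+ 3).
Definition two x : seq (K * K) := orbit4 (x, x *+ 2).

Lemma csum_tri x : csum (tri x) = axisv x + axisv (x *+ 3) + diagv (x *+ 2) + diagv (x *+ 4).
Proof.
rewrite csum_orbit4 /= -[diagv (x - _)]diagvN.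
have -> : - (x - x *+ 3) = x *+ 2 by ring.
have -> : x + x *+ 3 = x *+ 4 by ring.
by rewrite addrAC.
Qed.

Lemma csum_two x : csum (two x) = axisv x + axisv (x *+ 2) + diagv x + diagv (x *+ 3).
Proof.
rewrite csum_orbit4 /= -[diagv (x - _)]diagvN.
have -> : - (x - x *+ 2) = x by ring.
have -> : x + x *+ 2 = x *+ 3 by ring.
by rewrite addrAC.
Qed.

Lemma csum_triN x : csum (tri (- x)) = csum (tri x).
Proof. by rewrite !csum_tri !mulNrn !axisvN !diagvN. Qed.
Lemma csum_twoN x : csum (two (- x)) = csum (two x).
Proof. by rewrite !csum_two !mulNrn !axisvN !diagvN. Qed.

(* The trade that makes the queen [q] available: four template orbits are exchanged
   for four generic ones, one of which contains [q]. *)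
Definition trade_rest q : seq (K * K) :=
  behead (orbit4 q) ++ orbit4 (q.1 *+ 3, q.2 *+ 3) ++ orbit4 (q.1 + q.2, q.1 - q.2)
  ++ orbit4 ((q.1 + q.2) *+ 2, (q.1 - q.2) *+ 2).

(** The blocks regroup. The orbits of q and 3q take the axis blocks of the [tri] orbits and the
    diagonal blocks of the [two] orbits; the orbits of (q.1 + q.2, q.1 - q.2) and of its double take
    the remaining ones. *)
Lemma trade q :
  csum (tri q.1) + csum (tri q.2) + csum (two (q.1 + q.2)) + csum (two (q.1 - q.2))
  = cov q + csum (trade_rest q).
Proof.
have -> : cov q + csum (trade_rest q) = csum (orbit4 q) + csum (orbit4 (q.1 *+ 3, q.2 *+ 3))
  + csum (orbit4 (q.1 + q.2, q.1 - q.2))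
  + csum (orbit4 ((q.1 + q.2) *+ 2, (q.1 - q.2) *+ 2)).
  by rewrite /trade_rest !csum_cat [csum (orbit4 q)]csum_cons !addrA.
rewrite !csum_tri !csum_two !csum_orbit4 /=.
have -> : q.1 *+ 3 + q.2 *+ 3 = (q.1 + q.2) *+ 3 by ring.
have -> : q.1 *+ 3 - q.2 *+ 3 = (q.1 - q.2) *+ 3 by ring.
have -> : q.1 + q.2 + (q.1 - q.2) = q.1 *+ 2 by ring.
have -> : q.1 + q.2 - (q.1 - q.2) = q.2 *+ 2 by ring.
have -> : (q.1 + q.2) *+ 2 + (q.1 - q.2) *+ 2 = q.1 *+ 4 by ring.
have -> : (q.1 + q.2) *+ 2 - (q.1 - q.2) *+ 2 = q.2 *+ 4 by ring.
by apply/ffunP=> p; rewrite !vecD; ring.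
Qed.

Definition half x := (enum_rank x < enum_rank (- x))%N.

Lemma half_neg x : x != 0 -> half (- x) = ~~ half x.
Proof.
move=> x0; rewrite /half opprK -leqNgt ltn_neqAle; case: (_ <= _)%N; rewrite ?andbF // andbT.
apply: contraNN x0 => /eqP /val_inj /enum_rank_inj /eqP.
rewrite eq_sym -addr_eq0 -mulr2n -mulr_natr => /eqP h.
by rewrite -(mulrK u2 x) h mul0r.
Qed.

(** This splits the orbits consumed by the exchanges off the template. Since the elements of [us]
    are distinct up to sign, they stand for distinct orbits, whichever sign they carry. *)
Lemma half_sum (X : pred K) (F : K -> seq (K * K)) (us : seq K) :
  (forall x, X x -> x != 0) -> (forall x, X (- x) = X x) ->
  (forall x, csum (F (- x)) = csum (F x)) ->
  all X us -> pairwise (@apart K) us ->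
  exists s, \sum_(x | half x && X x) csum (F x) = \sum_(u <- us) csum (F u) + csum s.
Proof.
move=> X0 XN FN aX absorb_s.
pose nrm u := if half u then u else - u.
have nX u : X u -> half (nrm u) && X (nrm u).
  move=> Xu; rewrite /nrm; case: (boolP (half u)) => h; rewrite ?h ?XN ?Xu //=.
  by rewrite half_neg ?h // X0.
have Fn u : csum (F (nrm u)) = csum (F u) by rewrite /nrm; case: ifP.
have nE u v : nrm u = nrm v -> ~~ apart u v.
  rewrite /nrm /apart negb_and !negbK; case: ifP; case: ifP => _ _ e.
  - by rewrite e eqxx.
  - by rewrite e eqxx orbT.
  - by rewrite -e opprK eqxx orbT.
  - by rewrite (oppr_inj e) eqxx.
have un : uniq [seq nrm u | u <- us].
  elim: us absorb_s {aX} => //= u us IH /andP[au /IH ->]; rewrite andbT.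
  by apply/mapP=> -[v vus /nE]; rewrite (allP au v vus).
exists (flatten [seq F x | x <- enum [pred x | half x && X x & x \notin [seq nrm u | u <- us]]]).
rewrite (bigID (mem [seq nrm u | u <- us])) /=; congr (_ + _).
  rewrite (eq_bigl (mem [seq nrm u | u <- us])); last first.
    move=> x /=; apply: andb_idl => /mapP[u uus ->].
    by apply: nX; exact: (allP aX).
  rewrite -big_uniq //= big_map; apply: eq_bigr => u _; exact: Fn.
by rewrite /csum big_flatten big_map /= big_enum /=.
Qed.

End Orbits.

Section Absorb.
Variable K : finComUnitRingType.
Hypothesis u2 : (2 : K) \is a GRing.unit.
Hypothesis u3 : (3 : K) \is a GRing.unit.
Hypothesis hsol : forall (c : nat) (b : K), (0 < c)%N -> (#|[set t : K | t *+ c == b]| <= c)%N.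
Variables (in_tri in_two : pred K).
Implicit Types (q a b : K * K) (P N : seq (K * K)).

(** The template contains the four orbits that [trade] consumes for [q]. Below, [axis_of] and
    [diag_of] list the parameters of the consumed [tri] and [two] orbits. *)
Definition approved q := [&& in_tri q.1, in_tri q.2, in_two (q.1 + q.2) & in_two (q.1 - q.2)].
Definition axis_of N : seq K := flatten [seq [:: q.1; q.2] | q <- N].
Definition diag_of N : seq K := flatten [seq [:: q.1 + q.2; q.1 - q.2] | q <- N].

Variable Y : nat.
Hypothesis hY : forall a r, rooted a r ->
  (Y <= #|[set t | spread a r t && all approved (gad_neg a r t)]|)%N.

Lemma cov_ge0 q l : 0 <= cov q l. Proof. by rewrite covE; case: (_ == _). Qed.

Lemma csum_ge0 P l : 0 <= csum P l.
Proof.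
elim: P => [|q P IH]; first by rewrite csum0 vec0.
by rewrite csum_cons vecD addr_ge0 ?cov_ge0.
Qed.

Lemma csum_gt0 P l : 0 < csum P l -> exists2 q, q \in P & phi l.1 q = l.2.
Proof.
elim: P => [|q P IH]; first by rewrite csum0 vec0 ltxx.
rewrite csum_cons vecD covE; case: (phi l.1 q =P l.2) => [e _|_].
  by exists q; rewrite // inE eqxx.
by rewrite add0r => /IH [p pP e]; exists p; rewrite // inE pP orbT.
Qed.

Lemma csum_perm P P' : perm_eq P P' -> csum P = csum P'.
Proof. by move=> h; apply: perm_big. Qed.

Lemma subseq_flatten (T : eqType) (A : Type) (f g : A -> seq T) (s : seq A) :
  (forall x, subseq (f x) (g x)) -> subseq (flatten [seq f x | x <- s]) (flatten [seq g x | x <- s]).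
Proof. by move=> h; elim: s => //= x s IH; exact: cat_subseq. Qed.

Lemma fine_apart a r t : spread a r t ->
  [/\ all (@nonzero K) (gad_pos a r t), pairwise (@apart K) (axis_of (gad_neg a r t))
     & pairwise (@apart K) (diag_of (gad_neg a r t))].
Proof.
rewrite /spread gad_forms_all !gaps_allE !gaps_apart => /and3P[h1 h2 h3]; split.
- apply/allP=> q qP; rewrite /nonzero.
  have h v : v \in coords q -> v != 0.
    by move=> hv; apply: (allP h1); apply/flatten_mapP; exists q; rewrite // mem_cat qP.
  by rewrite !h // !inE eqxx ?orbT.
- apply: subseq_pairwise h2; apply: subseq_flatten => q /=.
  by rewrite !eqxx; case: (_ == _); rewrite /= ?eqxx ?sub0seq.
- apply: subseq_pairwise h3; apply: subseq_flatten => q.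
  rewrite /diag_cells.
  have -> : [:: q.1 + q.2; q.1 - q.2] = mask [:: false; false; false; false; true; false; true; false] (diag_cells q) by [].
  exact: mask_subseq.
Qed.

(** Two lines of different types meet in at most one queen; invertibility of 2 enters when both are
    diagonals. *)
Lemma line_inj q p i j : i != j -> phi i q = phi i p -> phi j q = phi j p -> q = p.
Proof.
case: q p => x y [x' y']; rewrite /phi.
have hh (z w : K) : z + z = w + w -> z = w.
  by move=> h; rewrite -(mulKr u2 z) -(mulKr u2 w) !mulr_natl !mulr2n h.
have h2 : x + y = x' + y' -> x - y = x' - y' -> (x, y) = (x', y').
  move=> e1 e2; have ex : x = x'.
    by apply: hh; have := congr2 +%R e1 e2; rewrite addrACA subrr addr0 addrACA subrr addr0.
  by rewrite ex in e1 *; rewrite (addrI _ e1).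
case: i => [[|[|[|[|//]]]] //= hi]; case: j => [[|[|[|[|//]]]] //= hj] // _ e1 e2; subst=> //.
- by rewrite (addrI _ e2).
- by rewrite (oppr_inj (addrI _ e2)).
- by rewrite (addIr _ e2).
- by rewrite (addIr _ e2).
- by rewrite (addrI _ e1).
- by rewrite (addIr _ e1).
- by rewrite (oppr_inj (addrI _ e1)).
- by rewrite (addIr _ e1).
- exact: (h2 e2 e1).
Qed.

End Absorb.

Section Absorb.
Variable K : finComUnitRingType.
Hypothesis u2 : (2 : K) \is a GRing.unit.
Hypothesis u3 : (3 : K) \is a GRing.unit.
Hypothesis hsol : forall (c : nat) (b : K), (0 < c)%N -> (#|[set t : K | t *+ c == b]| <= c)%N.
Variables (in_tri in_two : pred K).
Implicit Types (q a b : K * K) (P N : seq (K * K)).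
Variable Y : nat.
Hypothesis hY : forall a r, rooted a r ->
  (Y <= #|[set t | spread a r t && all (approved in_tri in_two) (gad_neg a r t)]|)%N.

Lemma axis_of_cat N N' : axis_of (N ++ N') = axis_of N ++ axis_of N'.
Proof. by rewrite /axis_of map_cat flatten_cat. Qed.
Lemma diag_of_cat N N' : diag_of (N ++ N') = diag_of N ++ diag_of N'.
Proof. by rewrite /diag_of map_cat flatten_cat. Qed.

Lemma size_gad_neg a r t : size (gad_neg a r t) = 32. Proof. by []. Qed.

(** [P] meets the four lines of [a] without containing [a]. The four queens found there are
    distinct, because a common one would share two lines with [a]. They are the ends of the
    gadget. *)
Lemma gad_end_perm a (P : seq (K * K)) : a \notin P ->
  (forall l, cov a l <= csum P l) ->
  exists r P', perm_eq P (gad_end a r ++ P').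
Proof.
move=> aP hP.
have hb (j : 'I_4) : exists2 b, b \in P & phi j b = phi j a.
  by apply: (@csum_gt0 K P (j, phi j a)); apply: lt_le_trans (hP _); rewrite covE eqxx.
pose o k (h : (k < 4)%N) : 'I_4 := Ordinal h.
have [b1 b1P e1] := hb (o 0 isT); have [b2 b2P e2] := hb (o 1 isT).
have [b3 b3P e3] := hb (o 2 isT); have [b4 b4P e4] := hb (o 3 isT).
have ne i j b b' : i != j -> b \in P -> phi i b = phi i a -> phi j b' = phi j a -> b != b'.
  move=> ij bP h h'; apply: contraNneq aP => e; rewrite -e in h'.
  by rewrite -(line_inj u2 ij h h').
have n12 : b1 != b2 by apply: (ne _ _ _ _ _ b1P e1 e2).
have n13 : b1 != b3 by apply: (ne _ _ _ _ _ b1P e1 e3).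
have n14 : b1 != b4 by apply: (ne _ _ _ _ _ b1P e1 e4).
have n23 : b2 != b3 by apply: (ne _ _ _ _ _ b2P e2 e3).
have n24 : b2 != b4 by apply: (ne _ _ _ _ _ b2P e2 e4).
have n34 : b3 != b4 by apply: (ne _ _ _ _ _ b3P e3 e4).
exists (b1.2 - a.2, b2.1 - a.1, b3.1 - a.1, b4.1 - a.1).
exists (rem b4 (rem b3 (rem b2 (rem b1 P)))).
have -> : gad_end a (b1.2 - a.2, b2.1 - a.1, b3.1 - a.1, b4.1 - a.1) = [:: b1; b2; b3; b4].
  have A (x y : K) : x + (y - x) = y by ring.
  move: e1 e2 e3 e4; rewrite /phi /gad_end /= !A.
  case: (b1) (b2) (b3) (b4) => x1 y1 [x2 y2] [x3 y3] [x4 y4] /= -> -> e3 e4.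
  have -> : a.2 - (x3 - a.1) = y3 by rewrite opprB addrCA addrA [a.1 + a.2]addrC -[a.2 + a.1]addrC -e3; ring.
  have -> : a.2 + (x4 - a.1) = y4.
    have -> : a.2 + (x4 - a.1) = x4 - (a.1 - a.2) by ring.
    by rewrite -e4; ring.
  by [].
apply: perm_trans (perm_to_rem b1P) _; rewrite /= perm_cons.
have h2 : b2 \in rem b1 P by rewrite rem_mem // eq_sym.
apply: perm_trans (perm_to_rem h2) _; rewrite perm_cons.
have h3 : b3 \in rem b2 (rem b1 P) by rewrite !rem_mem // eq_sym.
apply: perm_trans (perm_to_rem h3) _; rewrite perm_cons.
have h4 : b4 \in rem b3 (rem b2 (rem b1 P)) by rewrite !rem_mem // eq_sym.
exact: perm_to_rem.
Qed.

Lemma csum_consE q (s : seq (K * K)) l : csum (q :: s) l = cov q l + csum s l.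
Proof. by rewrite csum_cons [LHS]vecD. Qed.
Lemma csum_catE (s s' : seq (K * K)) l : csum (s ++ s') l = csum s l + csum s' l.
Proof. by rewrite csum_cat [LHS]vecD. Qed.

Lemma gad_sumE a r t l :
  cov a l + csum (gad_pos a r t) l = csum (gad_end a r) l + csum (gad_neg a r t) l.
Proof. by have := congr1 (fun f : vec K => f l) (gad_sum a r t); rewrite /= [LHS]vecD [RHS]vecD. Qed.

(** Induction on the negative queens [Nb] still to be removed. One that lies in [P] cancels; any
    other is replaced by a gadget, which adds 32 approved negative queens. The inequality between
    the sums provides the positive queens through its lines, and [size Ng + 32 * size Nb] never
    increases. *)
Lemma absorb (Nb Ng P : seq (K * K)) :
  all (@nonzero K) P -> all (@nonzero K) Nb -> all (approved in_tri in_two) Ng ->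
  pairwise (@apart K) (axis_of Ng) -> pairwise (@apart K) (diag_of Ng) ->
  (forall l, csum Nb l + csum Ng l <= csum P l) ->
  (gad_coord_bound * (8 * (size Ng + 32 * size Nb)) < Y)%N ->
  exists P' N', [/\ csum P' - csum N' = csum P - (csum Nb + csum Ng),
    all (approved in_tri in_two) N', pairwise (@apart K) (axis_of N') &
    pairwise (@apart K) (diag_of N')].
Proof.
elim: Nb Ng P => [|a Nb IH] Ng P nP nN aN pA pD hle hsz.
  by exists P, Ng; split; rewrite // csum0 add0r.
case: (boolP (a \in P)) => aP.
  have pP := perm_to_rem aP; have eP := csum_perm pP; rewrite csum_cons in eP.
  have [||||P' [N' [h1 h2 h3 h4]]] := IH Ng (rem a P) _ _ aN pA pD.
  - by apply/allP=> q /mem_rem; apply: (allP nP).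
  - by move: nN => /= /andP[].
  - by move=> l; have := hle l; rewrite eP csum_cons !vecD -addrA lerD2l.
  - by apply: leq_ltn_trans hsz; rewrite leq_mul2l leq_mul2l leq_add2l leq_mul2l leqnSn !orbT.
  exists P', N'; split=> //; rewrite h1 eP csum_cons.
  by apply/ffunP=> l; rewrite !vecE; ring.
have haP l : cov a l <= csum P l.
  apply: le_trans _ (hle l); rewrite csum_cons [(cov a + _) l]vecD; have := csum_ge0 Nb l;
    have := csum_ge0 Ng l; clear; lia.
have [r [P1 pP]] := gad_end_perm aP haP.
have eP l : csum P l = csum (gad_end a r) l + csum P1 l.
  by rewrite (csum_perm pP) csum_catE.
have rt : rooted a r.
  rewrite /rooted /root_forms; apply/allP=> v /flatten_mapP[q hq hv].
  have nq : nonzero q.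
    move: hq; rewrite inE => /orP[/eqP ->|hq]; first by move: nN => /= /andP[].
    by apply: (allP nP); rewrite (perm_mem pP) mem_cat hq.
  by move: nq hv => /and4P[n1 n2 n3 n4]; rewrite !inE => /or4P[] /eqP ->.
(* At least [Y] parameters are approved, and fewer than that collide with one of the 4 * [size Ng]
   orbit parameters already consumed. *)
have [t]: exists t, t \in [set t | spread a r t && all (approved in_tri in_two) (gad_neg a r t)]
   :\: [set t | has (fun x => has (fun u => ~~ apart x u) (axis_of Ng ++ diag_of Ng))
        (flatten [seq coords q | q <- gad_neg a r t])].
  apply/set0Pn; rewrite -subset0 subDset setU0; apply/negP=> /subset_leq_card.
  apply/negP; rewrite -ltnNge; apply: leq_ltn_trans (fresh_count hsol a r _) _.
  apply: leq_trans (hY rt); apply: leq_ltn_trans hsz; rewrite leq_mul2l; apply/orP; right.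
  have sz (f g : K * K -> K) : size (flatten [seq [:: f q; g q] | q <- Ng]) = (2 * size Ng)%N.
    by elim: (Ng) => //= q s ->; rewrite mulnS.
  by rewrite size_cat !sz; clear; lia.
rewrite !inE => /andP[ht /andP[hf hap]].
have [f1 f2 f3] := fine_apart hf.
have cr (x u : K) : x \in flatten [seq coords q | q <- gad_neg a r t] ->
    u \in axis_of Ng ++ diag_of Ng -> apart x u.
  move=> hx hu; apply: contraNT ht => h; apply/hasP; exists x => //.
  by apply/hasP; exists u.
have [|||||||P' [N' [h1 h2 h3 h4]]] := IH (gad_neg a r t ++ Ng) (gad_pos a r t ++ P1).
- rewrite all_cat f1; apply/allP=> q qP; apply: (allP nP).
  by rewrite (perm_mem pP) mem_cat qP orbT.
- by move: nN => /= /andP[].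
- by rewrite all_cat hap.
- rewrite axis_of_cat pairwise_cat f2 pA !andbT; apply/allrelP=> x u hx hu.
  apply: cr; last by rewrite mem_cat hu.
  move: hx => /flatten_mapP[q hq hx]; apply/flatten_mapP; exists q => //.
  by move: hx; rewrite !inE => /orP[] ->; rewrite ?orbT.
- rewrite diag_of_cat pairwise_cat f3 pD !andbT; apply/allrelP=> x u hx hu.
  apply: cr; last by rewrite mem_cat hu orbT.
  move: hx => /flatten_mapP[q hq hx]; apply/flatten_mapP; exists q => //.
  by move: hx; rewrite !inE => /orP[] ->; rewrite ?orbT.
- move=> l; have := hle l.
  rewrite eP (csum_consE a Nb) (csum_catE (gad_pos a r t) P1) (csum_catE (gad_neg a r t) Ng).
  by have := gad_sumE a r t l; move: (cov a l); clear; lia.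
- by apply: leq_ltn_trans hsz; rewrite size_cat size_gad_neg leq_mul2l leq_mul2l mulnS addnCA addnA !leqnn !orbT.
exists P', N'; split=> //; rewrite h1; apply/ffunP=> l.
rewrite !(vecD (csum _) (- _)) !vecN !(vecD (csum _) (csum _)) eP (csum_consE a Nb) (csum_catE (gad_pos a r t) P1) (csum_catE (gad_neg a r t) Ng).
by have := gad_sumE a r t l; move: (cov a l); clear; lia.
Qed.

End Absorb.

(** * Completing a partial configuration *)

Section Completion.
Variable K : finComUnitRingType.
Hypothesis u2 : (2 : K) \is a GRing.unit.
Hypothesis u3 : (3 : K) \is a GRing.unit.
Hypothesis hsol : forall (c : nat) (b : K), (0 < c)%N -> (#|[set t : K | t *+ c == b]| <= c)%N.
Hypothesis bigK : (100 < #|K|)%N.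
Variable l : nat.
Hypothesis hcyc : forall x : K, exists2 k : nat, (k < 2 ^ l)%N & x = k%:R.
Variables (in_tri in_two : pred K).
Hypothesis in_tri_neq0 : forall x, in_tri x -> x != 0.
Hypothesis in_two_neq0 : forall x, in_two x -> x != 0.
Hypothesis in_triN : forall x, in_tri (- x) = in_tri x.
Hypothesis in_twoN : forall x, in_two (- x) = in_two x.
Variable Y : nat.
Hypothesis hY : forall a r, rooted a r ->
  (Y <= #|[set t | spread a r t && all (approved in_tri in_two) (gad_neg a r t)]|)%N.
Implicit Types (q a b : K * K) (P N : seq (K * K)).

(* One orbit for each pair {x, -x} of approved parameters, and the central queen. *)
Definition template : seq (K * K) :=
  flatten [seq tri x | x <- enum [pred x | half x && in_tri x]]
  ++ flatten [seq two x | x <- enum [pred x | half x && in_two x]] ++ [:: (0, 0)].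

Definition onev : vec K := [ffun => 1].

Lemma csum_template : csum template =
  \sum_(x | half x && in_tri x) csum (tri x) + \sum_(x | half x && in_two x) csum (two x) + cov (0, 0).
Proof.
rewrite /template !csum_cat csum_cons csum0 addr0 addrA /csum !big_flatten !big_map /=.
by rewrite !big_enum.
Qed.

Definition deg (j : 'I_4) (f : vec K) : int := \sum_x f (j, x).

Lemma degD j (f g : vec K) : deg j (f + g) = deg j f + deg j g.
Proof. by rewrite /deg -big_split; apply: eq_bigr => x _; rewrite vecD. Qed.

Lemma deg_cov j q : deg j (cov q) = 1.
Proof.
rewrite /deg (bigD1 (phi j q)) //= covE /= eqxx big1 ?addr0 // => x hx.
by rewrite covE /= eq_sym (negbTE hx).
Qed.

Lemma deg_csum j s : deg j (csum s) = (size s)%:Z.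
Proof.
elim: s => [|q s IH]; first by rewrite csum0 /deg big1 // => x _; rewrite vec0.
by rewrite csum_cons degD deg_cov IH.
Qed.

Lemma sum_id : \sum_(x : K) x = 0.
Proof.
have h : \sum_(x : K) x = - \sum_(x : K) x.
  rewrite -sumrN [LHS](reindex_inj (@oppr_inj K)) /=; exact: eq_bigr.
have : \sum_(x : K) x + \sum_(x : K) x = 0 by rewrite [X in X + _]h addNr.
by rewrite -mulr2n -mulr_natl => h'; rewrite -[LHS](mulKr u2) h' mulr0.
Qed.

(** Doubling permutes the ring and multiplies the sum by 4, so 3 times the sum is zero. This removes
    the quadratic obstruction for the leave. *)
Lemma sum_sqr : \sum_(x : K) x ^+ 2 = 0.
Proof.
have h : \sum_(x : K) x ^+ 2 = 4 * \sum_(x : K) x ^+ 2.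
  rewrite mulr_sumr [LHS](reindex_inj (can_inj (mulKr u2))) /=.
  by apply: eq_bigr => x _; ring.
have : 3 * \sum_(x : K) x ^+ 2 = 0.
  have -> : 3 = 4 - 1 :> K by ring.
  by rewrite mulrBl mul1r -h subrr.
by move=> h'; rewrite -[LHS](mulKr u3) h' mulr0.
Qed.

Lemma moment_onev (w : nat -> K -> K) : (forall x y, w 0 x + w 1 y + w 2 (x + y) + w 3 (x - y) = 0) ->
  moment w onev = \sum_(x : K) (w 0 x + w 1 x + w 2 x + w 3 x).
Proof.
move=> _; rewrite /moment.
transitivity (\sum_(j : 'I_4) \sum_(x : K) w j x).
  rewrite pair_bigA /=; apply: eq_bigr => p _.
  by rewrite ffunE mulr1z.
by rewrite !big_ord_recl big_ord0 /= addr0 !big_split /= !addrA.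
Qed.

(** The two linear relations between the four lines of a queen: [phi] 2 is the sum and [phi] 3 the
    difference of the coordinates. *)
Definition linS (j : nat) (z : K) : K := match j with 0 => - z | 1 => - z | 2 => z | _ => 0 end.
Definition linD (j : nat) (z : K) : K := match j with 0 => - z | 1 => z | 2 => 0 | _ => z end.
Lemma linS_cov x y : linS 0 x + linS 1 y + linS 2 (x + y) + linS 3 (x - y) = 0.
Proof. by rewrite /linS /=; ring. Qed.
Lemma linD_cov x y : linD 0 x + linD 1 y + linD 2 (x + y) + linD 3 (x - y) = 0.
Proof. by rewrite /linD /=; ring. Qed.

Lemma sum_ge_term (I : eqType) (s : seq I) (F : I -> vec K) p i :
  i \in s -> (forall k, 0 <= F k p) -> F i p <= (\sum_(k <- s) F k) p.
Proof.
move=> + F0; elim: s => // k s IH; rewrite big_cons inE [X in _ <= X]vecD => /orP[/eqP <-|/IH h].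
  rewrite lerDl; elim: s {IH} => [|k' s IH]; first by rewrite big_nil vec0.
  by rewrite big_cons [X in _ <= X]vecD addr_ge0.
by apply: le_trans h _; rewrite lerDr.
Qed.

(** The uncovered lines are grouped into quadruples with one line of each type. The grouping is
    arbitrary, since the moments only see the total. *)
Lemma leave_lines (f : vec K) (m : nat) : (forall p, (f p == 0) || (f p == 1)) ->
  (forall j, deg j f = m%:Z) ->
  exists2 ts : seq ((K * K) * (K * K)), size ts = m &
    f = \sum_(t <- ts) (dl 0 t.1.1 + dl 1 t.1.2 + dl 2 t.2.1 + dl 3 t.2.2).
Proof.
move=> f01 degf; pose e (j : 'I_4) := enum [set x | f (j, x) == 1].
have sz j : size (e j) = m.
  apply/eqP; rewrite -cardE -eqz_nat -(degf j) /deg (bigID (fun x => f (j, x) == 1)) /=.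
  rewrite [X in _ + X]big1 ?addr0; last first.
    by move=> x /negbTE hx; have := f01 (j, x); rewrite hx orbF => /eqP.
  rewrite (eq_bigr (fun=> 1)); last by move=> x /eqP.
  by rewrite sumr_const cardsE natz.
pose o k (h : (k < 4)%N) : 'I_4 := Ordinal h.
exists (zip (zip (e (o 0 isT)) (e (o 1 isT))) (zip (e (o 2 isT)) (e (o 3 isT)))).
  by rewrite !size_zip !sz !minnn.
have row (j : nat) (h : (j < 4)%N) (x : K) :
    (\sum_(y <- e (o j h)) dl j y) (o j h, x) = f (o j h, x).
  have -> : (\sum_(y <- e (o j h)) dl j y) (o j h, x) = \sum_(y <- e (o j h)) dl j y (o j h, x).
    by elim: (e (o j h)) => [|y s IH]; rewrite !(big_nil, big_cons) ?vecE // IH.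
  rewrite (eq_bigr (fun y => (x == y)%:Z)); last by move=> y _; rewrite dlE /= eqxx.
  rewrite /e big_enum /= (eq_bigl (fun y => f (o j h, y) == 1)); last by move=> y; rewrite inE.
  have := f01 (o j h, x); case: (boolP (f (o j h, x) == 1)) => [hx _|hx].
    rewrite (bigD1 x) //= eqxx big1 ?addr0; first by rewrite (eqP hx).
    by move=> y /andP[_ hy]; rewrite eq_sym (negbTE hy).
  rewrite orbF => /eqP hx0; rewrite hx0 big1 // => y hy.
  by case: eqP => // e0; rewrite e0 hy in hx.
have row0 (j i : nat) (h : (j < 4)%N) (x : K) (s : seq K) : i != j ->
    (\sum_(y <- s) dl i y) (o j h, x) = 0.
  move=> ij; elim: s => [|y s IH]; rewrite !(big_nil, big_cons) ?vecE //.
  by rewrite IH dlE /= eq_sym (negbTE ij).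
have zp1 (T1 T2 : Type) (s1 : seq T1) (s2 : seq T2) (F : T1 -> vec K) : size s1 = size s2 ->
    \sum_(t <- zip s1 s2) F t.1 = \sum_(x <- s1) F x.
  by move=> h; rewrite -(big_map fst predT) /= -/(unzip1 _) unzip1_zip // h.
have zp2 (T1 T2 : Type) (s1 : seq T1) (s2 : seq T2) (F : T2 -> vec K) : size s1 = size s2 ->
    \sum_(t <- zip s1 s2) F t.2 = \sum_(x <- s2) F x.
  by move=> h; rewrite -(big_map snd predT) /= -/(unzip2 _) unzip2_zip // h.
rewrite !big_split /=.
rewrite (zp1 _ _ _ _ (fun t : K * K => dl 0 t.1)) ?size_zip ?sz //.
rewrite (zp1 _ _ _ _ (fun t : K * K => dl 1 t.2)) ?size_zip ?sz //.
rewrite (zp2 _ _ _ _ (fun t : K * K => dl 2 t.1)) ?size_zip ?sz //.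
rewrite (zp2 _ _ _ _ (fun t : K * K => dl 3 t.2)) ?size_zip ?sz //.
rewrite (zp1 _ _ _ _ (fun t : K => dl 0 t)) ?sz // (zp2 _ _ _ _ (fun t : K => dl 1 t)) ?sz //.
rewrite (zp1 _ _ _ _ (fun t : K => dl 2 t)) ?sz // (zp2 _ _ _ _ (fun t : K => dl 3 t)) ?sz //.
apply/ffunP=> -[j x]; rewrite !vecD.
have jE (k : nat) (h h' : (k < 4)%N) : Ordinal h = o k h' by exact: val_inj.
by case: j => [[|[|[|[|//]]]] hj]; rewrite (jE _ hj isT) row !row0 ?addr0 ?add0r.
Qed.

(** The leave [f] becomes P' - N' with all of N' approved. The template orbits consumed by N' have
    the sum of N' and its [trade_rest], so N' cancels and only positive queens remain. *)
Lemma completion (M : seq (K * K)) (m : nat) :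
  (forall p, csum (M ++ template) p <= 1) ->
  (size (M ++ template) + m = #|K|)%N ->
  (2 * m + 3 < #|K|)%N ->
  (gad_coord_bound * (8 * (32 * (m.+1 * (400 * l + 400)))) < Y)%N ->
  exists s, csum (M ++ s) = onev.
Proof.
move=> hle hsz hm hYm.
pose f := onev - csum (M ++ template).
have fE p : f p = 1 - csum (M ++ template) p by rewrite /f vecD vecN ffunE.
have f01 p : (f p == 0) || (f p == 1).
  by have := csum_ge0 (M ++ template) p; have := hle p; rewrite fE; clear; lia.
have degf j : deg j f = m%:Z.
  have : deg j (f + csum (M ++ template)) = #|K|%:Z.
    rewrite /f subrK /deg (eq_bigr (fun=> 1)); first by rewrite sumr_const natz.
    by move=> x _; rewrite ffunE.
  by rewrite degD deg_csum -hsz; clear; lia.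
have [ts szt ft] := leave_lines f01 degf.
have mom (w : nat -> K -> K) : (forall x y, w 0 x + w 1 y + w 2 (x + y) + w 3 (x - y) = 0) ->
    \sum_(x : K) (w 0 x + w 1 x + w 2 x + w 3 x) = 0 ->
    \sum_(t <- ts) (w 0 t.1.1 + w 1 t.1.2 + w 2 t.2.1 + w 3 t.2.2) = 0.
  move=> wc w0; have : moment w f = 0.
    by rewrite /f momentD momentN (moment_csum wc) (moment_onev wc) w0 subrr.
  rewrite ft moment_sum => h; rewrite -[RHS]h; apply: eq_bigr => t _.
  by rewrite !momentD !moment_dl.
have rf : rep (m.+1 * (400 * l + 400)) f.
  rewrite ft -szt; apply: (lattice_rep u2 bigK hcyc).
  - by rewrite szt.
  (* The central queen covers the zero lines, so the leave avoids them, as [lattice_rep] demands. *)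
  - have f0 j : f (j, 0) = 0.
      have h1 : 1 <= csum (M ++ template) (j, 0).
        rewrite csum_catE /template !csum_catE csum_consE covE.
        have -> : phi j (0, 0) = 0 :> K.
          by case: j => [[|[|[|[|//]]]] //= hj]; rewrite /phi /= ?addr0 ?subr0.
        rewrite eqxx /=; have := @csum_ge0 K.
        move=> h; move: (h M (j, 0)) (h [::] (j, 0)).
        move: (h (flatten [seq tri x | x <- enum [pred x | half x && in_tri x]]) (j, 0)).
        move: (h (flatten [seq two x | x <- enum [pred x | half x && in_two x]]) (j, 0)).
        move: (csum M _) (csum [::] _) (csum _ _) (csum _ _) => a b c d.
        by clear; lia.
      by have := hle (j, 0); rewrite fE; move: h1; clear; lia.
    have d0 (i : nat) (z : K) p : 0 <= dl i z p :> int by rewrite dlE; case: (_ && _).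
    apply/allP=> t ht.
    have hh (j : 'I_4) (z : K) (F : vec K) : dl j z (j, z) <= F (j, z) ->
        F (j, z) <= f (j, z) -> z != 0.
      rewrite dlE /= !eqxx => h1 h2; apply: contraTneq (le_trans h1 h2) => ->.
      by rewrite f0.
    pose G (k : (K * K) * (K * K)) := dl 0 k.1.1 + dl 1 k.1.2 + dl 2 k.2.1 + dl 3 k.2.2.
    have F0 p (k : (K * K) * (K * K)) : 0 <= G k p.
      by rewrite /G !vecD !addr_ge0.
    have fin (j : 'I_4) (z : K) :
       dl j z (j, z) <= G t (j, z) -> z != 0.
      by move=> h; apply: (hh j z _ h); rewrite ft; exact: (@sum_ge_term _ ts G (j, z) t ht).
    have gG p : [/\ dl 0 t.1.1 p <= G t p, dl 1 t.1.2 p <= G t p, dl 2 t.2.1 p <= G t p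
        & dl 3 t.2.2 p <= G t p].
      move: (d0 0%N t.1.1 p) (d0 1%N t.1.2 p) (d0 2%N t.2.1 p) (d0 3%N t.2.2 p).
      rewrite /G !vecD; move: (dl 0 _ _) (dl 1 _ _) (dl 2 _ _) (dl 3 _ _) => a b c d.
      by clear; move=> *; split; lia.
    apply/and4P; split.
    + by apply: (fin (Ordinal (isT : 0 < 4)%N)); have [] := gG (Ordinal (isT : 0 < 4)%N, t.1.1).
    + by apply: (fin (Ordinal (isT : 1 < 4)%N)); have [] := gG (Ordinal (isT : 1 < 4)%N, t.1.2).
    + by apply: (fin (Ordinal (isT : 2 < 4)%N)); have [] := gG (Ordinal (isT : 2 < 4)%N, t.2.1).
    + by apply: (fin (Ordinal (isT : 3 < 4)%N)); have [] := gG (Ordinal (isT : 3 < 4)%N, t.2.2).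
  - rewrite -[RHS](mom _ linS_cov); first by apply: eq_bigr => t _; rewrite /linS /=; ring.
    by rewrite -[RHS]oppr0 -[in RHS]sum_id -sumrN; apply: eq_bigr => t _; rewrite /linS /=; ring.
  - rewrite -[RHS](mom _ linD_cov); first by apply: eq_bigr => t _; rewrite /linD /=; ring.
    by rewrite -[RHS]sum_id; apply: eq_bigr => t _; rewrite /linD /=; ring.
  - rewrite -[RHS](mom _ (@quad_cov K)); first by apply: eq_bigr => t _; rewrite /quad /=; ring.
    rewrite (eq_bigr (fun x : K => - 2 * x ^+ 2)); last by move=> t _; rewrite /quad /=; ring.
    by rewrite -mulr_sumr sum_sqr mulr0.
case: rf => P [N [fPN nP nN sP sN]].
have hPN p : csum N p + csum [::] p <= csum P p.
  have : 0 <= f p by case/orP: (f01 p) => /eqP ->.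
  by rewrite fPN vecD vecN csum0 vec0; clear; lia.
have hY' : (gad_coord_bound * (8 * (size (@nil (K * K)) + 32 * size N)) < Y)%N.
  by apply: leq_ltn_trans hYm; rewrite add0n !leq_mul2l sN !orbT.
have [P' [N' [e aN' pA pD]]] := @absorb K u2 hsol in_tri in_two Y hY N [::] P nP nN isT isT isT hPN hY'.
rewrite csum0 addr0 -fPN in e.
have a3 : all in_tri (axis_of N').
  apply/allP=> x /flatten_mapP[q qN]; have /and4P[h1 h2 _ _] := allP aN' q qN.
  by rewrite !inE => /orP[] /eqP ->.
have a2 : all in_two (diag_of N').
  apply/allP=> x /flatten_mapP[q qN]; have /and4P[_ _ h1 h2] := allP aN' q qN.
  by rewrite !inE => /orP[] /eqP ->.
have [s3 e3] := half_sum u2 in_tri_neq0 in_triN (@csum_triN K) a3 pA.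
have [s2 e2] := half_sum u2 in_two_neq0 in_twoN (@csum_twoN K) a2 pD.
exists (P' ++ flatten [seq trade_rest q | q <- N'] ++ s3 ++ s2 ++ [:: (0, 0)]).
have e4 : \sum_(u <- axis_of N') csum (tri u) + \sum_(u <- diag_of N') csum (two u)
    = csum N' + csum (flatten [seq trade_rest q | q <- N']).
  have fl (g : K * K -> seq (K * K)) (s : seq (K * K)) :
      csum (flatten [seq g q | q <- s]) = \sum_(q <- s) csum (g q).
    by rewrite /csum big_flatten big_map.
  have fs (g : K * K -> seq K) (F : K -> vec K) (s : seq (K * K)) :
      \sum_(u <- flatten [seq g q | q <- s]) F u = \sum_(q <- s) \sum_(u <- g q) F u.
    by rewrite big_flatten big_map.
  rewrite fl /axis_of /diag_of !fs -big_split /= [csum N']/csum -big_split /=.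
  by apply: eq_bigr => q _; rewrite -trade !(big_cons, big_nil) !addr0 addrA.
have eo : onev = f + csum M + csum template by rewrite /f csum_cat -addrA subrK.
rewrite eo csum_template e3 e2 -e !csum_cat csum_cons csum0.
move: e4; move: (\sum_(u <- axis_of N') _) (\sum_(u <- diag_of N') _) => A B e4.
have -> : B = csum N' + csum (flatten [seq trade_rest q | q <- N']) - A by rewrite -e4 addrC addKr.
move: (cov _) (csum N') (csum P') (csum M) (csum s3) (csum s2) (csum _) => *.
by apply/ffunP=> p; rewrite !vecE; ring.
Qed.

End Completion.

(** * The random greedy process *)

Section Greedy.
Variable K : finComUnitRingType.
Hypothesis u2 : (2 : K) \is a GRing.unit.
Local Notation line := ('I_4 * K)%type.
Local Notation queen := (K * K)%type.
Implicit Types (U : {set line}) (v : line) (q f : queen) (i j : 'I_4).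

Definition lines q : {set line} := [set v | phi v.1 q == v.2].
Definition avail U : {set queen} := [set q | lines q \subset U].
Definition through U v : {set queen} := [set q in avail U | v \in lines q].
Definition avail_degree U v := #|through U v|.
Definition slice U j : {set K} := [set x | (j, x) \in U].
Definition balanced U N := forall j, #|slice U j| = N.

Lemma in_lines q j x : ((j, x) \in lines q) = (phi j q == x).
Proof. by rewrite inE. Qed.

Lemma mem_line q j : (j, phi j q) \in lines q.
Proof. by rewrite in_lines. Qed.

Lemma availP U q : reflect (forall j, (j, phi j q) \in U) (q \in avail U).
Proof.
rewrite inE; apply: (iffP subsetP) => [h j|h [j x]]; first by rewrite h ?mem_line.
by rewrite in_lines => /eqP <-.
Qed.

Lemma balanced_step U N q : balanced U N.+1 -> q \in avail U -> balanced (U :\: lines q) N.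
Proof.
move=> b /availP hq j.
have -> : slice (U :\: lines q) j = slice U j :\ phi j q.
  by apply/setP=> x; rewrite !inE /= eq_sym.
have := b j; rewrite (cardsD1 (phi j q)) inE hq => -[] //.
Qed.

Lemma card_avail U j : #|avail U| = (\sum_(x in slice U j) avail_degree U (j, x))%N.
Proof.
rewrite -sum1_card (partition_big (phi j) (mem (slice U j))) /=; last first.
  by move=> q /availP h; rewrite inE.
apply: eq_bigr => x _; rewrite /avail_degree -sum1_card; apply: eq_bigl => q.
by rewrite [in RHS]inE in_lines.
Qed.

Lemma through_le U v i y : v.1 != i -> (#|[set f in through U v | phi i f == y]| <= 1)%N.
Proof.
move=> vi; apply/card_le1_eqP => f f'.
rewrite !inE => /andP[/andP[_ /eqP h1] /eqP h2] /andP[/andP[_ /eqP h1'] /eqP h2'].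
by apply: (line_inj u2 vi); rewrite ?h1 ?h2.
Qed.

Definition hit U v q := #|[set f in through U v | lines f :&: lines q != set0]|.

Lemma avail_degree_step U v q : v \in U -> q \in avail U -> v \notin lines q ->
  avail_degree U v = (avail_degree (U :\: lines q) v + hit U v q)%N.
Proof.
move=> vU qU vq; rewrite /avail_degree /hit.
rewrite -(cardsID [set f | lines f :&: lines q == set0] (through U v)); congr (_ + _)%N.
  apply: eq_card => f; rewrite !inE subsetD setI_eq0 andbAC; congr (_ && _).
apply: eq_card => f; rewrite !inE andbC //.
Qed.

(** A queen through [v] meets [q] on at most one line, as otherwise it would be [q]; so hits can be
    counted by the type of the common line. *)
Lemma hitE U v q : v \notin lines q ->
  hit U v q = (\sum_(f in through U v) \sum_(i | i != v.1) (phi i f == phi i q))%N.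
Proof.
move=> vq; rewrite /hit -sum1_card big_mkcond /= [in RHS]big_mkcond /=.
apply: eq_bigr => f _; rewrite in_set; case: (boolP (f \in through U v)) => //= hf.
have vf : phi v.1 f = v.2 by move: hf; rewrite !inE => /andP[_ /eqP].
have fv : phi v.1 f != phi v.1 q by rewrite vf eq_sym; move: vq; rewrite inE.
have fq : f != q by apply: contraNneq fv => ->.
case: ifP => [/set0Pn[[i x]]|/negbT h].
  rewrite !inE /= => /andP[/eqP <- /eqP e].
  have iv : i != v.1 by apply: contraNneq fv => <-; rewrite e.
  rewrite (bigD1 i) //= e eqxx big1 // => k /andP[kv ki].
  apply/eqP; rewrite eqb0; apply: contraNN fq => /eqP ek.
  by apply/eqP; apply: (line_inj u2 ki).
rewrite big1 // => i _; apply/eqP; rewrite eqb0; apply: contraNN h => /eqP e.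
by apply/set0Pn; exists (i, phi i q); rewrite !inE /= e eqxx.
Qed.

Lemma hit_le3 U v q : v \notin lines q -> (hit U v q <= 3)%N.
Proof.
move=> vq; rewrite hitE // exchange_big /=.
apply: (@leq_trans (\sum_(i : 'I_4 | i != v.1) 1)%N); last first.
  by rewrite sum1_card (cardC1 v.1) card_ord.
apply: leq_sum => i hi; apply: leq_trans (through_le U (phi i q) (_ : v.1 != i)); last by rewrite eq_sym.
rewrite -sum1_card big_mkcond [X in (_ <= X)%N]big_mkcond leq_sum // => f _.
by rewrite in_set; case: (_ \in _); case: eqP.
Qed.

(** After exchanging the sums, the queens to count are those on a further line of [f]. Among them
    only [f] itself passes through [v], which explains the predecessor. *)
Lemma hit_sum U v : v \in U ->
  (\sum_(q in avail U | v \notin lines q) hit U v q =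
   \sum_(f in through U v) \sum_(i | i != v.1) (avail_degree U (i, phi i f)).-1)%N.
Proof.
move=> vU; rewrite (eq_bigr (fun q => \sum_(f in through U v) \sum_(i | i != v.1) (phi i f == phi i q)))%N; last first.
  by move=> q /andP[_ /hitE].
rewrite exchange_big; apply: eq_bigr => f hf /=.
rewrite exchange_big; apply: eq_bigr => i hi /=.
have ft : f \in through U (i, phi i f) by move: hf; rewrite !inE eqxx andbT => /andP[].
rewrite /avail_degree (cardsD1 f) ft /= -sum1_card [LHS]big_mkcond [RHS]big_mkcond /=.
apply: eq_bigr => q _; rewrite in_setD1 [q \in through U (i, _)]in_set in_lines (eq_sym (phi i f)).
case: (q \in avail U); rewrite ?andbF //=.
have vf : phi v.1 f = v.2 by move: hf; rewrite !inE => /andP[_ /eqP].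
case: (phi i q =P phi i f) => [e|_]; rewrite ?andbF ?andbT; last by case: ifP.
rewrite (_ : (v \notin lines q) = (q != f)); first by case: ifP.
rewrite inE -vf; congr (~~ _); apply/eqP/eqP => [e'|->//].
by apply: (line_inj u2 hi).
Qed.

Section Count.
Fixpoint greedy_count (k : nat) U : nat :=
  if k is k'.+1 then \sum_(q in avail U) greedy_count k' (U :\: lines q) else 1.

Definition packings (k : nat) U : {set {set queen}} :=
  [set M : {set queen} | (#|M| == k) && [forall q in M, (lines q \subset U)
    && [forall q' in M, (q != q') ==> [disjoint lines q & lines q']]]].

Lemma packings_step k U q M : q \in avail U -> M \in packings k (U :\: lines q) ->
  (q \notin M) && (q |: M \in packings k.+1 U).
Proof.
rewrite !inE => qU /andP[/eqP <- /forall_inP hM].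
have hq q' : q' \in M -> [disjoint lines q' & lines q].
  by move=> /hM /andP[]; rewrite subsetD => /andP[_].
have qM : q \notin M.
  apply/negP=> /hq; rewrite -setI_eq0 setIid => /eqP h.
  by have := mem_line q ord0; rewrite h inE.
rewrite qM cardsU1 qM /= eqxx /=; apply/forall_inP=> p; rewrite in_setU1 => /orP[/eqP ->|pM].
  rewrite qU; apply/forall_inP=> p'; rewrite in_setU1 => /orP[/eqP ->|p'M]; first by rewrite eqxx.
  by apply/implyP=> _; rewrite disjoint_sym hq.
have /andP[] := hM p pM; rewrite subsetD => /andP[-> _] /forall_inP h /=.
apply/forall_inP=> p'; rewrite in_setU1 => /orP[/eqP ->|p'M]; last exact: h.
by apply/implyP=> _; exact: hq.
Qed.

(** [greedy_count] counts ordered runs, and a packing arises from at most k! orders; the induction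
    marks the first queen of the run. *)
Lemma greedy_count_packings k U : (greedy_count k U <= k`! * #|packings k U|)%N.
Proof.
elim: k U => [|k IH] U /=.
  rewrite fact0 mul1n card_gt0; apply/set0Pn; exists set0.
  by rewrite inE cards0 eqxx; apply/forall_inP=> q; rewrite inE.
apply: (@leq_trans (\sum_(q in avail U) k`! * #|packings k (U :\: lines q)|)%N).
  by apply: leq_sum => q _; exact: IH.
rewrite -big_distrr /= factS (mulnC k.+1) -mulnA leq_mul2l; apply/orP; right.
apply: (@leq_trans (\sum_(q in avail U) #|[set M in packings k.+1 U | q \in M]|)%N).
  apply: leq_sum => q qU.
  rewrite -(card_in_imset (f := fun M => q |: M)); last first.
    move=> M M' hM hM' e.
    have /andP[n1 _] := packings_step qU hM; have /andP[n2 _] := packings_step qU hM'.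
    by rewrite -(setU1K n1) e setU1K.
  apply: subset_leq_card; apply/subsetP=> _ /imsetP[M hM ->].
  by have /andP[_ h] := packings_step qU hM; rewrite inE h setU11.
rewrite (eq_bigr (fun q => \sum_(M in packings k.+1 U) (q \in M))%N); last first.
  move=> q _; rewrite -sum1_card big_mkcond [RHS]big_mkcond; apply: eq_bigr => M _.
  by rewrite in_set; case: (M \in _); case: (q \in M).
rewrite exchange_big /= (eq_bigr (fun=> k.+1)).
  by rewrite sum_nat_const mulnC.
move=> M hM; have /andP[/eqP <- /forall_inP h] : (#|M| == k.+1) && [forall q in M, (lines q \subset U)
    && [forall q' in M, (q != q') ==> [disjoint lines q & lines q']]] by move: hM; rewrite inE.
rewrite -sum1_card [RHS]big_mkcond [LHS]big_mkcond; apply: eq_bigr => q _ /=.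
case: (boolP (q \in M)) => qM; last by case: ifP.
by have /andP[hq _] := h q qM; rewrite inE hq.
Qed.

End Count.
End Greedy.

(** * Random templates *)

Section Template.
Variable K : finComUnitRingType.
Hypothesis u2 : (2 : K) \is a GRing.unit.
Hypothesis u3 : (3 : K) \is a GRing.unit.
Variable p : nat.
Hypothesis p3 : (3 <= p)%N.
Local Notation cell := (bool * K)%type.
Local Notation Om := {ffun cell -> 'I_p.+1}.
Implicit Types (x y z : K) (w : Om) (e : seq (cell * nat)) (v : 'I_4 * K).

(* Cells are indexed by residues up to sign. *)
Definition sgn_repr x := if half x then x else - x.

Lemma sgn_repr_eq x y : (sgn_repr x == sgn_repr y) = ~~ apart x y.
Proof.
have h0 : half (0 : K) = false by rewrite /half oppr0 ltnn.
rewrite /sgn_repr /apart negb_and !negbK; have [->|x0] := eqVneq x 0.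
  by rewrite h0 oppr0; case: ifP => _; rewrite ![0 == _]eq_sym ?oppr_eq0 orbb.
have [->|y0] := eqVneq y 0.
  by rewrite h0 oppr0 orbb; case: ifP; rewrite ?oppr_eq0.
case: ifP => hx; case: ifP => hy.
- rewrite [x == - y](_ : _ = false) ?orbF //; apply/eqP => e.
  by move: hx; rewrite e half_neg // hy.
- rewrite [x == y](_ : _ = false) //; apply/eqP => e.
  by move: hx; rewrite e hy.
- rewrite eqr_oppLR [x == y](_ : _ = false) //; apply/eqP => e.
  by move: hx; rewrite e hy.
- rewrite eqr_opp [x == - y](_ : _ = false) ?orbF //; apply/eqP => e.
  by move: hx; rewrite e half_neg // hy.
Qed.

Lemma sgn_reprN x : sgn_repr (- x) = sgn_repr x.
Proof. by apply/eqP; rewrite sgn_repr_eq /apart eqxx andbF. Qed.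

(* The colours of the four cells of an orbit that put it into the template; since the
   colours at a cell determine the role of the corresponding line, chosen orbits are
   disjoint. *)
Definition tri_event x : seq (cell * nat) :=
  [:: (false, x, 0); (false, x *+ 3, 1); (true, x *+ 2, 0); (true, x *+ 4, 1)]%N.
Definition two_event x : seq (cell * nat) :=
  [:: (false, x, 2); (false, x *+ 2, 3); (true, x, 2); (true, x *+ 3, 3)]%N.

Definition holds w e := all (fun c => w (c.1.1, sgn_repr c.1.2) == inord c.2) e.

Arguments holds : simpl never.

Definition in_tri w x := (x != 0) && holds w (tri_event x).
Definition in_two w x := (x != 0) && holds w (two_event x).

Lemma in_tri_neq0 w x : in_tri w x -> x != 0. Proof. by case/andP. Qed.
Lemma in_two_neq0 w x : in_two w x -> x != 0. Proof. by case/andP. Qed.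
Lemma in_triN w x : in_tri w (- x) = in_tri w x.
Proof. by rewrite /in_tri oppr_eq0 /holds /= !mulNrn !sgn_reprN. Qed.
Lemma in_twoN w x : in_two w (- x) = in_two w x.
Proof. by rewrite /in_two oppr_eq0 /holds /= !mulNrn !sgn_reprN. Qed.

Definition random_template w := template (in_tri w) (in_two w).

(* The events through which the template can cover the line [v]. *)
Definition cover_events v : seq (seq (cell * nat)) :=
  if (v.1 < 2)%N then [:: tri_event v.2; tri_event (v.2 / 3); two_event v.2; two_event (v.2 / 2)]
  else [:: tri_event (v.2 / 2); tri_event (v.2 / 4); two_event v.2; two_event (v.2 / 3)].

Definition num_cover w v := count (holds w) (cover_events v).

Lemma half_pair (X : pred K) (g : K -> int) : (forall x, X x -> x != 0) ->
  (forall x, X (- x) = X x) ->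
  \sum_(x | half x && X x) (g x + g (- x)) = \sum_(x | X x) g x.
Proof.
move=> X0 XN; rewrite big_split [RHS](bigID (@half K)) /=; congr (_ + _).
  by apply: eq_bigl => x; rewrite andbC.
rewrite (reindex_inj (@oppr_inj K)) /=; apply: eq_big => [x|x _]; last by rewrite opprK.
rewrite XN andbC; case: (boolP (X x)) => //= /X0 x0; exact: (half_neg u2).
Qed.

(** The two signs make up for the choice of one element in each pair, and only x = z/m contributes
    to the full sum. *)
Lemma scaled_sum (X : pred K) z (m : nat) : (forall x, X x -> x != 0) ->
  (forall x, X (- x) = X x) -> (m%:R : K) \is a GRing.unit ->
  \sum_(x | half x && X x) ((z == x *+ m)%:Z + (z == - (x *+ m))%:Z) = (X (z / m%:R))%:Z.
Proof.
move=> X0 XN um.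
rewrite (eq_bigr (fun x => (z == x *+ m)%:Z + (z == (- x) *+ m)%:Z)); last by move=> x _; rewrite mulNrn.
rewrite (half_pair (fun x => (z == x *+ m)%:Z)) // big_mkcond (bigD1 (z / m%:R)) //=.
rewrite -[X in z == X]mulr_natr divrK // eqxx big1 ?addr0; first by case: ifP.
move=> x hx; case: ifP => // _; rewrite (_ : (z == _) = false) //.
by apply: contraNF hx => /eqP ->; rewrite -[x *+ m]mulr_natr mulrK.
Qed.

Let u4 : (4 : K) \is a GRing.unit. Proof. by rewrite (_ : 4 = 2 * 2) ?unitrMl // -natrM. Qed.

Lemma div0 x y : y \is a GRing.unit -> (x / y == 0) = (x == 0).
Proof.
move=> uy; apply/eqP/eqP => [h|->]; last by rewrite mul0r.
by rewrite -(divrK uy x) h mul0r.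
Qed.

Lemma sumE (P : pred K) (F : K -> vec K) l : (\sum_(x | P x) F x) l = \sum_(x | P x) F x l.
Proof. by apply: (big_morph (fun f : vec K => f l)) => [f g|]; rewrite ?vecD ?vec0. Qed.

Lemma axisvE y v : axisv y v = (v.1 < 2)%N%:Z * ((v.2 == y)%:Z + (v.2 == - y)%:Z).
Proof.
rewrite /axisv !vecD !dlE; case: v => [[[|[|[|[|//]]]] hj] z] /=; rewrite ?addr0 ?add0r ?mul1r ?mul0r //.
Qed.

Lemma diagvE y v : diagv y v = (2 <= v.1)%N%:Z * ((v.2 == y)%:Z + (v.2 == - y)%:Z).
Proof.
rewrite /diagv !vecD !dlE; case: v => [[[|[|[|[|//]]]] hj] z] /=; rewrite ?addr0 ?add0r ?mul1r ?mul0r //.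
Qed.

Lemma vec4 (f1 f2 f3 f4 : vec K) l : (f1 + f2 + f3 + f4) l = f1 l + f2 l + f3 l + f4 l.
Proof. by rewrite !vecD. Qed.

Lemma csum_random_template w v : csum (random_template w) v = if v.2 == 0 then 1 else (num_cover w v)%:Z.
Proof.
rewrite /random_template csum_template [LHS]vecD [X in X + _]vecD covE.
have -> : phi v.1 (0, 0) = 0 :> K.
  by case: (v.1) => [[|[|[|[|//]]]] //= hj]; rewrite /phi /= ?addr0 ?subr0.
rewrite !sumE [in LHS]eq_sym.
rewrite (eq_bigr (fun x => (v.1 < 2)%N%:Z * ((v.2 == x *+ 1)%:Z + (v.2 == - (x *+ 1))%:Z)
    + (v.1 < 2)%N%:Z * ((v.2 == x *+ 3)%:Z + (v.2 == - (x *+ 3))%:Z)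
    + (2 <= v.1)%N%:Z * ((v.2 == x *+ 2)%:Z + (v.2 == - (x *+ 2))%:Z)
    + (2 <= v.1)%N%:Z * ((v.2 == x *+ 4)%:Z + (v.2 == - (x *+ 4))%:Z))); last first.
  by move=> x _; rewrite csum_tri vec4 !axisvE !diagvE.
rewrite [X in _ + X + _](eq_bigr (fun x => (v.1 < 2)%N%:Z * ((v.2 == x *+ 1)%:Z + (v.2 == - (x *+ 1))%:Z)
    + (v.1 < 2)%N%:Z * ((v.2 == x *+ 2)%:Z + (v.2 == - (x *+ 2))%:Z)
    + (2 <= v.1)%N%:Z * ((v.2 == x *+ 1)%:Z + (v.2 == - (x *+ 1))%:Z)
    + (2 <= v.1)%N%:Z * ((v.2 == x *+ 3)%:Z + (v.2 == - (x *+ 3))%:Z))); last first.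
  by move=> x _; rewrite csum_two vec4 !axisvE !diagvE.
rewrite !big_split -!mulr_sumr /=.
have u1 : ((1 : nat)%:R : K) \is a GRing.unit by exact: unitr1.
rewrite !(scaled_sum _ (@in_tri_neq0 w) (@in_triN w)) // !(scaled_sum _ (@in_two_neq0 w) (@in_twoN w)) //.
rewrite /in_tri /in_two !div0 // divr1 /num_cover /cover_events ltnNge.
have [->|z0] := eqVneq v.2 0; first by rewrite /= !mulr0.
case: leqP => h /=; rewrite !mul1r !mul0r !addr0 ?add0r.
  by do 4!case: (holds w _).
by do 4!case: (holds w _).
Qed.

(** The events in [cover_events] are listed by the colour that they prescribe at the cell of [v]. At
    most one of them can therefore hold, and the template never covers a line twice. *)
Lemma holds_head w v k : (k < 4)%N -> holds w (nth [::] (cover_events v) k) ->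
  w ((2 <= v.1)%N, sgn_repr v.2) = inord k.
Proof.
have d (x : K) (m : nat) : (m%:R : K) \is a GRing.unit -> x / m%:R *+ m = x.
  by move=> um; rewrite -mulr_natr divrK.
rewrite /cover_events (ltnNge v.1); case: (leqP 2 v.1) => h; case: k => [|[|[|[|//]]]] _;
  rewrite /holds /= ?(d _ 2) ?(d _ 3) ?(d _ 4) //.
- by case/and5P=> _ _ /eqP.
- by case/and5P=> _ _ _ /eqP.
- by case/and5P=> _ _ /eqP.
- by case/and5P=> _ _ _ /eqP.
- by case/and5P=> /eqP.
- by case/and5P=> _ /eqP.
- by case/and5P=> /eqP.
- by case/and5P=> _ /eqP.
Qed.

Lemma num_cover_le1 w v : (num_cover w v <= 1)%N.
Proof.
have hd := @holds_head w v.
have e : cover_events v = [seq nth [::] (cover_events v) k | k <- iota 0 4].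
  by rewrite /cover_events; case: ifP.
rewrite /num_cover e count_map leqNgt; apply/negP => h.
have un : uniq (filter (preim (nth [::] (cover_events v)) (holds w)) (iota 0 4)).
  by rewrite filter_uniq // iota_uniq.
rewrite -size_filter in h.
case E : (filter _ _) h un => [|a [|b s]] //= _ /andP[]; rewrite inE negb_or => /andP[/eqP ab _] _.
have ha : a \in filter (preim (nth [::] (cover_events v)) (holds w)) (iota 0 4) by rewrite E !inE eqxx.
have hb : b \in filter (preim (nth [::] (cover_events v)) (holds w)) (iota 0 4) by rewrite E !inE eqxx orbT.
move: ha hb; rewrite !mem_filter !mem_iota /= add0n => /andP[/hd ha a4] /andP[/hd hb b4].
apply: ab; have := ha a4; rewrite (hb b4) => /(congr1 val); rewrite /= !inordK //; lia.
Qed.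

Lemma csum_random_template_le1 w v : csum (random_template w) v <= 1.
Proof. by rewrite csum_random_template; case: ifP => // _; have := num_cover_le1 w v; case: num_cover => [|[|]]. Qed.

Definition uncovered w : {set 'I_4 * K} := [set v | csum (random_template w) v == 0].

Lemma uncovered_unc w v : (v \in uncovered w) = (v.2 != 0) && (num_cover w v == 0%N).
Proof. by rewrite inE csum_random_template; case: ifP. Qed.

Lemma balanced_uncovered w : exists2 n0, balanced (uncovered w) n0 & (size (random_template w) + n0 = #|K|)%N.
Proof.
have key j : (size (random_template w) + #|slice (uncovered w) j| = #|K|)%N.
  have h : (size (random_template w))%:Z = #|K|%:Z - #|slice (uncovered w) j|%:Z.
    rewrite -(deg_csum j) /deg (eq_bigr (fun x => 1 - (x \in slice (uncovered w) j)%:Z)).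
      rewrite sumrB sumr_const natz; congr (_ - _).
      rewrite -[RHS]natz -sum1_card natr_sum [RHS]big_mkcond; apply: eq_bigr => x _.
      by case: (_ \in _).
    move=> x _; rewrite !inE; have := csum_random_template_le1 w (j, x); have := csum_ge0 (random_template w) (j, x).
    by move: (csum _ _) => c; clear; case: c => [[|[|c]]|].
  by move: h; clear; lia.
exists (#|K| - size (random_template w))%N => [j|].
  by rewrite -(key j) addKn.
by rewrite subnKC // -(key ord0) leq_addr.
Qed.

End Template.

(** * Coincidences between two lines of a queen *)

Section Cross.
Variable K : finComUnitRingType.
Hypothesis u2 : (2 : K) \is a GRing.unit.
Hypothesis u3 : (3 : K) \is a GRing.unit.
Hypothesis hsol : forall (c : nat) (b : K), (0 < c)%N -> (#|[set t : K | t *+ c == b]| <= c)%N.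
Implicit Types (q : K * K) (i j : 'I_4) (x y z : K).

Definition px i : int := match val i with 1 => 0 | _ => 1 end.
Definition py i : int := match val i with 0 => 0 | 1 => 1 | 2 => 1 | _ => -1 end.
Definition det2 i j : int := px i * py j - py i * px j.

Lemma phiE j q : phi j q = (px j)%:~R * q.1 + (py j)%:~R * q.2.
Proof. by rewrite /phi /px /py; case: j => [[|[|[|[|//]]]] hj] /=; ring. Qed.

Lemma cramer i j k q :
  (det2 i j)%:~R * phi k q = (det2 k j)%:~R * phi i q + (det2 i k)%:~R * phi j q.
Proof. by rewrite !phiE /det2; ring. Qed.

Lemma det2_le i j : (`|det2 i j| <= 2)%N.
Proof. by case: i j => [[|[|[|[|//]]]] hi] [[|[|[|[|//]]]] hj]. Qed.

Lemma det2_unit i j : i != j -> ((det2 i j)%:~R : K) \is a GRing.unit.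
Proof.
have uN (c : nat) : (c%:R : K) \is a GRing.unit -> ((- c%:Z)%:~R : K) \is a GRing.unit.
  by move=> uc; rewrite mulrNz unitrN.
by case: i j => [[|[|[|[|//]]]] hi] [[|[|[|[|//]]]] hj] // _; rewrite /det2 /px /py /=;
  first [exact: unitr1 | exact: u2 | exact: (uN 1%N (unitr1 _)) | exact: (uN 2%N u2)].
Qed.

Lemma hsol_int (c : int) (b : K) : c != 0 -> (#|[set t : K | (c%:~R * t)%R == b]| <= `|c|)%N.
Proof.
case: c => k k0 /=.
  rewrite (_ : [set _ | _] = [set t : K | t *+ k == b]); last first.
    by apply/setP=> t; rewrite !inE -pmulrn mulr_natl.
  by apply: hsol; rewrite lt0n.
rewrite (_ : [set _ | _] = [set t : K | t *+ k.+1 == - b]); last first.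
  by apply/setP=> t; rewrite !inE NegzE mulrNz -pmulrn mulNr mulr_natl eqr_oppLR.
exact: hsol.
Qed.

(** Along the line [phi k q = z], Cramer's rule turns the relation into D * phi i q = b * det * z.
    If D = 0 this contradicts z != 0, the other factors being units; otherwise there are at most |D|
    solutions. *)
Lemma cross_int (a b : int) i j k z : z != 0 -> k != i -> i != j -> (b%:~R : K) \is a GRing.unit ->
  (#|[set q | (phi k q == z) && (a%:~R * phi i q + b%:~R * phi j q == 0)%R]| <=
    2 * (`|a| + `|b|))%N.
Proof.
move=> z0 ki ij ub; pose D := det2 k j * b - det2 i k * a.
have eD q : phi k q = z -> a%:~R * phi i q + b%:~R * phi j q = 0 ->
    D%:~R * phi i q = b%:~R * ((det2 i j)%:~R * z).
  move=> <- h; rewrite [in RHS]cramer /D.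
  have -> : b%:~R * ((det2 k j)%:~R * phi i q + (det2 i k)%:~R * phi j q)
     = (b * det2 k j)%:~R * phi i q + (det2 i k)%:~R * (b%:~R * phi j q) by ring.
  have -> : b%:~R * phi j q = - (a%:~R * phi i q) by apply/eqP; rewrite -addr_eq0 addrC h.
  by ring.
have [D0|D0] := eqVneq D 0.
  rewrite (_ : [set q | _] = set0) ?cards0 //; apply/setP=> q; rewrite !inE.
  apply: contraNF z0 => /andP[/eqP h1 /eqP h2]; have := eD q h1 h2.
  rewrite D0 mul0r => /esym h; apply/eqP.
  by rewrite -[z](mulKr (det2_unit ij)) -[_ * z](mulKr ub) h !mulr0.
apply: (@leq_trans `|D|%N).
  apply: leq_trans (hsol_int (b%:~R * ((det2 i j)%:~R * z)) D0).
  rewrite -(card_in_imset (f := phi i)); last first.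
    move=> q q'; rewrite !inE => /andP[/eqP h1 _] /andP[/eqP h2 _].
    by apply: (line_inj u2 ki); rewrite h1 h2.
  apply: subset_leq_card; apply/subsetP=> _ /imsetP[q + ->].
  by rewrite !inE => /andP[/eqP h1 /eqP h2]; rewrite eD.
have := det2_le k j; have := det2_le i k; rewrite /D.
move: (det2 k j) (det2 i k) => c d; clear => h1 h2.
have t : (absz (c * b - d * a)%R <= absz c * absz b + absz d * absz a)%N.
  by rewrite -!abszM; move: (c * b) (d * a) => m n; clear; lia.
by apply: leq_trans t _; rewrite mulnDr addnC leq_add // leq_mul.
Qed.

Lemma cross_count (a b : nat) i j k z : z != 0 -> k != i -> i != j ->
  (b%:R : K) \is a GRing.unit -> (a <= 16)%N -> (b <= 16)%N ->
  (#|[set q | (phi k q == z) && ~~ apart (phi i q *+ a) (phi j q *+ b)]| <= 128)%N.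
Proof.
move=> z0 ki ij ub a16 b16.
rewrite (_ : [set q | _] = [set q | (phi k q == z) && ((a%:Z)%:~R * phi i q + (- b%:Z)%:~R * phi j q == 0)]
   :|: [set q | (phi k q == z) && ((a%:Z)%:~R * phi i q + (b%:Z)%:~R * phi j q == 0)]).
  apply: leq_trans (leq_card_setU _ _) _; apply: (@leq_trans (64 + 64)%N) => //; apply: leq_add.
    have ub' : ((- b%:Z)%:~R : K) \is a GRing.unit by rewrite mulrNz unitrN.
    by apply: leq_trans (@cross_int a%:Z (- b%:Z) i j k z z0 ki ij ub') _; rewrite abszN /=; clear - a16 b16; lia.
  by apply: leq_trans (@cross_int a%:Z b%:Z i j k z z0 ki ij ub) _; clear - a16 b16; rewrite /=; lia.
apply/setP=> q; rewrite !inE -andb_orr; congr (_ && _).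
by rewrite /apart negb_and !negbK mulrNz mulNr subr_eq0 addr_eq0 -!pmulrn !mulr_natl.
Qed.

End Cross.

Section ConfigurationSums.
Variable K : finComUnitRingType.
Local Notation queen := (K * K)%type.
Implicit Types (v : 'I_4 * K) (q : queen).

Lemma csumE (s : seq queen) v : csum s v = (count (fun q => phi v.1 q == v.2) s)%:Z.
Proof.
elim: s => [|q s IH]; first by rewrite csum0 vec0.
by rewrite csum_consE covE IH /=; case: (_ == _).
Qed.

Lemma csum_conf (s : seq queen) : csum s = onev K -> [set q in s] \in conf K.
Proof.
move=> h; rewrite inE; apply/forallP => v.
have : csum s v = 1 by rewrite h ffunE.
rewrite csumE /cov_count => -[e]; apply/eqP; apply/eqP; rewrite eqn_leq; apply/andP; split.
  apply: (@leq_trans (count (fun q => phi v.1 q == v.2) s)); last by rewrite e.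
  rewrite -size_filter; apply: leq_trans (card_size _); apply: subset_leq_card.
  by apply/subsetP => q; rewrite !inE mem_filter andbC.
rewrite card_gt0; apply/set0Pn.
have : has (fun q => phi v.1 q == v.2) s by rewrite has_count e.
by case/hasP => q qs hq; exists q; rewrite !inE qs.
Qed.

End ConfigurationSums.

Section Extend.
Variable K : finComUnitRingType.
Hypothesis u2 : (2 : K) \is a GRing.unit.
Hypothesis u3 : (3 : K) \is a GRing.unit.
Hypothesis hsol : forall (c : nat) (b : K), (0 < c)%N -> (#|[set t : K | t *+ c == b]| <= c)%N.
Hypothesis bigK : (100 < #|K|)%N.
Variable l : nat.
Hypothesis hcyc : forall x : K, exists2 k : nat, (k < 2 ^ l)%N & x = k%:R.
Variable p : nat.
Hypothesis p3 : (3 <= p)%N.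
Variable u : {ffun (bool * K) -> 'I_p.+1}.
Variable Y : nat.
Hypothesis hY : forall a r, rooted a r ->
  (Y <= #|[set t | spread a r t && all (approved (in_tri u) (in_two u)) (gad_neg a r t)]|)%N.

Lemma packing_cov (k : nat) M v : M \in packings k (uncovered u) ->
  (cov_count M v <= (v \in uncovered u))%N.
Proof.
rewrite inE => /andP[_ /forall_inP hM].
have sub q : q \in M -> phi v.1 q == v.2 -> v \in uncovered u.
  by move=> /hM /andP[/subsetP h _] hq; apply: h; rewrite inE.
case: (boolP (v \in uncovered u)) => hv; last first.
  rewrite leqn0 cards_eq0; apply/eqP/setP => q; rewrite !inE; apply/negbTE/negP => /andP[qM hq].
  by rewrite (sub q qM hq) in hv.
apply/card_le1_eqP => q q'; rewrite !inE => /andP[qM hq] /andP[qM' hq'].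
apply/eqP; apply: contraT => qq; have /andP[_ /forall_inP h] := hM q qM.
have := h q' qM'; rewrite eq_sym qq /= => /pred0P /(_ v); rewrite /= !inE hq hq' //.
Qed.

Lemma packing_extends (n0 m k : nat) : (size (random_template u) + n0 = #|K|)%N -> (k + m = n0)%N ->
  (2 * m + 3 < #|K|)%N -> (gad_coord_bound * (8 * (32 * (m.+1 * (400 * l + 400)))) < Y)%N ->
  forall M, M \in packings k (uncovered u) -> exists2 S, S \in conf K & M \subset S.
Proof.
move=> hn0 hk hm hYm M hM.
have sM : #|M| = k by move: hM; rewrite inE => /andP[/eqP].
have [||s hs] := @completion K u2 u3 hsol bigK l hcyc (in_tri u) (in_two u) (@in_tri_neq0 K p u) (@in_two_neq0 K p u)
  (@in_triN K u2 p u) (@in_twoN K u2 p u) Y hY (enum M) m _ _ hm hYm.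
- move=> v; rewrite csum_catE csumE.
  have := packing_cov v hM; have := csum_random_template_le1 u2 u3 p3 u v; have := csum_ge0 (random_template u) v.
  have -> : count (fun q => phi v.1 q == v.2) (enum M) = cov_count M v.
    rewrite /cov_count -sum1_count big_enum_cond -[RHS]sum1_card.
    by apply: eq_bigl => q; rewrite [RHS]inE.
  rewrite inE -[template _ _]/(random_template u); move: (csum _ _) (cov_count _ _) => a b; clear.
  by case: eqP => [->|]; lia.
- by rewrite size_cat -cardE sM -[template _ _]/(random_template u) -hn0 -hk; clear; lia.
exists [set q in enum M ++ s]; first exact: csum_conf.
by apply/subsetP => q qM; rewrite inE mem_cat mem_enum qM.
Qed.

End Extend.

From mathcomp Require Import all_classical all_reals all_analysis.
Import Order.TTheory GRing.Theory Num.Theory.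
Import numFieldNormedType.Exports.
Local Open Scope ring_scope.

(** * Concentration of the greedy process *)

Section Drift.
Variable R : realType.
Implicit Types (N typ_deg g rho Z del Del E d H x lam C : R).

Lemma expR_le_quad x : x <= 2^-1 -> expR x <= 1 + x + 2 * x ^+ 2.
Proof.
move=> hx; have h1 : 0 < 1 - x by lra.
have h : expR x * (1 - x) <= 1.
  have := expR_ge1Dx (- x) => h2.
  have : expR x * (1 - x) <= expR x * expR (- x) by rewrite ler_pM2l ?expR_gt0.
  by rewrite -expRD subrr expR0.
rewrite -(ler_pM2r h1); apply: le_trans h _.
have -> : (1 + x + 2 * x ^+ 2) * (1 - x) = 1 + x ^+ 2 * (1 - 2 * x) by ring.
rewrite lerDl mulr_ge0 ?sqr_ge0 //; lra.
Qed.

Lemma exp_sum_le (I : finType) (B : {set I}) (c : I -> R) lam C :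
  0 <= lam -> lam * C <= 2^-1 -> (forall q, q \in B -> `|c q| <= C) ->
  \sum_(q in B) expR (lam * c q) <=
    #|B|%:R + lam * (\sum_(q in B) c q) + #|B|%:R * (2 * lam ^+ 2 * C ^+ 2).
Proof.
move=> l0 lC hc.
apply: (@le_trans _ _ (\sum_(q in B) (1 + lam * c q + 2 * lam ^+ 2 * C ^+ 2))).
  apply: ler_sum => q qB; have hq := hc q qB.
  apply: le_trans (expR_le_quad _) _.
    apply: le_trans lC; apply: ler_wpM2l => //.
    by apply: le_trans hq; exact: ler_norm.
  rewrite lerD2l exprMn mulrA ler_wpM2l ?mulr_ge0 ?sqr_ge0 //.
  rewrite -[c q ^+ 2]real_normK ?num_real //.
  by rewrite lerXn2r ?nnegrE ?normr_ge0 // (le_trans _ hq).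
rewrite !big_split /= -mulr_sumr !sumr_const.
by rewrite !mulr_natl.
Qed.

(** The gain E(1+Z)rho from the decrease of the typical degree and the loss Hg from destroyed queens
    are both about 3d. They cancel up to 7 del relative to the degree, which is less than 9 of the
    10 parts by which the tolerance grows; the tenth part pays for the second-order term E del/N. *)
Lemma drift_up N typ_deg g rho Z del Del E d H :
  100 <= N -> 0 < typ_deg -> 0 < g -> typ_deg * g = 1 + rho -> 3 <= N * rho -> N * rho <= 3 + 20 / N ->
  0 < del -> del <= 100^-1 -> `|Z| <= del -> d = typ_deg * (1 + Z) ->
  N * (1 - del) * typ_deg <= E -> E <= N * (1 + del) * typ_deg ->
  3 * d * ((1 - del) * typ_deg - 1) <= H -> 25 / N + 4 * g <= del -> 10 * del / N <= Del ->
  E * ((1 + Z) * rho - Del) - H * g + E * (del / N) <= 0.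
Proof.
move=> hN hth hg hthg hr1 hr2 hd0 hd1 hZ -> hE1 hE2 hH hs hD.
have N0 : 0 < N by lra.
move: hZ; rewrite ler_norml => /andP[hZ1 hZ2].
set w := 1 + Z; have w1 : 99 / 100 <= w by rewrite /w; lra.
have w2 : w <= 101 / 100 by rewrite /w; lra.
have r0 : 0 <= rho by rewrite -(pmulr_rge0 _ N0); lra.
have iN : 0 < N^-1 by rewrite invr_gt0.
have a1 : E * (w * rho) <= w * typ_deg * ((1 + del) * (3 + 20 / N)).
  apply: (@le_trans _ _ (N * (1 + del) * typ_deg * (w * rho))).
    by apply: ler_wpM2r => //; apply: mulr_ge0 => //; lra.
  have -> : N * (1 + del) * typ_deg * (w * rho) = w * typ_deg * ((1 + del) * (N * rho)) by ring.
  apply: ler_wpM2l; first by apply: mulr_ge0; lra.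
  by apply: ler_wpM2l => //; lra.
have a2 : 3 * (w * typ_deg) * (1 - del - g) <= H * g.
  apply: le_trans (ler_wpM2r (ltW hg) hH).
  have -> : 3 * (typ_deg * w) * ((1 - del) * typ_deg - 1) * g = 3 * (w * typ_deg) * ((1 - del) * (typ_deg * g) - g) by ring.
  apply: ler_wpM2l; first by apply: mulr_ge0; [|apply: mulr_ge0]; lra.
  rewrite hthg lerD2r mulrDr mulr1 lerDl; apply: mulr_ge0 => //; lra.
have E0 : 0 <= E by apply: le_trans hE1; apply: mulr_ge0; [apply: mulr_ge0|]; lra.
have a3 : E * Del >= E * (10 * del / N) by apply: ler_wpM2l.
have a4 : 9 * (1 - del) * typ_deg * del <= E * (9 * del / N).
  have := ler_wpM2r (mulr_ge0 (ltW iN) (ltW hd0)) hE1.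
  have -> : N * (1 - del) * typ_deg * (N^-1 * del) = (N / N) * ((1 - del) * typ_deg * del) by ring.
  rewrite divff ?gt_eqF // mul1r => h.
  have -> : E * (9 * del / N) = 9 * (E * (N^-1 * del)) by ring.
  have -> : 9 * (1 - del) * typ_deg * del = 9 * ((1 - del) * typ_deg * del) by ring.
  by apply: ler_wpM2l.
have b1 : (1 + del) * (20 / N) <= 25 / N.
  rewrite mulrA; apply: ler_wpM2r; [exact: ltW | lra].
have b2 : w * typ_deg * ((1 + del) * (3 + 20 / N)) - 3 * (w * typ_deg) * (1 - del - g) <= w * typ_deg * (7 * del).
  have -> : w * typ_deg * ((1 + del) * (3 + 20 / N)) - 3 * (w * typ_deg) * (1 - del - g)
    = w * typ_deg * ((1 + del) * (20 / N) + 6 * del + 3 * g) by ring.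
  by apply: ler_wpM2l; [apply: mulr_ge0; lra | lra].
have b3 : w * typ_deg * (7 * del) <= 9 * (1 - del) * typ_deg * del.
  have -> : w * typ_deg * (7 * del) = typ_deg * del * (7 * w) by ring.
  have -> : 9 * (1 - del) * typ_deg * del = typ_deg * del * (9 * (1 - del)) by ring.
  by apply: ler_wpM2l; [apply: mulr_ge0; lra | lra].
have -> : E * (w * rho - Del) = E * (w * rho) - E * Del by ring.
have e1 : E * (10 * del / N) = E * (9 * del / N) + E * (del / N) by ring.
lra.
Qed.

Lemma drift_down N typ_deg g rho Z del Del E d H :
  100 <= N -> 0 < typ_deg -> 0 < g -> typ_deg * g = 1 + rho -> 3 <= N * rho -> N * rho <= 3 + 20 / N ->
  0 < del -> del <= 100^-1 -> `|Z| <= del -> d = typ_deg * (1 + Z) ->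
  N * (1 - del) * typ_deg <= E -> E <= N * (1 + del) * typ_deg ->
  H <= 3 * d * ((1 + del) * typ_deg) -> 25 / N + 4 * g <= del -> 10 * del / N <= Del ->
  E * (- ((1 + Z) * rho) - Del) + H * g + E * (del / N) <= 0.
Proof.
move=> hN hth hg hthg hr1 hr2 hd0 hd1 hZ -> hE1 hE2 hH hs hD.
have N0 : 0 < N by lra.
move: hZ; rewrite ler_norml => /andP[hZ1 hZ2].
set w := 1 + Z; have w1 : 99 / 100 <= w by rewrite /w; lra.
have w2 : w <= 101 / 100 by rewrite /w; lra.
have r0 : 0 <= rho by rewrite -(pmulr_rge0 _ N0); lra.
have iN : 0 < N^-1 by rewrite invr_gt0.
have a1 : w * typ_deg * ((1 - del) * 3) <= E * (w * rho).
  apply: (@le_trans _ _ (N * (1 - del) * typ_deg * (w * rho))); last first.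
    by apply: ler_wpM2r => //; apply: mulr_ge0 => //; lra.
  have -> : N * (1 - del) * typ_deg * (w * rho) = w * typ_deg * ((1 - del) * (N * rho)) by ring.
  apply: ler_wpM2l; first by apply: mulr_ge0; lra.
  by apply: ler_wpM2l => //; lra.
have a2 : H * g <= 3 * (w * typ_deg) * ((1 + del) * (1 + rho)).
  apply: le_trans (ler_wpM2r (ltW hg) hH) _.
  have -> : 3 * (typ_deg * w) * ((1 + del) * typ_deg) * g = 3 * (w * typ_deg) * ((1 + del) * (typ_deg * g)) by ring.
  by rewrite hthg.
have E0 : 0 <= E by apply: le_trans hE1; apply: mulr_ge0; [apply: mulr_ge0|]; lra.
have a3 : E * Del >= E * (10 * del / N) by apply: ler_wpM2l.
have a4 : 9 * (1 - del) * typ_deg * del <= E * (9 * del / N).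
  have := ler_wpM2r (mulr_ge0 (ltW iN) (ltW hd0)) hE1.
  have -> : N * (1 - del) * typ_deg * (N^-1 * del) = (N / N) * ((1 - del) * typ_deg * del) by ring.
  rewrite divff ?gt_eqF // mul1r => h.
  have -> : E * (9 * del / N) = 9 * (E * (N^-1 * del)) by ring.
  have -> : 9 * (1 - del) * typ_deg * del = 9 * ((1 - del) * typ_deg * del) by ring.
  by apply: ler_wpM2l.
have b0 : rho <= 4 / N.
  rewrite ler_pdivlMr // mulrC; apply: le_trans hr2 _.
  have : 20 / N <= 1 by rewrite ler_pdivrMr //; lra.
  lra.
have b1 : 3 * (1 + del) * rho <= del.
  apply: (@le_trans _ _ (3 * (1 + del) * (4 / N))); first by apply: ler_wpM2l => //; lra.
  have : 3 * (1 + del) * (4 / N) <= 25 / N by rewrite mulrA; apply: ler_wpM2r; [exact: ltW | lra].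
  lra.
have b2 : 3 * (w * typ_deg) * ((1 + del) * (1 + rho)) - w * typ_deg * ((1 - del) * 3) <= w * typ_deg * (7 * del).
  have -> : 3 * (w * typ_deg) * ((1 + del) * (1 + rho)) - w * typ_deg * ((1 - del) * 3)
    = w * typ_deg * (6 * del + 3 * (1 + del) * rho) by ring.
  by apply: ler_wpM2l; [apply: mulr_ge0; lra | lra].
have b3 : w * typ_deg * (7 * del) <= 9 * (1 - del) * typ_deg * del.
  have -> : w * typ_deg * (7 * del) = typ_deg * del * (7 * w) by ring.
  have -> : 9 * (1 - del) * typ_deg * del = typ_deg * del * (9 * (1 - del)) by ring.
  by apply: ler_wpM2l; [apply: mulr_ge0; lra | lra].
have -> : E * (- (w * rho) - Del) = - (E * (w * rho)) - E * Del by ring.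
have e1 : E * (10 * del / N) = E * (9 * del / N) + E * (del / N) by ring.
lra.
Qed.

End Drift.

Section Scale.
Variables (R : realType) (D del0 lam n0 m : R).
Implicit Types (N : R).
Hypothesis m100 : 100 <= m.
Hypothesis mn : m <= n0.
Hypothesis D0 : 0 < D.
Hypothesis Dn : D <= n0.
Hypothesis del0_gt0 : 0 < del0.
Hypothesis lam0 : 0 < lam.

(* The expected degree of a line when [N] lines of each type are free, and the
   relative error allowed at that time. *)
Definition typ_deg N : R := D * (N / n0) ^+ 3.
Definition del N : R := del0 * (n0 / N) ^+ 10.

Let n0_gt0 : 0 < n0. Proof. by apply: (lt_le_trans _ mn); have := m100; lra. Qed.

Lemma typ_deg_gt0 N : 0 < N -> 0 < typ_deg N.
Proof. by move=> h; rewrite /typ_deg mulr_gt0 // exprn_gt0 // divr_gt0. Qed.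

Lemma typ_deg_le N N' : 0 <= N -> N <= N' -> typ_deg N <= typ_deg N'.
Proof.
move=> h h'; have h2 : 0 <= N' by exact: le_trans h h'.
have i0 : 0 <= n0^-1 by rewrite invr_ge0 ltW.
by rewrite /typ_deg ler_pM2l // lerXn2r ?nnegrE ?mulr_ge0 //; exact: ler_wpM2r.
Qed.

Lemma typ_deg_leN N : 0 <= N -> N <= n0 -> typ_deg N <= N.
Proof.
move=> h h'; have a : N / n0 <= 1 by rewrite ler_pdivrMr // mul1r.
have a0 : 0 <= N / n0 by rewrite divr_ge0 // ltW.
apply: (@le_trans _ _ (n0 * (N / n0))); last by rewrite mulrCA divff ?gt_eqF // mulr1.
rewrite /typ_deg; apply: ler_pM => //; [exact: ltW | exact: exprn_ge0 |].
by rewrite exprS -[leRHS]mulr1; apply: ler_wpM2l => //; apply: exprn_ile1.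
Qed.

Lemma del_gt0 N : 0 < N -> 0 < del N.
Proof. by move=> h; rewrite /del mulr_gt0 // exprn_gt0 // divr_gt0. Qed.

Lemma del_ge N N' : 0 < N -> N <= N' -> del N' <= del N.
Proof.
move=> h h'; have h2 : 0 < N' by exact: lt_le_trans h h'.
have g (x : R) : 0 < x -> 0 <= n0 / x by move=> hx; rewrite divr_ge0 // ltW.
by rewrite /del ler_pM2l // lerXn2r ?nnegrE ?g // ler_pM2l // lef_pV2 ?posrE.
Qed.

Lemma del_n0 : del n0 = del0.
Proof. by rewrite /del divff ?gt_eqF // expr1n mulr1. Qed.

Lemma ratio_bounds N (rho := (N / (N - 1)) ^+ 3 - 1) : 100 <= N ->
  [/\ typ_deg N * (typ_deg (N - 1))^-1 = 1 + rho, 3 <= N * rho & N * rho <= 3 + 20 / N].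
Proof.
move=> hN; have N1 : 0 < N - 1 by lra.
have N0 : 0 < N by lra.
have e : N / (N - 1) = 1 + 1 / (N - 1).
  by field; rewrite gt_eqF.
set u := 1 / (N - 1) in e.
have uN : u * N = 1 + u.
  by rewrite /u; field; rewrite gt_eqF.
have u0 : 0 < u by rewrite divr_gt0.
have u1 : u <= 101 / 99 / N.
  by rewrite ler_pdivlMr // uN; have : u <= 99^-1; [rewrite /u mul1r lef_pV2 ?posrE; lra | lra].
have rhoE : rho = 3 * u + 3 * u ^+ 2 + u ^+ 3 by rewrite /rho e; ring.
have NrE : N * rho = (1 + u) * (3 + 3 * u + u ^+ 2).
  by rewrite rhoE -uN; ring.
split.
- by rewrite /rho (addrC 1) subrK /typ_deg; field; rewrite !gt_eqF.
- rewrite NrE; have := sqr_ge0 u => h; have : 0 <= u * (3 + 3 * u + u ^+ 2) by apply: mulr_ge0; lra.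
  lra.
have u2 : u <= 2 / 100.
  apply: le_trans u1 _; rewrite ler_pdivrMr //; lra.
have -> : N * rho = 3 + u * (6 + 4 * u + u ^+ 2) by rewrite NrE; ring.
rewrite lerD2l; apply: (@le_trans _ _ (101 / 99 / N * 7)).
  apply: ler_pM => //; [exact: ltW | have := sqr_ge0 u; lra |].
  have : u ^+ 2 <= u * (2 / 100) by rewrite expr2; apply: ler_wpM2l => //; exact: ltW.
  lra.
rewrite mulrAC; apply: ler_wpM2r; [by rewrite invr_ge0 ltW | lra].
Qed.

(** Bernoulli's inequality. The exponent 10 in [del] is chosen to make the tolerance grow faster
    than the drift errors accumulate. *)
Lemma del_step N : 100 <= N -> 10 * del N / N <= del (N - 1) - del N.
Proof.
move=> hN; have N1 : 0 < N - 1 by lra.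
have N0 : 0 < N by lra.
have e : del (N - 1) = del N * (N / (N - 1)) ^+ 10.
  rewrite /del -mulrA -exprMn; congr (_ * _ ^+ 10); field; by rewrite !gt_eqF.
have e1 : N / (N - 1) = 1 + 1 / (N - 1).
  by field; rewrite gt_eqF.
have b : 1 + 10 / (N - 1) <= (N / (N - 1)) ^+ 10.
  rewrite e1; set u := 1 / (N - 1); have u0 : 0 < u by rewrite divr_gt0.
  have -> : 10 / (N - 1) = u *+ 10 by rewrite -[u *+ 10]mulr_natl /u mul1r.
  elim: 10%N => [|k IH]; first by rewrite mulr0n addr0 expr0.
  rewrite exprS mulrSr addrA; apply: le_trans (ler_wpM2l _ IH); last by lra.
  have : 0 <= u * (u *+ k) by rewrite mulr_ge0 // ?mulrn_wge0 // ltW.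
  have -> : (1 + u) * (1 + u *+ k) = 1 + u *+ k + u + u * (u *+ k) by ring.
  lra.
have dN := del_gt0 N0.
apply: (@le_trans _ _ (del N * (10 / (N - 1)))).
  rewrite mulrAC mulrC; apply: ler_wpM2l; first exact: ltW.
  by rewrite ler_pM2l // lef_pV2 ?posrE //; lra.
by rewrite e; have := ler_wpM2l (ltW dN) b; rewrite mulrDr mulr1; lra.
Qed.

Lemma del_step_le N : 100 <= N -> del (N - 1) - del N <= 20 * del N / N.
Proof.
move=> hN; have N1 : 0 < N - 1 by lra.
have N0 : 0 < N by lra.
have e : del N = del (N - 1) * ((N - 1) / N) ^+ 10.
  rewrite /del -mulrA -exprMn; congr (_ * _ ^+ 10); field; by rewrite !gt_eqF.
set u := N^-1; have u0 : 0 < u by rewrite invr_gt0.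
have u1 : u <= 100^-1 by rewrite /u lef_pV2 ?posrE.
have b : 1 - 10 * u <= ((N - 1) / N) ^+ 10.
  have -> : (N - 1) / N = 1 - u by rewrite /u; field; rewrite gt_eqF.
  have -> : 10 * u = u *+ 10 by rewrite -[u *+ 10]mulr_natl.
  elim: 10%N => [|k IH]; first by rewrite mulr0n subr0 expr0.
  rewrite exprS mulrSr; apply: le_trans (ler_wpM2l _ IH); last by lra.
  have : 0 <= u * (u *+ k) by rewrite mulr_ge0 // ?mulrn_wge0 // ltW.
  have -> : (1 - u) * (1 - u *+ k) = 1 - u *+ k - u + u * (u *+ k) by ring.
  lra.
have d1 := del_gt0 N1; have d0 := del_gt0 N0.
have h1 : del (N - 1) * (1 - 10 * u) <= del N by rewrite [leRHS]e; apply: ler_wpM2l => //; exact: ltW.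
have h2 : 1 <= (1 + 20 * u) * (1 - 10 * u).
  have -> : (1 + 20 * u) * (1 - 10 * u) = 1 + u * (10 - 200 * u) by ring.
  rewrite lerDl; apply: mulr_ge0; [exact: ltW | lra].
have h3 : del (N - 1) <= del N * (1 + 20 * u).
  have p : 0 < 1 - 10 * u by lra.
  rewrite -(ler_pM2r p); apply: le_trans h1 _.
  by have := ler_wpM2l (ltW d0) h2; rewrite mulr1 mulrA.
have -> : 20 * del N / N = del N * (20 * u) by rewrite /u; ring.
rewrite mulrDr mulr1 in h3; lra.
Qed.

(** The tolerance grows like N^-10 while the squared degree shrinks only like N^6, so the condition
    on [lam] is tightest at the start, N = n0. *)
Lemma del_th N : 0 < N -> N <= n0 -> del0 * D ^+ 2 / n0 <= del N * typ_deg N ^+ 2 / N.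
Proof.
move=> N0 Nn; rewrite /del /typ_deg.
have -> : del0 * (n0 / N) ^+ 10 * (D * (N / n0) ^+ 3) ^+ 2 / N
   = del0 * D ^+ 2 * ((n0 / N) ^+ 4 / N) by field; rewrite !gt_eqF.
apply: ler_wpM2l.
  by apply: mulr_ge0; [exact: ltW | exact: sqr_ge0].
rewrite -[leLHS]mul1r; apply: ler_pM => //.
- by rewrite invr_ge0 ltW.
- by apply: exprn_ege1; rewrite ler_pdivlMr // mul1r.
- by rewrite lef_pV2 ?posrE.
Qed.

End Scale.

Section Potential.
Variable K : finComUnitRingType.
Hypothesis u2 : (2 : K) \is a GRing.unit.
Local Notation line := ('I_4 * K)%type.
Local Notation queen := (K * K)%type.
Implicit Types (U : {set line}) (v : line) (q f : queen) (i j : 'I_4).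
Variables (R : realType) (D del0 lam n0 m : R).
Hypothesis m100 : 100 <= m.
Hypothesis mn : m <= n0.
Hypothesis D0 : 0 < D.
Hypothesis Dn : D <= n0.
Hypothesis del0_gt0 : 0 < del0.
Hypothesis lam0 : 0 < lam.
Local Notation typ_deg := (typ_deg D n0).
Local Notation del := (del del0 n0).
Hypothesis hdel : del m <= 100^-1.
Hypothesis hsmall : 25 / m + 4 / typ_deg m <= del0.
Hypothesis hlam1 : 16 * lam <= typ_deg m.
Hypothesis hlam2 : 128 * lam <= del0 * D ^+ 2 / n0.

Definition dev U (N : nat) v : R := (avail_degree U v)%:R / typ_deg N%:R - 1.

Definition regular U (N : nat) := forall v, v \in U -> `|dev U N v| <= del N%:R.

(* [Phi] is a supermartingale as long as it stays below 1, and then all degrees are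
   within their tolerance. *)
Definition Phi U (N : nat) : R :=
  \sum_(v in U) (expR (lam * (dev U N v - del N%:R)) + expR (lam * (- dev U N v - del N%:R))).

Lemma Phi_regular U N : Phi U N < 1 -> regular U N.
Proof.
move=> h v vU; rewrite leNgt; apply/negP=> hv.
have : 1 <= Phi U N; last by lra.
rewrite /Phi (bigD1 v) //=.
have a : 1 <= expR (lam * (dev U N v - del N%:R)) + expR (lam * (- dev U N v - del N%:R)).
  have p x : 0 <= x -> 1 <= expR (lam * x).
    by move=> hx; rewrite -expR0 ler_expR mulr_ge0 // ltW.
  have e0 x := expR_gt0 (lam * x).
  case: (lerP 0 (dev U N v)) => hs; move: hv; rewrite ?(ger0_norm hs) ?(ltr0_norm hs) => hv.
    have /p h1 : 0 <= dev U N v - del N%:R by rewrite subr_ge0 ltW.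
    by have := e0 (- dev U N v - del N%:R); lra.
  have /p h1 : 0 <= - dev U N v - del N%:R by rewrite subr_ge0 ltW.
  by have := e0 (dev U N v - del N%:R); lra.
apply: le_trans a _; rewrite lerDl; apply: sumr_ge0 => w _.
by rewrite addr_ge0 // ltW // expR_gt0.
Qed.

Section Step.
Variables (U : {set line}) (N : nat).
Hypothesis bU : balanced U N.+1.
Hypothesis mN : m <= N%:R.
Variable x : R.
Hypothesis xE : x = N.+1%:R.
Hypothesis Nn : x <= n0.
Hypothesis rU : regular U N.+1.

Let x1 : x - 1 = N%:R. Proof. by rewrite xE mulrSr addrK. Qed.
Let x100 : 100 <= x. Proof. by rewrite -(subrK 1 x) x1; have := m100; have := mN; lra. Qed.
Let x0 : 0 < x. Proof. by have := x100; lra. Qed.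
Let N0 : 0 < N%:R :> R. Proof. by have := m100; have := mN; lra. Qed.
Let mx : m <= x. Proof. by rewrite -(subrK 1 x) x1; have := mN; lra. Qed.
Let m0 : 0 < m. Proof. by have := m100; lra. Qed.
Let thx0 : 0 < typ_deg x. Proof. exact: (typ_deg_gt0 m100 mn D0 x0). Qed.
Let thN0 : 0 < typ_deg N%:R. Proof. exact: (typ_deg_gt0 m100 mn D0 N0). Qed.
Let thm0 : 0 < typ_deg m. Proof. exact: (typ_deg_gt0 m100 mn D0 m0). Qed.
Let dx0 : 0 < del x. Proof. exact: (del_gt0 m100 mn del0_gt0 x0). Qed.
Let dx1 : del x <= 100^-1.
Proof. by apply: le_trans hdel; exact: (del_ge m100 mn del0_gt0 m0 mx). Qed.
Let g := (typ_deg N%:R)^-1.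
Let rho := (x / (x - 1)) ^+ 3 - 1.
Let E := #|avail U|%:R : R.

Lemma avail_degree_bounds v : v \in U -> (1 - del x) * typ_deg x <= (avail_degree U v)%:R <= (1 + del x) * typ_deg x.
Proof.
move=> /rU; rewrite ler_norml /dev -xE => /andP[h1 h2].
by apply/andP; split; rewrite -?(ler_pdivlMr _ _ thx0) -?(ler_pdivrMr _ _ thx0); lra.
Qed.

Lemma avail_bounds : x * (1 - del x) * typ_deg x <= E <= x * (1 + del x) * typ_deg x.
Proof.
pose j : 'I_4 := ord0.
have e : E = \sum_(y in slice U j) (avail_degree U (j, y))%:R by rewrite /E (card_avail U j) natr_sum.
have h (c : R) : x * c * typ_deg x = \sum_(y in slice U j) (c * typ_deg x).
  by rewrite sumr_const (bU j) -[RHS]mulr_natl -xE mulrA.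
rewrite e !h; apply/andP; split; apply: ler_sum => y; rewrite inE => yU.
  by have /andP[] := avail_degree_bounds yU.
by have /andP[] := avail_degree_bounds yU.
Qed.

Section Vertex.
Variable v : line.
Hypothesis vU : v \in U.
Let B := [set q in avail U | v \notin lines q].
Let d := (avail_degree U v)%:R : R.
Let Z := dev U N.+1 v.
Let H := \sum_(q in B) (hit U v q)%:R : R.

Lemma card_B : #|B|%:R = E - d.
Proof.
have -> : E = (avail_degree U v + #|B|)%N%:R.
  rewrite /E /avail_degree -(cardsID [set q | v \in lines q] (avail U)); congr (_ + _)%N%:R.
    by apply: eq_card => q; rewrite !inE.
  by apply: eq_card => q; rewrite !inE andbC.
by rewrite natrD addrC addKr.
Qed.

Lemma hit_bounds : 3 * d * ((1 - del x) * typ_deg x - 1) <= H <= 3 * d * ((1 + del x) * typ_deg x).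
Proof.
have e : H = \sum_(f in through U v) \sum_(i | i != v.1) (avail_degree U (i, phi i f)).-1%:R.
  rewrite /H -natr_sum (eq_bigl (fun q => (q \in avail U) && (v \notin lines q))).
    by rewrite (hit_sum u2 vU) natr_sum; apply: eq_bigr => f _; rewrite natr_sum.
  by move=> q; rewrite inE.
have c3 (c : R) : 3 * d * c = \sum_(f in through U v) \sum_(i | i != v.1) c.
  under eq_bigr do rewrite sumr_const.
  rewrite sumr_const (_ : #|_| = 3); last by rewrite (cardC1 v.1) card_ord.
  by rewrite -[#|through U v|]/(avail_degree U v) -[RHS]mulr_natl -[c *+ 3]mulr_natl -/d; ring.
rewrite e !c3; apply/andP; split; apply: ler_sum => f hf; apply: ler_sum => i hi.
  have fU : (i, phi i f) \in U by move: hf; rewrite inE => /andP[/availP].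
  have d0 : (0 < avail_degree U (i, phi i f))%N.
    by rewrite card_gt0; apply/set0Pn; exists f; rewrite inE mem_line andbT; move: hf; rewrite inE => /andP[].
  have /andP[h _] := avail_degree_bounds fU.
  by rewrite -subn1 natrB // lerD2r.
have fU : (i, phi i f) \in U by move: hf; rewrite inE => /andP[/availP].
have /andP[_ h] := avail_degree_bounds fU.
by apply: le_trans h; rewrite ler_nat leq_pred.
Qed.

Let Del := del N%:R - del x.

Lemma dev_step q : q \in B -> dev (U :\: lines q) N v = Z + (1 + Z) * rho - (hit U v q)%:R * g.
Proof.
rewrite inE => /andP[qU vq].
have [hth _ _] := ratio_bounds m100 mn D0 x100.
rewrite -/rho x1 -/g in hth.
have e : (avail_degree (U :\: lines q) v)%:R = d - (hit U v q)%:R :> R.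
  by rewrite /d (avail_degree_step vU qU vq) natrD addrK.
have dE : d = typ_deg x * (1 + Z).
  by rewrite /Z /dev -xE -/d addrC subrK mulrC divfK // gt_eqF.
rewrite /dev e mulrBl -/g dE mulrAC hth; ring.
Qed.

Lemma rhoC : rho <= 33 / 10 / x.
Proof.
have [_ _ h] := ratio_bounds m100 mn D0 x100; rewrite -/rho in h.
rewrite ler_pdivlMr // mulrC; apply: le_trans h _.
have : 20 / x <= 20 / 100 by rewrite ler_pM2l // lef_pV2 ?posrE //; lra.
lra.
Qed.

(** A bound for one increment of the deviation: the three contributions in [pieces] amount to at
    most 3.4 + 0.2 + 3.13. *)
Let C := 8 / typ_deg x.

Lemma invx_th : x^-1 <= (typ_deg x)^-1.
Proof. by rewrite lef_pV2 ?posrE //; apply: (typ_deg_leN m100 mn D0 Dn); rewrite // ltW. Qed.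

Lemma g_le : g <= 104 / 100 / typ_deg x.
Proof.
have [h _ _] := ratio_bounds m100 mn D0 x100; rewrite -/rho x1 -/g in h.
rewrite ler_pdivlMr // mulrC h.
have := rhoC; have : x^-1 <= 100^-1 by rewrite lef_pV2 ?posrE.
lra.
Qed.

Lemma Del_le : Del <= 1 / 5 / x.
Proof.
have := del_step_le m100 mn del0_gt0 x100; rewrite x1 -/Del => h; apply: le_trans h _.
apply: ler_wpM2r; first by rewrite invr_ge0 ltW.
by have := dx1; lra.
Qed.

Lemma Del_ge : 10 * del x / x <= Del.
Proof. by have := del_step m100 mn del0_gt0 x100; rewrite x1. Qed.

Lemma small_g : 25 / x + 4 * g <= del x.
Proof.
have h1 : del0 <= del x.
  by rewrite -[leLHS](del_n0 del0 m100 mn); apply: (del_ge m100 mn del0_gt0 x0 Nn).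
apply: le_trans h1; apply: le_trans hsmall.
apply: lerD; rewrite ler_pM2l // lef_pV2 ?posrE //.
by apply: (typ_deg_le m100 mn D0 (ltW m0)).
Qed.

Lemma pieces : [/\ 0 <= (1 + Z) * rho, (1 + Z) * rho <= 34 / 10 / typ_deg x, 0 <= Del,
  Del <= 1 / 5 / typ_deg x & forall q, q \in B -> 0 <= (hit U v q)%:R * g <= 313 / 100 / typ_deg x].
Proof.
have := rU vU; rewrite -/Z ler_norml -xE => /andP[z1 z2].
have [_ h3 _] := ratio_bounds m100 mn D0 x100; rewrite -/rho in h3.
have r0 : 0 <= rho by rewrite -(pmulr_rge0 _ x0); lra.
have hx := invx_th; have ix0 : 0 < x^-1 by rewrite invr_gt0.
have it0 : 0 < (typ_deg x)^-1 by rewrite invr_gt0.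
have d1 := dx1; have d0 := dx0.
have g0 : 0 < g by rewrite invr_gt0.
split.
- by apply: mulr_ge0 => //; lra.
- apply: (@le_trans _ _ ((101 / 100) * (33 / 10 / x))).
    by apply: ler_pM => //; [lra | lra | exact: rhoC].
  by rewrite mulrA; apply: ler_pM => //; lra.
- apply: le_trans Del_ge; apply: mulr_ge0; [lra | exact: ltW].
- by apply: le_trans Del_le _; apply: ler_wpM2l => //; lra.
- move=> q; rewrite inE => /andP[_ vq].
  have h := hit_le3 u2 U vq; have h' : (hit U v q)%:R <= 3 :> R by rewrite ler_nat.
  apply/andP; split; first by apply: mulr_ge0 => //; exact: ltW.
  apply: (@le_trans _ _ (3 * (104 / 100 / typ_deg x))).
    by apply: ler_pM => //; [exact: ltW | exact: g_le].
  by rewrite mulrA; apply: ler_wpM2r; [exact: ltW | lra].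
Qed.

Lemma lamC : lam * C <= 2^-1.
Proof.
have h := typ_deg_le m100 mn D0 (ltW m0) mx.
rewrite /C mulrA ler_pdivrMr //; have := hlam1; lra.
Qed.

Lemma lamC2 : 2 * lam * C ^+ 2 <= del x / x.
Proof.
have h := del_th D m100 mn del0_gt0 x0 Nn.
have -> : 2 * lam * C ^+ 2 = 128 * lam / typ_deg x ^+ 2.
  by rewrite /C exprMn exprVn; ring.
rewrite ler_pdivrMr ?exprn_gt0 //.
have -> : del x / x * typ_deg x ^+ 2 = del x * typ_deg x ^+ 2 / x by ring.
exact: le_trans hlam2 h.
Qed.

(** Queens through [v] remove [v] from the potential. The sum thus has E - d terms although it is
    compared with E, and the surplus is nonnegative. *)
Lemma tail_sum (c : queen -> R) (y z : R) : (forall q, q \in B -> `|c q| <= C) ->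
  \sum_(q in B) c q = (E - d) * y + z -> `|y| <= C -> E * y + z + E * (del x / x) <= 0 ->
  \sum_(q in B) expR (lam * c q) <= E.
Proof.
move=> hc hs hy hE; apply: le_trans (exp_sum_le (ltW lam0) lamC hc) _.
rewrite card_B hs.
have d0 : 0 <= d by [].
have E0 : 0 <= E by [].
have Ed : 0 <= E - d by rewrite -card_B.
have h1 : (E - d) * (2 * lam ^+ 2 * C ^+ 2) <= lam * (E * (del x / x)).
  have -> : (E - d) * (2 * lam ^+ 2 * C ^+ 2) = lam * ((E - d) * (2 * lam * C ^+ 2)) by ring.
  apply: ler_wpM2l; first exact: ltW.
  apply: ler_pM => //; [|by rewrite gerBl|exact: lamC2].
  by apply: mulr_ge0; [apply: mulr_ge0 => //; exact: ltW | exact: sqr_ge0].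
have h2 : lam * (E * y + z + E * (del x / x)) <= 0 by rewrite pmulr_rle0.
have h3 : - 2^-1 <= lam * y.
  have : `|lam * y| <= 2^-1.
    by rewrite normrM gtr0_norm //; apply: le_trans lamC; apply: ler_wpM2l => //; exact: ltW.
  by rewrite ler_norml => /andP[].
(* What the [d] queens through [v] would add to first order; dropping it can only help. *)
have h4 : 0 <= d * (1 + lam * y) by apply: mulr_ge0 => //; lra.
have -> : E - d + lam * ((E - d) * y + z) + (E - d) * (2 * lam ^+ 2 * C ^+ 2)
  = E - d * (1 + lam * y) + lam * (E * y + z) + (E - d) * (2 * lam ^+ 2 * C ^+ 2) by ring.
have e2 : lam * (E * y + z + E * (del x / x)) = lam * (E * y + z) + lam * (E * (del x / x)) by ring.
lra.
Qed.

Lemma tail_up : \sum_(q in B) expR (lam * (dev (U :\: lines q) N v - del N%:R))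
  <= E * expR (lam * (Z - del x)).
Proof.
have [p1 p2 p3 p4 p5] := pieces.
pose y := (1 + Z) * rho - Del.
have it0 : 0 < (typ_deg x)^-1 by rewrite invr_gt0.
rewrite (eq_bigr (fun q => expR (lam * (Z - del x)) * expR (lam * (y - (hit U v q)%:R * g)))); last first.
  move=> q qB; rewrite -expRD (dev_step qB) -mulrDr; congr (expR (lam * _)).
  by rewrite /y /Del; ring.
rewrite -mulr_sumr mulrC ler_pM2r ?expR_gt0 //.
have [hth r3 r4] := ratio_bounds m100 mn D0 x100; rewrite -/rho x1 -/g in hth r3 r4.
have /andP[E1 E2] := avail_bounds; have /andP[H1 H2] := hit_bounds.
have g0 : 0 < g by rewrite invr_gt0.
have rv := rU vU; rewrite -xE in rv.
have dE : d = typ_deg x * (1 + Z).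
  by rewrite /Z /dev -xE -/d addrC subrK mulrC divfK // gt_eqF.
apply: (@tail_sum _ y (- (H * g))).
- move=> q /p5 /andP[a1 a2]; rewrite ler_norml /y /C; apply/andP; split; lra.
- rewrite big_split /= sumr_const -mulr_natl card_B; congr (_ + _).
  by rewrite sumrN /H mulr_suml.
- rewrite ler_norml /y /C; apply/andP; split; lra.
- exact: (drift_up x100 thx0 g0 hth r3 r4 dx0 dx1 rv dE E1 E2 H1 small_g Del_ge).
Qed.

Lemma tail_down : \sum_(q in B) expR (lam * (- dev (U :\: lines q) N v - del N%:R))
  <= E * expR (lam * (- Z - del x)).
Proof.
have [p1 p2 p3 p4 p5] := pieces.
pose y := - ((1 + Z) * rho) - Del.
have it0 : 0 < (typ_deg x)^-1 by rewrite invr_gt0.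
rewrite (eq_bigr (fun q => expR (lam * (- Z - del x)) * expR (lam * (y + (hit U v q)%:R * g)))); last first.
  move=> q qB; rewrite -expRD (dev_step qB) -mulrDr; congr (expR (lam * _)).
  by rewrite /y /Del; ring.
rewrite -mulr_sumr mulrC ler_pM2r ?expR_gt0 //.
have [hth r3 r4] := ratio_bounds m100 mn D0 x100; rewrite -/rho x1 -/g in hth r3 r4.
have /andP[E1 E2] := avail_bounds; have /andP[H1 H2] := hit_bounds.
have g0 : 0 < g by rewrite invr_gt0.
have rv := rU vU; rewrite -xE in rv.
have dE : d = typ_deg x * (1 + Z).
  by rewrite /Z /dev -xE -/d addrC subrK mulrC divfK // gt_eqF.
apply: (@tail_sum _ y (H * g)).
- move=> q /p5 /andP[a1 a2]; rewrite ler_norml /y /C; apply/andP; split; lra.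
- rewrite big_split /= sumr_const -mulr_natl card_B; congr (_ + _).
  by rewrite /H mulr_suml.
- rewrite ler_norml /y /C; apply/andP; split; lra.
- exact: (drift_down x100 thx0 g0 hth r3 r4 dx0 dx1 rv dE E1 E2 H2 small_g Del_ge).
Qed.

End Vertex.

Lemma Phi_step : \sum_(q in avail U) Phi (U :\: lines q) N <= E * Phi U N.+1.
Proof.
rewrite /Phi (eq_bigr (fun q => \sum_(v in U | v \notin lines q)
   (expR (lam * (dev (U :\: lines q) N v - del N%:R)) +
    expR (lam * (- dev (U :\: lines q) N v - del N%:R))))); last first.
  by move=> q _; apply: eq_bigl => v; rewrite finset.in_setD andbC.
rewrite (exchange_big_dep (mem U)) /=; last by move=> q v _ /andP[].
rewrite mulr_sumr; apply: ler_sum => v vU.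
rewrite (eq_bigl [in [set q in avail U | v \notin lines q]]); last by move=> q; rewrite inE vU.
rewrite big_split mulrDr /= -xE; apply: lerD; [exact: tail_up | exact: tail_down].
Qed.

End Step.

(** The factor 1 - [Phi] plays the role of a lower bound for the probability that all degrees stay
    regular. By [Phi_step] its sum over all choices is at least its present value times the number
    of choices, so it survives the induction. *)
Lemma greedy_count_lower (k N : nat) U (eta : R) : balanced U N -> m <= (N - k)%N%:R -> (k <= N)%N ->
  N%:R <= n0 -> del m <= eta -> eta <= 1 ->
  (\prod_(N - k <= i < N) ((1 - eta) * i.+1%:R * typ_deg i.+1%:R)) * (1 - Phi U N) <= (greedy_count k U)%:R.
Proof.
move=> + + + + he1 he2.
have m0 : 0 < m by have := m100; lra.
elim: k N U => [|k IH] N U bU hm hk hN.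
  rewrite subn0 big_geq // mul1r /= lerBlDr lerDl; apply: sumr_ge0 => v _.
  by rewrite addr_ge0 // ltW // expR_gt0.
case: N bU hm hk hN => // N bU hm hk hN; rewrite subSS in hm *.
have pos (i : nat) : (N - k <= i)%N -> 0 <= (1 - eta) * i.+1%:R * typ_deg i.+1%:R.
  move=> hi; apply: mulr_ge0; first by apply: mulr_ge0; [rewrite subr_ge0 | ].
  by apply: ltW; apply: (typ_deg_gt0 m100 mn D0).
(* Once [Phi] has reached 1 the left-hand side is not positive, and regularity need not be known. *)
case: (lerP 1 (Phi U N.+1)) => hP.
  apply: (@le_trans _ _ 0) => //; apply: mulr_ge0_le0; last by rewrite subr_le0.
  by rewrite big_nat_cond; apply: prodr_ge0 => i /andP[/andP[hi _] _]; exact: pos.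
have rU := Phi_regular hP.
have mN : m <= N%:R by apply: le_trans hm _; rewrite ler_nat leq_subr.
have st := Phi_step bU mN erefl hN rU.
have /andP[E1 _] := avail_bounds bU mN erefl rU.
have NN : (N%:R <= n0) by apply: le_trans hN; rewrite ler_nat.
set F := \prod_(N - k <= i < N) ((1 - eta) * i.+1%:R * typ_deg i.+1%:R).
have F0 : 0 <= F.
  by rewrite /F big_nat_cond; apply: prodr_ge0 => i /andP[/andP[hi _] _]; exact: pos.
rewrite big_nat_recr ?leq_subr //= -/F natr_sum.
apply: (@le_trans _ _ (\sum_(q in avail U) F * (1 - Phi (U :\: lines q) N))); last first.
  by apply: ler_sum => q qU; apply: IH => //; exact: balanced_step.
rewrite -mulr_sumr -mulrA; apply: ler_wpM2l => //.
rewrite sumrB sumr_const.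
apply: (@le_trans _ _ (#|avail U|%:R * (1 - Phi U N.+1))); last first.
  by rewrite mulrBr mulr1 lerD2l lerN2.
apply: ler_wpM2r; first by rewrite subr_ge0 ltW.
apply: le_trans E1; rewrite (mulrC (1 - eta)).
apply: ler_wpM2r; first by apply: ltW; apply: (typ_deg_gt0 m100 mn D0).
apply: ler_wpM2l => //; rewrite lerD2l lerN2; apply: le_trans he1.
by apply: (del_ge m100 mn del0_gt0 m0); apply: le_trans mN _; rewrite ler_nat.
Qed.

End Potential.

(** * Concentration for random colourings *)

Section Colouring.
Variables (R : realType) (C : finType) (p : nat).
Local Notation Om := {ffun C -> 'I_p.+1}.
Local Notation Q := (p.+1%:R : R).
Implicit Types (w : Om) (k : C) (f g : Om -> R) (s : seq C) (A B : {set C}).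

Definition upd w k (c : 'I_p.+1) : Om := [ffun i => if i == k then c else w i].
(* Expectation over one coordinate; [expect] iterates it, so that independence and the
   exponential moment bound are proved one coordinate at a time. *)
Definition avg k f : Om -> R := fun w => (\sum_c f (upd w k c)) / Q.
Fixpoint expect s f : Om -> R := if s is k :: s' then expect s' (avg k f) else f.

Let Q0 : 0 < Q. Proof. by []. Qed.
Let iQ0 : 0 <= Q^-1. Proof. by rewrite invr_ge0. Qed.

Lemma upd_upd w k c c' : upd (upd w k c) k c' = upd w k c'.
Proof. by apply/ffunP=> i; rewrite !ffunE; case: eqP. Qed.

Lemma updC w k j c c' : k != j -> upd (upd w k c) j c' = upd (upd w j c') k c.
Proof.
move=> kj; apply/ffunP=> i; rewrite !ffunE; case: (i =P j) => // ->.
by case: eqP => // e; rewrite e eqxx in kj.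
Qed.

Lemma expect_le s f g w : (forall w, f w <= g w) -> expect s f w <= expect s g w.
Proof.
elim: s f g => //= k s IH f g h; apply: IH => w'.
by apply: ler_wpM2r => //; apply: ler_sum.
Qed.

Lemma expect_ext s f g w : f =1 g -> expect s f w = expect s g w.
Proof. by move=> h; apply/eqP; rewrite eq_le !expect_le // => w'; rewrite h. Qed.

Lemma avg_cst k (c : R) w : avg k (fun=> c) w = c.
Proof. by rewrite /avg sumr_const card_ord -[c *+ _]mulr_natr mulfK ?gt_eqF. Qed.

Lemma expect_cst s (c : R) w : expect s (fun=> c) w = c.
Proof.
elim: s => //= k s IH; rewrite -[RHS]IH; apply: expect_ext => w'; exact: avg_cst.
Qed.

Lemma expect_sum (I : Type) (r : seq I) (P : pred I) (F : I -> Om -> R) s w :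
  expect s (fun w => \sum_(i <- r | P i) F i w) w = \sum_(i <- r | P i) expect s (F i) w.
Proof.
elim: s F => //= k s IH F; rewrite -IH; apply: expect_ext => w'.
by rewrite /avg exchange_big mulr_suml.
Qed.

Lemma expectZ s (c : R) f w : expect s (fun w => c * f w) w = c * expect s f w.
Proof.
elim: s f => //= k s IH f; rewrite -IH; apply: expect_ext => w'.
by rewrite /avg -mulr_sumr mulrA.
Qed.

Lemma expectD s f g w : expect s (fun w => f w + g w) w = expect s f w + expect s g w.
Proof.
elim: s f g => //= k s IH f g; rewrite -IH; apply: expect_ext => w'.
by rewrite /avg big_split mulrDl.
Qed.

Definition depends_on A f := forall w w', {in A, w =1 w'} -> f w = f w'.

Lemma dep_avg A f k : depends_on A f -> depends_on A (avg k f).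
Proof.
move=> h w w' e; rewrite /avg; congr (_ / _); apply: eq_bigr => c _; apply: h => i iA.
by rewrite !ffunE e.
Qed.

Lemma dep_upd A f w k c : depends_on A f -> k \notin A -> f (upd w k c) = f w.
Proof. by move=> h kA; apply: h => i iA; rewrite ffunE; case: eqP => // e; rewrite -e iA in kA. Qed.

Lemma expect_indep A B s f g w : depends_on A f -> depends_on B g -> [disjoint A & B] ->
  expect s (fun w => f w * g w) w = expect s f w * expect s g w.
Proof.
move=> + + AB; elim: s f g => //= k s IH f g hf hg.
rewrite -(IH _ _ (dep_avg k hf) (dep_avg k hg)); apply: expect_ext => w'.
case: (boolP (k \in A)) => [kA|kA].
  have kB : k \notin B by rewrite (disjointFr AB kA).
  have e u : avg k g u = g u.
    by rewrite /avg (eq_bigr (fun=> g u)) => [|c _]; [exact: avg_cst | exact: dep_upd hg kB].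
  rewrite e /avg [RHS]mulrAC [in RHS]mulr_suml; congr (_ / _); apply: eq_bigr => c _.
  by rewrite (dep_upd _ _ hg kB).
have e u : avg k f u = f u.
  by rewrite /avg (eq_bigr (fun=> f u)) => [|c _]; [exact: avg_cst | exact: dep_upd hf kA].
rewrite e /avg [RHS]mulrA [in RHS]mulr_sumr; congr (_ / _); apply: eq_bigr => c _.
by rewrite (dep_upd _ _ hf kA).
Qed.

Lemma dep1 k a : depends_on [set k] (fun w => (w k == a)%:R).
Proof. by move=> w w' e; rewrite e // inE. Qed.

Lemma expect1 k a s w : k \in s -> expect s (fun w => (w k == a)%:R) w = Q^-1.
Proof.
elim: s => //= j s IH; rewrite inE; case: (eqVneq k j) => [->|kj] /= h.
  rewrite -[RHS](expect_cst s _ w); apply: expect_ext => w'; rewrite /avg.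
  rewrite (bigD1 a) //= ffunE !eqxx big1 ?addr0 ?mul1r // => c hc.
  by rewrite ffunE eqxx (negbTE hc).
rewrite -[RHS](IH h); apply: expect_ext => w'; rewrite /avg.
rewrite (eq_bigr (fun=> (w' k == a)%:R)); first exact: avg_cst.
by move=> c _; rewrite ffunE (negbTE kj).
Qed.

Lemma dep_prod (I : Type) (r : seq I) (f : I -> Om -> R) (A : I -> {set C}) :
  (forall i, depends_on (A i) (f i)) ->
  depends_on [set k | has (fun i => k \in A i) r] (fun w => \prod_(i <- r) f i w).
Proof.
move=> h w w'; elim: r => [|i r IH] e; first by rewrite !big_nil.
rewrite !big_cons (h i w w') ?IH // => k hk; apply: e; rewrite inE /=.
  by move: hk; rewrite inE => ->; rewrite orbT.
by rewrite hk.
Qed.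

Lemma expect_prod (I : eqType) (r : seq I) (f : I -> Om -> R) (A : I -> {set C}) s w :
  uniq r -> (forall i, depends_on (A i) (f i)) ->
  {in r &, forall i i', i != i' -> [disjoint A i & A i']} ->
  expect s (fun w => \prod_(i <- r) f i w) w = \prod_(i <- r) expect s (f i) w.
Proof.
move=> + hA; elim: r => [|i r IH] /= ur hr.
  by rewrite big_nil -[RHS](expect_cst s _ w); apply: expect_ext => u; rewrite big_nil.
have /andP[ir ur'] := ur; rewrite big_cons -IH //; last first.
  by move=> a b ar br; apply: hr; rewrite inE ?ar ?br orbT.
rewrite -(@expect_indep (A i) [set k | has (fun i => k \in A i) r]) //.
- by apply: expect_ext => u; rewrite big_cons.
- exact: dep_prod.
- rewrite disjoint_sym disjoint_subset; apply/fintype.subsetP => k; rewrite inE => /hasP[a ar ka].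
  rewrite inE; apply: contraT; rewrite negbK => ki.
  have ai : a != i by apply: contraNneq ir => <-.
  by rewrite -(disjointFr (hr a i _ _ ai) ka) ?ki // inE ?ar ?eqxx ?orbT.
Qed.

Definition bounded_diff (kap : R) f := forall w k c, `|f w - f (upd w k c)| <= kap.

Lemma bounded_diff_avg kap f k : bounded_diff kap f -> bounded_diff kap (avg k f).
Proof.
move=> h w j c; rewrite /avg -mulrBl -sumrB normrM (ger0_norm iQ0) ler_pdivrMr //.
apply: le_trans (ler_norm_sum _ _ _) _.
rewrite mulr_natr -[in leRHS](card_ord p.+1) -sumr_const; apply: ler_sum => c' _.
case: (eqVneq k j) => [->|kj]; last by rewrite -(updC _ _ _ kj).
by rewrite upd_upd subrr normr0; apply: le_trans (h w j c).
Qed.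

(** The martingale argument for bounded differences: f minus its average over one coordinate has
    mean zero and size at most [kap], so each coordinate costs one factor exp(2 lam^2 kap^2). *)
Lemma exp_moment_le kap lam f s w : bounded_diff kap f -> 0 <= lam -> lam * kap <= 2^-1 ->
  expect s (fun u => expR (lam * (f u - expect s f w))) w <= expR ((size s)%:R * (2 * lam ^+ 2 * kap ^+ 2)).
Proof.
move=> + l0 lk; elim: s f => [|k s IH] f hf /=.
  by rewrite subrr mulr0 mul0r.
set b := 2 * _ * _; set mu := expect s (avg k f) w.
apply: (@le_trans _ _ (expect s (fun u => expR b * expR (lam * (avg k f u - mu))) w)); last first.
  by rewrite expectZ -natr1 mulrDl mul1r addrC expRD ler_pM2l ?expR_gt0 //; apply: IH; exact: bounded_diff_avg.
apply: expect_le => u; rewrite {1}/avg.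
rewrite (eq_bigr (fun c => expR (lam * (avg k f u - mu)) * expR (lam * (f (upd u k c) - avg k f u)))).
  rewrite -mulr_sumr -mulrA mulrC ler_pM2r ?expR_gt0 // ler_pdivrMr //.
  have hc c : c \in [set: 'I_p.+1] -> `|f (upd u k c) - avg k f u| <= kap.
    move=> _; rewrite -[f (upd u k c)](avg_cst k _ u) /avg -mulrBl -sumrB normrM (ger0_norm iQ0).
    rewrite ler_pdivrMr // mulr_natr -[in leRHS](card_ord p.+1) -sumr_const.
    apply: le_trans (ler_norm_sum _ _ _) _; apply: ler_sum => c' _.
    by rewrite -(upd_upd u k c c').
  have := exp_sum_le l0 lk hc; rewrite (eq_bigl xpredT) => [|c]; last by rewrite inE.
  rewrite [in X in _ <= _ + X + _](eq_bigl xpredT) => [|c]; last by rewrite inE.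
  rewrite sumrB sumr_const cardsT card_ord -[avg k f u *+ _]mulr_natl.
  have -> : \sum_c f (upd u k c) = Q * avg k f u by rewrite /avg mulrC divfK ?gt_eqF.
  rewrite subrr mulr0 addr0 => h; apply: le_trans h _; rewrite -/b.
  rewrite -[X in X + _]mulr1 -mulrDr mulrC ler_pM2r //; exact: expR_ge1Dx.
by move=> c _; rewrite -expRD -mulrDr; congr (expR (lam * _)); ring.
Qed.

Lemma bounded_diff_sum (I : finType) (D : {set I}) (F : I -> Om -> R) (A : I -> {set C}) (kap : nat) :
  (forall i, depends_on (A i) (F i)) -> (forall i w, 0 <= F i w <= 1) ->
  (forall k, #|[set i in D | k \in A i]| <= kap)%N ->
  bounded_diff kap%:R (fun w => \sum_(i in D) F i w).
Proof.
move=> hA F01 hk w k c; rewrite -sumrB; apply: le_trans (ler_norm_sum _ _ _) _.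
apply: (@le_trans _ _ (\sum_(i in [set i in D | k \in A i]) 1)); last first.
  by rewrite sumr_const ler_nat.
rewrite [leRHS](eq_bigl (fun i => (i \in D) && (k \in A i))) => [|i]; last by rewrite inE.
rewrite big_mkcondr; apply: ler_sum => i _; case: ifP => ki.
  by rewrite ler_norml; have /andP[a1 a2] := F01 i w; have /andP[b1 b2] := F01 i (upd w k c);
     apply/andP; split; lra.
by rewrite (dep_upd _ _ (hA i)) ?ki // subrr normr0.
Qed.

(** A union bound in expectation: the exponentials of all deviations of both signs are summed, and
    some colouring keeps the sum below exp(lam t), hence each of its terms. *)
Lemma concentrated (I : finType) (F : I -> Om -> R) (kap lam t : R) s w :
  (forall i, bounded_diff kap (F i)) -> 0 < lam -> lam * kap <= 2^-1 ->
  #|I|%:R * 2 * expR ((size s)%:R * (2 * lam ^+ 2 * kap ^+ 2)) < expR (lam * t) ->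
  exists u, forall i, `|F i u - expect s (F i) w| <= t.
Proof.
move=> hF l0 lk hb.
pose mu i := expect s (F i) w.
pose G (i : I) (u : Om) := expR (lam * (F i u - mu i)) + expR (lam * (- F i u - - mu i)).
have lipN i : bounded_diff kap (fun u => - F i u).
  by move=> u k c; rewrite -opprD normrN; exact: hF.
have muN i : expect s (fun u => - F i u) w = - mu i.
  rewrite -mulN1r /mu -expectZ; apply: expect_ext => u; by rewrite mulN1r.
have hG : expect s (fun u => \sum_i G i u) w < expR (lam * t).
  apply: le_lt_trans hb; rewrite expect_sum.
  rewrite [leRHS](_ : _ = \sum_(i : I) 2 * expR ((size s)%:R * (2 * lam ^+ 2 * kap ^+ 2))); last first.
    by rewrite sumr_const -mulrA mulr_natl.
  apply: ler_sum => i _.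
  rewrite expectD [leRHS]mulr_natl mulr2n; apply: lerD; first by apply: exp_moment_le => //; exact: ltW.
  by rewrite -muN; apply: exp_moment_le => //; exact: ltW.
have [u hu] : exists u, \sum_i G i u < expR (lam * t).
  apply: contrapT => /forallNP h.
  move: hG; rewrite ltNge => /negP; apply; rewrite -[leLHS](expect_cst s _ w); apply: expect_le => u.
  by have := h u; rewrite leNgt => /negP.
exists u => i.
have G0 j : 0 <= G j u by rewrite addr_ge0 // ltW // expR_gt0.
have : G i u < expR (lam * t).
  by apply: le_lt_trans hu; rewrite (bigD1 i) //= lerDl sumr_ge0.
have a1 := expR_gt0 (lam * (F i u - mu i)); have a2 := expR_gt0 (lam * (- F i u - - mu i)).
rewrite /G => h.
have h1 : expR (lam * (F i u - mu i)) < expR (lam * t) by lra.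
have h2 : expR (lam * (- F i u - - mu i)) < expR (lam * t) by lra.
move: h1 h2; rewrite !ltr_expR !ltr_pM2l // => h1 h2.
rewrite -/(mu i) ler_norml; apply/andP; split; lra.
Qed.

End Colouring.

(** * Degrees of the lines after a random template *)

Section Degrees.
Variables (R : realType) (K : finComUnitRingType).
Hypothesis u2 : (2 : K) \is a GRing.unit.
Hypothesis u3 : (3 : K) \is a GRing.unit.
Hypothesis hsol : forall (c : nat) (b : K), (0 < c)%N -> (#|[set t : K | t *+ c == b]| <= c)%N.
Variable p : nat.
Hypothesis p3 : (3 <= p)%N.
Local Notation cell := (bool * K)%type.
Local Notation line := ('I_4 * K)%type.
Local Notation Om := {ffun cell -> 'I_p.+1}.
Local Notation Q := (p.+1%:R : R).
Implicit Types (x y z : K) (u w : Om) (e : seq (cell * nat)) (v : line) (q : K * K).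

Definition cells e : seq cell := [seq (c.1.1, sgn_repr c.1.2) | c <- e].
Definition cellset e : {set cell} := [set k | k \in cells e].

Lemma dep_holds e : depends_on (cellset e) (fun u => (holds u e)%:R : R).
Proof.
move=> u u' h; congr (_%:R); rewrite /holds; congr (nat_of_bool _); apply: eq_in_all => c ce.
by rewrite h // inE; apply: map_f.
Qed.

Lemma expect_holds e w : uniq (cells e) ->
  expect (enum {: cell}) (fun u => (holds u e)%:R : R) w = Q^-1 ^+ size e.
Proof.
elim: e => [|c e IH] /=; first by rewrite -[RHS](expect_cst (R := R) (enum {: cell}) 1 w).
case/andP => ce ue; rewrite exprS -(IH ue) -(expect1 R (inord c.2) w (mem_enum predT (c.1.1, sgn_repr c.1.2))).
rewrite -(@expect_indep _ _ _ [set (c.1.1, sgn_repr c.1.2)] (cellset e)).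
- by apply: expect_ext => u; rewrite /holds /= -natrM mulnb.
- exact: dep1.
- exact: dep_holds.
- by rewrite disjoints1 inE.
Qed.

Definition cellv v : {set cell} := cellset (flatten (cover_events v)).
Definition unc u v : R := (v.2 != 0)%:R * (1 - (num_cover u v)%:R).
(** A line is covered by one of four mutually exclusive events, each prescribing the colours of four
    distinct cells. *)
Definition unc_mean : R := 1 - 4 * Q^-1 ^+ 4.

Lemma unc01 u v : 0 <= unc u v <= 1.
Proof.
have := num_cover_le1 u2 u3 p3 u v; rewrite /unc; case: (num_cover u v) => [|[|]] // _; case: (v.2 == 0);
  rewrite /= ?mul0r ?mul1r ?subr0 ?subrr ?lexx ?ler01 //.
Qed.

Lemma uncE u v : unc u v = (v \in uncovered u)%:R.
Proof.
rewrite uncovered_unc // /unc; have := num_cover_le1 u2 u3 p3 u v.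
by case: (num_cover u v) => [|[|]] // _; case: (v.2 == 0); rewrite /= ?mul0r ?mul1r ?subr0 ?subrr.
Qed.

Lemma dep_unc v : depends_on (cellv v) (fun u => unc u v).
Proof.
move=> u u' h; rewrite /unc /num_cover; congr (_ * (1 - _%:R)); apply: eq_in_count => e ev.
rewrite /holds; apply: eq_in_all => c ce.
rewrite h // inE; apply/mapP; exists c => //.
by apply/flattenP; exists e.
Qed.

Let u4 : (4 : K) \is a GRing.unit. Proof. by rewrite (_ : 4 = 2 * 2) ?unitrMl // -natrM. Qed.

Lemma cells_ev3 x : x != 0 -> uniq (cells (tri_event x)).
Proof.
move=> x0; have d (c : nat) : (c%:R : K) \is a GRing.unit -> x *+ c != 0.
  by move=> uc; apply: contraNneq x0 => h; rewrite -(mulrK uc x) mulr_natr h mul0r.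
rewrite /cells /= !inE !xpair_eqE /= !negb_or !andbT !(sgn_repr_eq u2) !negbK /apart.
have -> : (x != x *+ 3) = (x *+ 2 != 0) by rewrite -subr_eq0 -oppr_eq0; congr (~~ (_ == _)); ring.
have -> : (x != - (x *+ 3)) = (x *+ 4 != 0) by rewrite -subr_eq0; congr (~~ (_ == _)); ring.
have -> : (x *+ 2 != x *+ 4) = (x *+ 2 != 0) by rewrite -subr_eq0 -oppr_eq0; congr (~~ (_ == _)); ring.
have -> : (x *+ 2 != - (x *+ 4)) = (x *+ 2 *+ 3 != 0) by rewrite -subr_eq0; congr (~~ (_ == _)); ring.
rewrite !d //= -mulrnA d // natrM unitrMl //.
Qed.

Lemma cells_ev2 x : x != 0 -> uniq (cells (two_event x)).
Proof.
move=> x0; have d (c : nat) : (c%:R : K) \is a GRing.unit -> x *+ c != 0.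
  by move=> uc; apply: contraNneq x0 => h; rewrite -(mulrK uc x) mulr_natr h mul0r.
rewrite /cells /= !inE !xpair_eqE /= !negb_or !andbT !(sgn_repr_eq u2) !negbK /apart.
have -> : (x != x *+ 2) = (x != 0) by rewrite -subr_eq0 -oppr_eq0; congr (~~ (_ == _)); ring.
have -> : (x != - (x *+ 2)) = (x *+ 3 != 0) by rewrite -subr_eq0; congr (~~ (_ == _)); ring.
have -> : (x != x *+ 3) = (x *+ 2 != 0) by rewrite -subr_eq0 -oppr_eq0; congr (~~ (_ == _)); ring.
have -> : (x != - (x *+ 3)) = (x *+ 4 != 0) by rewrite -subr_eq0; congr (~~ (_ == _)); ring.
by rewrite !d ?x0.
Qed.

Lemma expect_unc v w : v.2 != 0 -> expect (enum {: cell}) (fun u => unc u v) w = unc_mean.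
Proof.
move=> v0.
have hE e : e \in cover_events v -> expect (enum {: cell}) (fun u => (holds u e)%:R : R) w = Q^-1 ^+ 4.
  have nd (c : K) : c \is a GRing.unit -> v.2 / c != 0 by move=> uc; rewrite div0.
  have h3 x : x != 0 -> expect (enum {: cell}) (fun u => (holds u (tri_event x))%:R : R) w = Q^-1 ^+ 4.
    by move=> /cells_ev3 /expect_holds ->.
  have h2 x : x != 0 -> expect (enum {: cell}) (fun u => (holds u (two_event x))%:R : R) w = Q^-1 ^+ 4.
    by move=> /cells_ev2 /expect_holds ->.
  rewrite /cover_events; case: ifP => _; rewrite !inE => /or4P[] /eqP ->; rewrite ?h3 ?h2 ?nd //.
rewrite (@expect_ext _ _ _ _ _ (fun u => 1 + -1 * \sum_(e <- cover_events v) (holds u e)%:R)); last first.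
  move=> u; rewrite /unc v0 mul1r mulN1r /num_cover; congr (1 - _).
  by rewrite -sum1_count natr_sum big_mkcond; apply: eq_bigr => e _; case: (holds u e).
rewrite expectD expect_cst expectZ expect_sum /unc_mean (eq_big_seq _ hE) mulN1r.
by rewrite /cover_events; case: ifP => _; rewrite !big_cons big_nil; congr (1 - _); ring.
Qed.

Definition multipliers : seq nat := [:: 1; 2; 3; 4]%N.

Lemma unit_mm m : m \in multipliers -> (m%:R : K) \is a GRing.unit.
Proof. by rewrite !inE => /or4P[] /eqP ->; rewrite ?unitr1. Qed.

Lemma cellv_mult v k : k \in cellv v ->
  exists m d, [/\ m \in multipliers, d \in multipliers & k.2 = sgn_repr (v.2 *+ m / d%:R)].
Proof.
rewrite inE => /mapP[c + ->] /=.
have ex m d x : m \in multipliers -> d \in multipliers -> v.2 *+ m / d%:R = x ->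
    exists m' d', [/\ m' \in multipliers, d' \in multipliers & sgn_repr x = sgn_repr (v.2 *+ m' / d'%:R)].
  by move=> hm hd <-; exists m, d.
rewrite /cover_events; case: ifP => _ /=; rewrite !inE; do ?[case/orP=> [/eqP -> /=|]]; try move/eqP => -> /=.
all: first [by apply: (ex 1%N 1%N); rewrite // ?mulrnAl !mulr1n ?divr1
  |by apply: (ex 1%N 2%N); rewrite // ?mulrnAl !mulr1n ?divr1
  |by apply: (ex 1%N 3%N); rewrite // ?mulrnAl !mulr1n ?divr1
  |by apply: (ex 1%N 4%N); rewrite // ?mulrnAl !mulr1n ?divr1
  |by apply: (ex 2%N 1%N); rewrite // ?mulrnAl !mulr1n ?divr1
  |by apply: (ex 2%N 2%N); rewrite // mulrnAl
  |by apply: (ex 2%N 3%N); rewrite // mulrnAl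
  |by apply: (ex 2%N 4%N); rewrite // mulrnAl
  |by apply: (ex 3%N 1%N); rewrite // ?mulrnAl !mulr1n ?divr1
  |by apply: (ex 3%N 2%N); rewrite // mulrnAl
  |by apply: (ex 3%N 3%N); rewrite // mulrnAl
  |by apply: (ex 3%N 4%N); rewrite // mulrnAl
  |by apply: (ex 4%N 1%N); rewrite // ?mulrnAl !mulr1n ?divr1
  |by apply: (ex 4%N 2%N); rewrite // mulrnAl
  |by apply: (ex 4%N 3%N); rewrite // mulrnAl
  |by apply: (ex 4%N 4%N); rewrite // mulrnAl].
Qed.

End Degrees.

Section DegreeStat.
Variables (R : realType) (K : finComUnitRingType).
Hypothesis u2 : (2 : K) \is a GRing.unit.
Hypothesis u3 : (3 : K) \is a GRing.unit.
Hypothesis hsol : forall (c : nat) (b : K), (0 < c)%N -> (#|[set t : K | t *+ c == b]| <= c)%N.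
Variable p : nat.
Hypothesis p3 : (3 <= p)%N.
Local Notation cell := (bool * K)%type.
Local Notation line := ('I_4 * K)%type.
Local Notation Om := {ffun cell -> 'I_p.+1}.
Local Notation unc := (@unc R K p).
Local Notation beta := (unc_mean R p).
Local Notation E f w := (expect (enum {: cell}) f w).
Implicit Types (x y z : K) (u w : Om) (v : line) (q : K * K) (i j : 'I_4).

Definition on_line v : {set K * K} := [set q | phi v.1 q == v.2].

Lemma card_on_line v : #|on_line v| = #|K|.
Proof.
case: v => j z; pose f (t : K) : K * K :=
  match val j with 0 => (z, t) | 1 => (t, z) | 2 => (t, z - t) | _ => (t, t - z) end.
have fi : injective f.
  by rewrite /f => t t'; case: j {f} => [[|[|[|[|//]]]] hj] //= [] //.
rewrite -cardsT -(card_imset _ fi); apply: eq_card => q; rewrite inE /=.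
apply/eqP/imsetP => [h|[t _ ->]]; last first.
  by rewrite /f /phi; case: j {f fi} => [[|[|[|[|//]]]] hj] //=; ring.
case: q h => a b; rewrite /phi /f; case: j {f fi} => [[|[|[|[|//]]]] hj] //= <-.
- by exists b.
- by exists a.
- by exists a => //; congr (_, _); ring.
- by exists a => //; congr (_, _); ring.
Qed.

Definition others v : seq 'I_4 := [seq i <- enum 'I_4 | i != v.1].
Definition indic v q u : R := \prod_(i <- others v) unc u (i, phi i q).
Definition degree_stat v u : R := \sum_(q in on_line v) indic v q u.
Definition reach v q : {set cell} := [set k | has (fun i => k \in cellv (i, phi i q)) (others v)].

Lemma mem_others v i : (i \in others v) = (i != v.1).
Proof. by rewrite mem_filter mem_enum andbT. Qed.

Lemma size_others v : size (others v) = 3.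
Proof. by rewrite size_filter -sum1_count big_enum_cond sum1_card (cardC1 v.1) card_ord. Qed.

Lemma sum_others v (c : nat) : (\sum_(i <- others v) c = 3 * c)%N.
Proof. by rewrite big_const_seq count_predT size_others iter_addn_0 mulnC. Qed.

Lemma dep_indic v q : depends_on (reach v q) (indic v q).
Proof. by apply: dep_prod => i; exact: dep_unc. Qed.

Lemma indic01 v q u : 0 <= indic v q u <= 1.
Proof.
rewrite /indic; elim: (others v) => [|i s IH]; first by rewrite big_nil ler01 lexx.
rewrite big_cons; have /andP[a1 a2] := unc01 R u2 u3 p3 u (i, phi i q); have /andP[b1 b2] := IH.
by rewrite mulr_ge0 // mulr_ile1.
Qed.

Lemma indicE v q u : indic v q u = (all (fun i => (i, phi i q) \in uncovered u) (others v))%:R.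
Proof.
rewrite /indic; elim: (others v) => [|i s IH] /=; first by rewrite big_nil.
by rewrite big_cons IH uncE // -natrM mulnb.
Qed.

Lemma stat_dg v u : v \in uncovered u -> degree_stat v u = (avail_degree (uncovered u) v)%:R.
Proof.
move=> vV; rewrite /degree_stat /avail_degree -sum1_card natr_sum.
rewrite [LHS]big_mkcond [RHS]big_mkcond; apply: eq_bigr => q _ /=.
rewrite indicE [q \in on_line v]inE [q \in through _ _]inE [v \in lines q]inE.
case: (phi v.1 q =P v.2) => h; rewrite ?andbF // andbT.
have -> : (q \in avail (uncovered u)) = all (fun i => (i, phi i q) \in uncovered u) (others v).
  apply/availP/allP => [hq i _ //|hq i].
  case: (eqVneq i v.1) => [->|iv]; last by apply: hq; rewrite mem_others.
  by rewrite h -surjective_pairing.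
by case: (all _ _).
Qed.

Lemma stat_slice v u i : i != v.1 -> degree_stat v u <= #|slice (uncovered u) i|%:R.
Proof.
move=> iv; rewrite /degree_stat (eq_bigr (fun q => (all (fun i => (i, phi i q) \in uncovered u) (others v))%:R)); last first.
  by move=> q _; exact: indicE.
rewrite -natr_sum ler_nat.
set S := [set q in on_line v | all (fun i => (i, phi i q) \in uncovered u) (others v)].
rewrite [leqLHS](_ : _ = #|S|); last first.
  rewrite -sum1_card [RHS]big_mkcond [LHS]big_mkcond; apply: eq_bigr => q _ /=.
  by rewrite [q \in S]inE; case: (_ \in on_line v); case: (all _ _).
rewrite -(card_in_imset (f := phi i)); last first.
  move=> q q'; rewrite !inE => /andP[/eqP a1 _] /andP[/eqP b1 _] e.
  by apply: (line_inj u2 iv e); rewrite a1 b1.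
apply: subset_leq_card; apply/fintype.subsetP => _ /imsetP[q + ->].
by rewrite inE => /andP[_ /allP h]; rewrite inE h // mem_others.
Qed.

(** The cells that matter for a line with label z are z m/d with m, d at most 4. The label is thus
    one of 16 multiples of the label of [k] up to sign, and each label fixes the queen on [v]. *)
Lemma hit_cell (k : cell) v i : i != v.1 ->
  (#|[set q in on_line v | k \in cellv (i, phi i q)]| <= 32)%N.
Proof.
move=> iv; pose L := [seq (m, d) | m <- multipliers, d <- multipliers].
apply: (@leq_trans (\sum_(c <- L) 2)%N); last by rewrite /L /= !big_cons big_nil.
pose P (c : nat * nat) q := (q \in on_line v) && ~~ apart (phi i q) (k.2 *+ c.2 / c.1%:R).
apply: leq_trans (_ : _ <= #|[set q | has (P^~ q) L]|)%N _.
  apply: subset_leq_card; apply/fintype.subsetP => q; rewrite inE => /andP[qv /cellv_mult].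
  case=> m [d [hm hd e]]; rewrite inE; apply/hasP; exists (m, d); first by apply/allpairsP; exists (m, d).
  rewrite /P /= qv /=.
  have um := unit_mm u2 u3 hm; have ud := unit_mm u2 u3 hd.
  have : ~~ apart k.2 (phi i q *+ m / d%:R) by rewrite -sgn_repr_eq // e /= sgn_repr_eq // /apart; rewrite /sgn_repr; case: ifP; rewrite ?opprK eqxx ?andbF.
  rewrite /apart !negb_and !negbK => /orP[] /eqP ->; apply/orP; [left|right]; apply/eqP.
    by rewrite -[_ *+ d]mulr_natr divrK // -[_ *+ m]mulr_natr mulrK.
  by rewrite mulNrn mulNr opprK -[_ *+ d]mulr_natr divrK // -[_ *+ m]mulr_natr mulrK.
apply: card_has_le => c _; rewrite /P.
rewrite (_ : [set q | _] = [set q in on_line v | phi i q == k.2 *+ c.2 / c.1%:R]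
   :|: [set q in on_line v | phi i q == - (k.2 *+ c.2 / c.1%:R)]); last first.
  by apply/setP=> q; rewrite !inE -andb_orr /apart negb_and !negbK.
have one (y : K) : (#|[set q in on_line v | phi i q == y]| <= 1)%N.
  apply/card_le1_eqP => q q'; rewrite !inE => /andP[/eqP a1 /eqP a2] /andP[/eqP b1 /eqP b2].
  by apply: (line_inj u2 iv); rewrite ?a1 ?a2.
by apply: leq_trans (leq_card_setU _ _) _; rewrite -[2%N]/(1 + 1)%N leq_add.
Qed.

Lemma hit_reach (k : cell) v : (#|[set q in on_line v | k \in reach v q]| <= 96)%N.
Proof.
apply: (@leq_trans (\sum_(i <- others v) 32)%N); last first.
  by rewrite sum_others.
rewrite (_ : [set q in _ | _] =
  [set q | has (fun i => (q \in on_line v) && (k \in cellv (i, phi i q))) (others v)]).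
  apply: (card_has_le (P := fun i q => (q \in on_line v) && (k \in cellv (i, phi i q)))).
  by move=> i; rewrite mem_others; exact: hit_cell.
apply/setP=> q; rewrite !inE; case: (phi v.1 q == v.2) => //=.
by elim: (others v).
Qed.

Lemma bounded_diff_stat v : bounded_diff 96 (degree_stat v).
Proof.
apply: (@bounded_diff_sum _ _ _ _ _ _ (reach v) 96).
- exact: dep_indic.
- exact: indic01.
- by move=> k; exact: hit_reach.
Qed.

Definition generic v q := all (fun i => (phi i q != 0)
   && all (fun j => (i == j) || [disjoint cellv (i, phi i q) & cellv (j, phi j q)]) (others v)) (others v).

(** For each of three lines: one queen with label 0, and for each of three partners 256 pairs of
    ratios with at most 128 queens from [cross_count]. *)
Definition special_bound : nat := (3 * (1 + 3 * (256 * 128)))%N.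

Lemma generic_count v : v.2 != 0 -> (#|[set q in on_line v | ~~ generic v q]| <= special_bound)%N.
Proof.
move=> v0; rewrite /special_bound; set c := (256 * 128)%N.
have hc : c = (256 * 128)%N by [].
clearbody c.
pose P i q := (q \in on_line v) && ((phi i q == 0) || has (fun j => (i != j) &&
  ~~ [disjoint cellv (i, phi i q) & cellv (j, phi j q)]) (others v)).
rewrite (_ : [set q in _ | _] = [set q | has (P^~ q) (others v)]); last first.
  apply/setP=> q; rewrite !inE /P inE; case: (phi v.1 q == v.2) => /=; last by elim: (others v).
  rewrite /generic -has_predC; apply: eq_has => i /=; rewrite negb_and negbK; congr (_ || _).
  by rewrite -has_predC; apply: eq_has => j /=; rewrite negb_or.
apply: (@leq_trans (\sum_(i <- others v) (1 + 3 * c))%N); last by rewrite sum_others.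
apply: card_has_le => i; rewrite mem_others => iv; rewrite /P.
rewrite (_ : [set q | _] = [set q in on_line v | phi i q == 0] :|: [set q | has (fun j =>
    [&& q \in on_line v, i != j & ~~ [disjoint cellv (i, phi i q) & cellv (j, phi j q)]]) (others v)]); last first.
  apply/setP=> q; rewrite !inE; case: (phi v.1 q == v.2) => //=.
  by rewrite (eq_has (a2 := pred0)) ?has_pred0.
apply: leq_trans (leq_card_setU _ _) _; apply: leq_add.
  apply/card_le1_eqP => q q'; rewrite !inE => /andP[/eqP a1 /eqP a2] /andP[/eqP b1 /eqP b2].
  by apply: (line_inj u2 iv); rewrite ?a1 ?a2.
apply: (@leq_trans (\sum_(j <- others v) c)%N); last by rewrite sum_others.
apply: (card_has_le (P := fun j q =>
    [&& q \in on_line v, i != j & ~~ [disjoint cellv (i, phi i q) & cellv (j, phi j q)]])) => j _.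
have [->|ij] := eqVneq i j.
  by rewrite (_ : [set q | _] = finset.set0) ?cards0 //; apply/setP=> q; rewrite !inE /= andbF.
pose S (l : (nat * nat) * (nat * nat)) q := (phi v.1 q == v.2) &&
  ~~ apart (phi i q *+ (l.1.1 * l.2.2)) (phi j q *+ (l.2.1 * l.1.2)).
pose L1 := [seq (a, b) | a <- multipliers, b <- multipliers].
pose L2 := [seq (a, b) | a <- L1, b <- L1].
apply: (@leq_trans (\sum_(l <- L2) 128)%N); last first.
  by rewrite hc big_const_seq count_predT iter_addn_0 mulnC leq_mul2r /L2 !size_allpairs.
apply: leq_trans (_ : _ <= #|[set q | has (S^~ q) L2]|)%N _.
  apply: subset_leq_card; apply/fintype.subsetP => q; rewrite inE => /and3P[qv _].
  rewrite inE in qv.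
  rewrite disjoint_subset => /subsetPn[k /cellv_mult[m [d [hm hd e]]]].
  rewrite negbK => /cellv_mult[m' [d' [hm' hd' e']]].
  rewrite inE; apply/hasP; exists ((m, d), (m', d')).
    by apply/allpairsP; exists ((m, d), (m', d')); split=> //; apply/allpairsP; [exists (m, d)|exists (m', d')].
  rewrite /S qv /=; move: e; rewrite e' => /eqP; rewrite eq_sym sgn_repr_eq //=.
  have ud := unit_mm u2 u3 hd; have ud' := unit_mm u2 u3 hd'.
  rewrite /apart !negb_and !negbK => /orP[] /eqP h; apply/orP; [left|right]; apply/eqP.
    by rewrite !mulrnA -[_ *+ d']mulr_natr -[phi i q *+ m](divrK ud) h mulrAC divrK // mulr_natr.
  by rewrite !mulrnA -[_ *+ d']mulr_natr -[phi i q *+ m](divrK ud) h !mulNr mulrAC divrK // mulr_natr.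
apply: card_has_le => -[[a b] [e d]] /allpairsP[[[a' b'] [e' d']]] /= [].
move=> /allpairsP[[a1 b1] /= [ha hb [-> ->]]] /allpairsP[[c1 d1] /= [hc1 hd [-> ->]]] [-> -> -> ->] {a b e d a' b' e' d'}.
have le4 n : n \in multipliers -> (n <= 4)%N by rewrite !inE => /or4P[] /eqP ->.
have ki : v.1 != i by rewrite eq_sym.
apply: (cross_count u2 hsol v0 ki ij).
- by rewrite natrM unitrMl ?(unit_mm u2 u3).
- by rewrite -[16%N]/(4 * 4)%N leq_mul ?le4.
- by rewrite -[16%N]/(4 * 4)%N leq_mul ?le4.
Qed.

Lemma expect_generic v q w : generic v q -> E (indic v q) w = beta ^+ 3.
Proof.
move=> /allP g; rewrite /indic (@expect_prod _ _ _ _ _ _ (fun i => cellv (i, phi i q))).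
- rewrite (eq_big_seq (fun=> beta)).
    by rewrite big_const_seq count_predT size_others /= mulr1 !exprS expr0 mulr1.
  by move=> i /g /andP[i0 _]; exact: expect_unc.
- by rewrite filter_uniq // enum_uniq.
- by move=> i; exact: dep_unc.
- move=> i j hi hj ij; have /andP[_ /allP /(_ j hj)] := g i hi.
  by rewrite (negbTE ij).
Qed.

Lemma mean_stat v w : v.2 != 0 -> 0 <= beta <= 1 ->
  `|E (degree_stat v) w - #|K|%:R * beta ^+ 3| <= special_bound%:R.
Proof.
move=> v0 /andP[b0 b1].
rewrite /degree_stat expect_sum -(card_on_line v) mulr_natl -sumr_const -sumrB.
apply: le_trans (ler_norm_sum _ _ _) _.
apply: (@le_trans _ _ (#|[set q in on_line v | ~~ generic v q]|%:R)); last first.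
  by rewrite ler_nat; exact: generic_count.
rewrite -sum1_card natr_sum [leRHS](eq_bigl (fun q => (q \in on_line v) && ~~ generic v q)).
  rewrite big_mkcondr; apply: ler_sum => q _; case: (boolP (generic v q)) => g /=.
    by rewrite expect_generic // subrr normr0.
  have h0 : 0 <= E (indic v q) w.
    by rewrite -[leLHS](expect_cst (enum {: cell}) _ w); apply: expect_le => u; have /andP[] := indic01 v q u.
  have h1 : E (indic v q) w <= 1.
    by rewrite -[leRHS](expect_cst (enum {: cell}) _ w); apply: expect_le => u; have /andP[] := indic01 v q u.
  have c0 : 0 <= beta ^+ 3 by exact: exprn_ge0.
  have c1 : beta ^+ 3 <= 1 by exact: exprn_ile1.
  by rewrite ler_norml; apply/andP; split; lra.
by move=> q; rewrite inE.
Qed.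

End DegreeStat.

(** * Supply of gadgets after a random template *)

Section GadgetStat.
Variables (R : realType) (K : finComUnitRingType).
Hypothesis u2 : (2 : K) \is a GRing.unit.
Hypothesis u3 : (3 : K) \is a GRing.unit.
Hypothesis hsol : forall (c : nat) (b : K), (0 < c)%N -> (#|[set t : K | t *+ c == b]| <= c)%N.
Variable p : nat.
Hypothesis p3 : (3 <= p)%N.
Local Notation cell := (bool * K)%type.
Local Notation line := ('I_4 * K)%type.
Local Notation Om := {ffun cell -> 'I_p.+1}.
Local Notation Q := (p.+1%:R : R).
Local Notation E f w := (expect (enum {: cell}) f w).
Implicit Types (x y z t : K) (u w : Om) (v : line) (q a : K * K) (r : K * K * K * K).
Implicit Types (N : seq (K * K)).

(** The colours follow the order of [axis_cells] and of [diag_cells] alike: 0 and 1 for the two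
    [tri] orbits, 2 and 3 for the two [two] orbits. *)
Definition queen_cols : seq nat := [:: 0; 1; 0; 1; 2; 3; 2; 3]%N.
Definition axis_ev q : seq (cell * nat) := zip [seq (false, x) | x <- axis_cells q] queen_cols.
Definition diag_ev q : seq (cell * nat) := zip [seq (true, x) | x <- diag_cells q] queen_cols.
Definition queens_ev N : seq (cell * nat) :=
  flatten [seq axis_ev q | q <- N] ++ flatten [seq diag_ev q | q <- N].

Lemma queens_ev_approved u N : all (@nonzero K) N -> holds u (queens_ev N) ->
  all (approved (in_tri u) (in_two u)) N.
Proof.
move=> /allP nN; rewrite /holds /queens_ev all_cat => /andP[/allP hA /allP hD].
apply/allP => q qN.
have : all (fun c => u (c.1.1, sgn_repr c.1.2) == inord c.2) (axis_ev q).
  by apply/allP => c cq; apply: hA; apply/flatten_mapP; exists q.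
have : all (fun c => u (c.1.1, sgn_repr c.1.2) == inord c.2) (diag_ev q).
  by apply/allP => c cq; apply: hD; apply/flatten_mapP; exists q.
have /and4P[n1 n2 n3 n4] := nN q qN.
rewrite /= /approved /in_tri /in_two n1 n2 n3 n4 /holds /= !andbT.
by do 7 (case/andP => -> ); move=> ->; do 7 (case/andP => ->); move=> ->.
Qed.

Lemma uniq_rp (s : seq K) : pairwise (@apart K) s -> uniq [seq sgn_repr x | x <- s].
Proof.
elim: s => //= x s IH /andP[/allP ax /IH ->]; rewrite andbT.
by apply/mapP => -[y ys /eqP]; rewrite (sgn_repr_eq u2) ax.
Qed.

Lemma cells_queens_ev N : cells (queens_ev N) =
  [seq (false, x) | x <- [seq sgn_repr x | x <- flatten [seq axis_cells q | q <- N]]]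
  ++ [seq (true, x) | x <- [seq sgn_repr x | x <- flatten [seq diag_cells q | q <- N]]].
Proof.
rewrite /cells /queens_ev map_cat; congr (_ ++ _).
  by elim: N => //= q N IH; rewrite IH.
by elim: N => //= q N IH; rewrite IH.
Qed.

Lemma uniq_queens_ev N : pairwise (@apart K) (flatten [seq axis_cells q | q <- N]) ->
  pairwise (@apart K) (flatten [seq diag_cells q | q <- N]) -> uniq (cells (queens_ev N)).
Proof.
move=> /uniq_rp h1 /uniq_rp h2; rewrite cells_queens_ev cat_uniq.
have ib (b : bool) : injective (fun x : K => (b, x)) by move=> x y [].
rewrite (map_inj_uniq (ib false)) (map_inj_uniq (ib true)) h1 h2 andbT /=.
by apply/hasPn => _ /mapP[x _ ->]; apply/negP => /mapP[y _ []].
Qed.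

Lemma size_queens_ev N : size (queens_ev N) = (16 * size N)%N.
Proof.
rewrite size_cat; have h (f : K * K -> seq (cell * nat)) : (forall q, size (f q) = 8) ->
    size (flatten [seq f q | q <- N]) = (8 * size N)%N.
  by move=> hf; elim: N => [|q N IH] //=; rewrite size_cat hf IH mulnS.
by rewrite !h // -mulnDl.
Qed.

Definition gad_ev a r t := queens_ev (gad_neg a r t).
Definition gadget_stat a r u : R := \sum_(t in [set t | spread a r t]) (holds u (gad_ev a r t))%:R.

Lemma fineE a r t : spread a r t ->
  [/\ all (@nonzero K) (gad_neg a r t),
      pairwise (@apart K) (flatten [seq axis_cells q | q <- gad_neg a r t])
    & pairwise (@apart K) (flatten [seq diag_cells q | q <- gad_neg a r t])].
Proof.
rewrite /spread gad_forms_all !gaps_allE !gaps_apart => /and3P[h -> ->]; split=> //.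
move: h; move: (gad_pos a r t) (gad_neg a r t) => P N.
rewrite map_cat flatten_cat all_cat => /andP[_ /allP h]; apply/allP => q qN.
have hc x : x \in coords q -> x != 0 by move=> xq; apply: h; apply/flatten_mapP; exists q.
by apply/and4P; split; apply: hc; rewrite !inE eqxx ?orbT.
Qed.

Lemma gstat_le a r u :
  gadget_stat a r u <= #|[set t | spread a r t && all (approved (in_tri u) (in_two u)) (gad_neg a r t)]|%:R.
Proof.
rewrite /gadget_stat -sum1_card natr_sum [leLHS]big_mkcond [leRHS]big_mkcond; apply: ler_sum => t _.
rewrite !inE; case: (boolP (spread a r t)) => ft; last by [].
have [n0 _ _] := fineE ft; rewrite andTb.
case: (boolP (holds u (gad_ev a r t))) => hh; first by rewrite (queens_ev_approved n0 hh).
by case: ifP.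
Qed.

Definition gad_hits : nat := (gad_coord_bound * (2 * 4))%N.

(** If the cell [k] is used, some coordinate of a negative queen is, up to sign, the label of [k]
    divided by 1, 2, 3 or 4; [fresh_count] bounds the parameters for which this happens. *)
Lemma gad_hit (k : cell) a r :
  (#|[set t in [set t | spread a r t] | k \in cellset (gad_ev a r t)]| <= gad_hits)%N.
Proof.
pose U := [seq k.2 / m%:R | m <- multipliers].
apply: leq_trans (fresh_count hsol a r U).
apply: subset_leq_card; apply/fintype.subsetP => t; rewrite inE => /andP[_].
rewrite [k \in _]inE /gad_ev cells_queens_ev mem_cat => h.
have {h} : exists m q c, [/\ m \in multipliers, q \in gad_neg a r t, c \in coords q & k.2 = sgn_repr (c *+ m)].
  have ex m q c x : m \in multipliers -> q \in gad_neg a r t -> c \in coords q -> x = c *+ m ->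
     exists m q c, [/\ m \in multipliers, q \in gad_neg a r t, c \in coords q & sgn_repr x = sgn_repr (c *+ m)].
    by move=> *; exists m, q, c; split => //; congr sgn_repr.
  case/orP: h => /mapP[_ /mapP[x /flatten_mapP[q qN hx] ->] ->] /=;
    move: hx; rewrite !inE; do ?[case/orP=> [/eqP ->|]]; try move/eqP=> ->.
  all: try first [ by apply: (ex 1%N q q.1) => //; rewrite !inE eqxx ?orbT
    | by apply: (ex 1%N q q.2) => //; rewrite !inE eqxx ?orbT
    | by apply: (ex 1%N q (q.1 + q.2)) => //; rewrite !inE eqxx ?orbT
    | by apply: (ex 1%N q (q.1 - q.2)) => //; rewrite !inE eqxx ?orbT
    | by apply: (ex _ q q.1 (q.1 *+ _) _ _ _ erefl) => //; rewrite !inE eqxx ?orbT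
    | by apply: (ex _ q q.2 (q.2 *+ _) _ _ _ erefl) => //; rewrite !inE eqxx ?orbT
    | by apply: (ex _ q (q.1 + q.2) ((q.1 + q.2) *+ _) _ _ _ erefl) => //; rewrite !inE eqxx ?orbT
    | by apply: (ex _ q (q.1 - q.2) ((q.1 - q.2) *+ _) _ _ _ erefl) => //; rewrite !inE eqxx ?orbT].
move=> [m [q [c [hm qN hc e]]]]; rewrite inE; apply/hasP; exists c.
  by apply/flatten_mapP; exists q.
apply/hasP; exists (k.2 / m%:R); first by apply/mapP; exists m.
have um := unit_mm u2 u3 hm.
have : ~~ apart (c *+ m) k.2.
  rewrite -(sgn_repr_eq u2) e (sgn_repr_eq u2) /apart /sgn_repr; case: ifP => _; by rewrite ?opprK eqxx ?andbF.
rewrite /apart !negb_and !negbK => /orP[] /eqP h; apply/orP; [left|right].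
  by rewrite -h -[c *+ m]mulr_natr mulrK.
by rewrite -[k.2]opprK -h -[c *+ m]mulr_natr mulNr opprK mulrK.
Qed.

Lemma bounded_diff_gstat a r : bounded_diff gad_hits%:R (gadget_stat a r).
Proof.
apply: (@bounded_diff_sum _ _ _ _ _ _ (fun t => cellset (gad_ev a r t)) gad_hits).
- by move=> t; exact: dep_holds.
- by move=> t u; rewrite ler0n lern1 leq_b1.
- by move=> k; exact: gad_hit.
Qed.

(** 32 negative queens prescribe 16 cells each. For [spread] parameters these 512 cells are
    distinct, hence their colours independent. *)
Lemma mean_gstat a r w : rooted a r ->
  (#|K|%:R - gad_bound%:R) * Q^-1 ^+ 512 <= E (gadget_stat a r) w.
Proof.
move=> hr; rewrite /gadget_stat expect_sum.
rewrite (eq_bigr (fun=> Q^-1 ^+ 512)); last first.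
  move=> t; rewrite inE => /fineE[_ h1 h2].
  have e : size (gad_ev a r t) = 512%N by rewrite /gad_ev size_queens_ev.
  by rewrite -e; apply: expect_holds; exact: uniq_queens_ev.
rewrite sumr_const -[leRHS]mulr_natl; apply: ler_wpM2r; first by rewrite exprn_ge0 // invr_ge0.
rewrite lerBlDr -natrD ler_nat.
have := fine_count u2 u3 hsol hr => h.
rewrite -(cardsC [set t | spread a r t]) leq_add2l; apply: leq_trans h.
by apply: subset_leq_card; apply/fintype.subsetP => t; rewrite !inE.
Qed.

End GadgetStat.

Section GoodColouring.
Variables (R : realType) (K : finComUnitRingType).
Hypothesis u2 : (2 : K) \is a GRing.unit.
Hypothesis u3 : (3 : K) \is a GRing.unit.
Hypothesis hsol : forall (c : nat) (b : K), (0 < c)%N -> (#|[set t : K | t *+ c == b]| <= c)%N.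
Variable p : nat.
Hypothesis p3 : (3 <= p)%N.
Local Notation Om := {ffun (bool * K) -> 'I_p.+1}.
Local Notation Q := (p.+1%:R : R).
Local Notation beta := (unc_mean R p).

Lemma beta01 : 0 <= beta <= 1.
Proof.
have q0 : 0 <= Q^-1 by rewrite invr_ge0.
have q1 : Q^-1 <= 4^-1 by rewrite lef_pV2 ?posrE // ler_nat.
have h : Q^-1 ^+ 4 <= 4^-1 ^+ 4 by apply: lerXn2r => //; rewrite nnegrE invr_ge0.
have h0 : 0 <= Q^-1 ^+ 4 by exact: exprn_ge0.
have e : 4^-1 ^+ 4 = 256^-1 :> R by field.
by move: h h0; rewrite /unc_mean e; move: (Q^-1 ^+ 4) => y h h0; apply/andP; split; lra.
Qed.

Definition kappa : nat := (96 + gad_hits)%N.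

(** One colouring must serve all 4n lines and all n^6 choices of a queen with its four ends; both
    statistics are put into one family, so that one union bound over 2n cells suffices. *)
Lemma good_colouring (lam t : R) : 0 < lam -> lam * kappa%:R <= 2^-1 ->
  (4 * #|K| + #|K| ^ 6)%N%:R * 2 * expR ((2 * #|K|)%N%:R * (2 * lam ^+ 2 * kappa%:R ^+ 2)) < expR (lam * t) ->
  exists u : Om, (forall v, v.2 != 0 ->
      `|degree_stat R v u - #|K|%:R * beta ^+ 3| <= t + special_bound%:R)
    /\ (forall a r, rooted a r -> (#|K|%:R - gad_bound%:R) * Q^-1 ^+ 512 - t <=
       #|[set s | spread a r s && all (approved (in_tri u) (in_two u)) (gad_neg a r s)]|%:R).
Proof.
move=> l0 lk hb.
pose I : finType := (('I_4 * K) + ((K * K) * (K * K * K * K)))%type.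
pose F (i : I) (u : Om) : R := match i with inl v => degree_stat R v u | inr ar => gadget_stat R ar.1 ar.2 u end.
have hF i : bounded_diff kappa%:R (F i).
  case: i => [v|[a r]] /=.
    move=> w k c; apply: le_trans (bounded_diff_stat R u2 u3 p3 v w k c) _.
    by rewrite ler_nat leq_addr.
  move=> w k c; apply: le_trans (bounded_diff_gstat R u2 u3 hsol a r w k c) _.
  by rewrite ler_nat leq_addl.
pose w : Om := [ffun=> ord0].
have [u hu] : exists u, forall i, `|F i u - expect (enum {: bool * K}) (F i) w| <= t.
  apply: (concentrated _ hF l0 lk).
  rewrite -cardE card_prod card_bool card_sum !card_prod card_ord.
  rewrite (_ : (#|K| * #|K| * (#|K| * #|K| * #|K| * #|K|) = #|K| ^ 6)%N) //.
  by rewrite !expnS expn0 muln1 !mulnA.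
exists u; split => [v v0|a r hr].
  have h1 := hu (inl v); have h2 := mean_stat u2 u3 hsol p3 w v0 beta01.
  rewrite /= in h1.
  rewrite -(subrKA (expect (enum {: bool * K}) (degree_stat R v) w)).
  by apply: le_trans (ler_normD _ _) _; apply: lerD.
have h1 := hu (inr (a, r)); have h2 := mean_gstat R u2 u3 hsol w hr; rewrite /= in h1.
apply: le_trans (gstat_le R a r u).
rewrite lerBlDr; apply: le_trans h2 _.
by move: h1; rewrite ler_norml => /andP[h3 _]; move: h3; rewrite lerBrDr addrC lerBlDr.
Qed.

End GoodColouring.

(** * The lower bound *)

Section Factorial.
Variable R : realType.

Lemma fact_ge (n : nat) : n%:R ^+ n * expR (- n%:R) <= n`!%:R :> R.
Proof.
elim: n => [|n IH]; first by rewrite expr0 oppr0 expR0 mul1r fact0.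
rewrite factS natrM exprS -mulrA ler_pM2l ?ltr0n //; apply: le_trans IH.
case: n => [|n].
  by rewrite !expr0 !mul1r ler_expR oppr0 oppr_le0.
set x : R := n.+1%:R; have x0 : 0 < x by rewrite ltr0n.
have h : (x + 1) ^+ n.+1 <= x ^+ n.+1 * expR 1.
  have -> : x + 1 = x * (1 + x^-1) by rewrite mulrDr mulr1 divff // gt_eqF.
  rewrite exprMn ler_pM2l ?exprn_gt0 //.
  have -> : expR 1 = expR x^-1 ^+ n.+1 :> R.
    by rewrite -expRM_natl -/x divff // gt_eqF.
  by apply: lerXn2r; rewrite ?nnegrE ?expR_ge1Dx ?expR_ge0 // addr_ge0 // invr_ge0 ltW.
rewrite -[n.+2%:R]natr1 -/x opprD expRD mulrCA [leRHS]mulrC ler_pM2l ?expR_gt0 //.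
by rewrite expRN ler_pdivrMr ?expR_gt0.
Qed.

End Factorial.

Section Lower.
Variables (R : realType) (K : finComUnitRingType).
Hypothesis u2 : (2 : K) \is a GRing.unit.
Hypothesis u3 : (3 : K) \is a GRing.unit.
Hypothesis hsol : forall (c : nat) (b : K), (0 < c)%N -> (#|[set t : K | t *+ c == b]| <= c)%N.
Hypothesis bigK : (100 < #|K|)%N.
Variable l : nat.
Hypothesis hcyc : forall x : K, exists2 k : nat, (k < 2 ^ l)%N & x = k%:R.
Variable p : nat.
Hypothesis p3 : (3 <= p)%N.
Variable u : {ffun (bool * K) -> 'I_p.+1}.
Variable Y : nat.
Hypothesis hY : forall a r, rooted a r ->
  (Y <= #|[set t | spread a r t && all (approved (in_tri u) (in_two u)) (gad_neg a r t)]|)%N.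
Variables (mu Tt del0 lam eta : R) (m : nat).
Hypothesis hst : forall v : 'I_4 * K, v.2 != 0 -> `|degree_stat R v u - mu| <= Tt.
Local Notation n := (#|K|%:R : R).
Let D := mu - Tt.
Hypothesis m100 : 100 <= m%:R :> R.
Hypothesis mD : m%:R <= D.
Hypothesis del0_gt0 : 0 < del0.
Hypothesis lam0 : 0 < lam.
Hypothesis hT : 4 * Tt <= del0 * D.
Hypothesis hdel : del0 * (n / m%:R) ^+ 10 <= eta.
Hypothesis heta : eta <= 100^-1.
Hypothesis hsmall : 25 / m%:R + 4 / (D * (m%:R / n) ^+ 3) <= del0.
Hypothesis hlam1 : 16 * lam <= D * (m%:R / n) ^+ 3.
Hypothesis hlam2 : 128 * lam <= del0 * D ^+ 2 / n.
Hypothesis hPhi : 8 * n * expR (lam * (- (del0 / 2))) <= 2^-1.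
Hypothesis hm : (2 * m + 3 < #|K|)%N.
Hypothesis hYm : (gad_coord_bound * (8 * (32 * (m.+1 * (400 * l + 400)))) < Y)%N.

(** The number of runs is at least ((1-eta)D)^k P (P/n0^k)^3 / 2 with P = n0!/m!. Dividing by k! <=
    P passes from runs to packings, and P >= n0^k e^-n0 turns the cube into e^(-3n). *)
Lemma lower_count : exists k : nat, [/\ (k <= #|K|)%N, n - k%:R <= n - D + m%:R
  & expR (- (3 * n)) / 2 * ((1 - eta) * D) ^+ k <= #|conf K|%:R * n ^+ (#|K| - k)].
Proof.
have [n0 bal hn0] := balanced_uncovered u2 u3 p3 u.
have m0 : 0 < m%:R :> R by have := m100; lra.
have D0 : 0 < D by apply: lt_le_trans mD.
have hV v : v.2 != 0 -> D <= degree_stat R v u <= D + 2 * Tt.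
  by move=> /hst; rewrite ler_norml /D => /andP[h1 h2]; apply/andP; split; lra.
have Tt0 : 0 <= Tt by apply: le_trans (hst (v := (ord0, 1)) (oner_neq0 _)).
have Dn0 : D <= n0%:R.
  have /andP[h _] := hV (ord0, 1) (oner_neq0 _); apply: le_trans h _.
  by rewrite -(bal (lift ord0 ord0)); apply: stat_slice.
have n0n : (n0 <= #|K|)%N by rewrite -hn0 leq_addl.
have n0n' : n0%:R <= n by rewrite ler_nat.
have n00 : 0 < n0%:R :> R by exact: lt_le_trans Dn0.
have nn0 : 0 < n by exact: lt_le_trans n0n'.
have mn0 : m%:R <= n0%:R :> R by exact: le_trans mD Dn0.
have thm : D * (m%:R / n) ^+ 3 <= typ_deg D n0%:R m%:R.
  rewrite /typ_deg ler_pM2l //; apply: lerXn2r; rewrite ?nnegrE ?divr_ge0 //.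
  by rewrite ler_pM2l // lef_pV2 ?posrE.
have Dm0 : 0 < D * (m%:R / n) ^+ 3 by rewrite mulr_gt0 // exprn_gt0 // divr_gt0.
have delm : del del0 n0%:R m%:R <= eta.
  apply: le_trans hdel; rewrite /del ler_pM2l //; apply: lerXn2r; rewrite ?nnegrE ?divr_ge0 //.
  by apply: ler_wpM2r => //; rewrite invr_ge0 ltW.
have c1 : del del0 n0%:R m%:R <= 100^-1 by exact: le_trans delm heta.
have c2 : 25 / m%:R + 4 / typ_deg D n0%:R m%:R <= del0.
  apply: le_trans hsmall; rewrite lerD2l ler_pM2l // lef_pV2 ?posrE //.
  exact: lt_le_trans thm.
have c3 : 16 * lam <= typ_deg D n0%:R m%:R by exact: le_trans hlam1 thm.
have c4 : 128 * lam <= del0 * D ^+ 2 / n0%:R.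
  apply: le_trans hlam2 _; rewrite ler_pM2l ?lef_pV2 ?posrE //.
  by rewrite mulr_gt0 // exprn_gt0.
(* The process stops with [m] free lines of each type, few enough for [completion]. *)
pose k := (n0 - m)%N.
have mn : (m <= n0)%N by rewrite -(ler_nat R).
have kE : (n0 - k = m)%N by rewrite /k subKn.
have kn0 : (k <= n0)%N by rewrite leq_subr.
(* All initial degrees lie between D and D(1 + del0/2), half the tolerance away from violating it;
   there are at most 4n lines with two terms each. *)
have hP : Phi D del0 lam n0%:R (uncovered u) n0 <= 2^-1.
  apply: le_trans hPhi; rewrite /Phi (del_n0 del0 m100 mn0).
  have thn : typ_deg D n0%:R n0%:R = D by rewrite /typ_deg divff ?gt_eqF // expr1n mulr1.
  apply: (@le_trans _ _ (\sum_(v in uncovered u) 2 * expR (lam * (- (del0 / 2))))).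
    apply: ler_sum => v vV; rewrite /dev thn -(stat_dg R u2 u3 p3 vV).
    have v0 : v.2 != 0 by move: vV; rewrite (uncovered_unc u2 u3) => /andP[].
    have /andP[h1 h2] := hV v v0.
    have h3 : 1 <= degree_stat R v u / D by rewrite ler_pdivlMr // mul1r.
    have h4 : degree_stat R v u / D <= 1 + del0 / 2.
      by rewrite ler_pdivrMr // mulrDl mul1r; have := hT; lra.
    rewrite [leRHS]mulr_natl mulr2n; apply: lerD; rewrite ler_expR ler_pM2l //; lra.
  rewrite sumr_const -[leLHS]mulr_natl mulrA ler_pM2r ?expR_gt0 // mulrC.
  rewrite -[8]/((2 * 4)%N%:R) natrM -mulrA ler_pM2l // -natrM ler_nat.
  by apply: leq_trans (max_card _) _; rewrite card_prod card_ord.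
have hlow := @greedy_count_lower K u2 R D del0 lam n0%:R m%:R m100 mn0 D0 Dn0 del0_gt0 lam0 c1 c2 c3 c4
  k n0 (uncovered u) eta bal.
rewrite kE lexx in hlow; have {}hlow := hlow erefl kn0 (lexx _) delm.
have e1 : eta <= 1 by have := heta; lra.
have {}hlow := hlow e1.
exists k; split; first exact: leq_trans n0n.
  by rewrite natrB //; move: Dn0; lra.
have hpk := greedy_count_packings k (uncovered u).
have hpc : (#|packings k (uncovered u)| <= #|conf K| * #|K| ^ (#|K| - k))%N.
  apply: extend_count; first exact: leq_trans n0n.
    by move=> M; rewrite inE => /andP[/eqP].
  by apply: (packing_extends u2 u3 hsol bigK hcyc p3 hY hn0 _ hm hYm); rewrite subnK.
(* The product of the numbers of free lines along the run. *)
pose P := (\prod_(m <= i < n0) i.+1)%N.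
have PE : (P * m`! = n0`!)%N.
  rewrite /P -(subnK mn) addnC; elim: (n0 - m)%N => [|d IH].
    by rewrite addn0 big_geq // mul1n.
  by rewrite addnS big_nat_recr ?leq_addr //= mulnAC IH factS mulnC.
have Pk : (k`! <= P)%N.
  rewrite /P /k -{2}(subnK mn) addnC; elim: (n0 - m)%N => [|d IH].
    by rewrite addn0 big_geq.
  by rewrite addnS big_nat_recr ?leq_addr //= factS mulnC leq_mul // ltnS leq_addl.
have PR : n0%:R ^+ k * expR (- n0%:R) <= P%:R :> R.
  have h1 : P%:R * m`!%:R = n0`!%:R :> R by rewrite -natrM PE.
  have h2 : m`!%:R <= n0%:R ^+ m :> R.
    rewrite -natrX ler_nat; clear -mn; elim: m mn => // d IH hd.
    by rewrite factS expnS leq_mul // IH // ltnW.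
  have h3 := fact_ge R n0; rewrite -h1 in h3.
  have nm0 : 0 < n0%:R ^+ m :> R by exact: exprn_gt0.
  rewrite -(ler_pM2r nm0); apply: le_trans (le_trans h3 _).
    by rewrite mulrAC -exprD /k subnK.
  by rewrite ler_wpM2l.
have hprod : \prod_(m <= i < n0) ((1 - eta) * i.+1%:R * typ_deg D n0%:R i.+1%:R)
    = ((1 - eta) * D) ^+ k * (P%:R * (P%:R / n0%:R ^+ k) ^+ 3).
  have h d : \prod_(m <= i < m + d) ((1 - eta) * i.+1%:R * typ_deg D n0%:R i.+1%:R)
     = ((1 - eta) * D) ^+ d * ((\prod_(m <= i < m + d) i.+1)%N%:R *
       ((\prod_(m <= i < m + d) i.+1)%N%:R / n0%:R ^+ d) ^+ 3).
    elim: d => [|d IH]; first by rewrite addn0 !big_geq // !expr0 mul1r divr1 expr1n mulr1.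
    rewrite addnS !big_nat_recr ?leq_addr //= IH natrM /typ_deg !exprS expr0.
    by field; rewrite expf_neq0 gt_eqF // n00.
  have mk : (m + k)%N = n0 by rewrite /k addnC subnK.
  by have := h k; rewrite mk.
have P0 : 0 < P%:R :> R by apply: lt_le_trans PR; rewrite mulr_gt0 ?expR_gt0 ?exprn_gt0.
have A0 : 0 <= ((1 - eta) * D) ^+ k.
  by apply: exprn_ge0; apply: mulr_ge0; [rewrite subr_ge0 | exact: ltW].
have hX : expR (- n) <= P%:R / n0%:R ^+ k.
  rewrite ler_pdivlMr ?exprn_gt0 // mulrC; apply: le_trans PR.
  by rewrite ler_pM2l ?exprn_gt0 // ler_expR lerN2.
have hX3 : expR (- (3 * n)) <= (P%:R / n0%:R ^+ k) ^+ 3.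
  have -> : expR (- (3 * n)) = expR (- n) ^+ 3 by rewrite -expRM_natl mulrN.
  by apply: lerXn2r; rewrite ?nnegrE ?expR_ge0 // divr_ge0 // ltW // exprn_gt0.
have hq : (greedy_count k (uncovered u))%:R <= P%:R * (#|conf K|%:R * n ^+ (#|K| - k)).
  rewrite -natrX -!natrM ler_nat; apply: leq_trans hpk _.
  by apply: leq_mul.
have {hlow}h := le_trans hlow hq; rewrite hprod in h.
rewrite -(ler_pM2l P0); apply: le_trans h.
set B := (_ / _) ^+ 3 in hX3 *; set A := _ ^+ k in A0 *.
have -> : P%:R * (expR (- (3 * n)) / 2 * A) = (A * P%:R) * (expR (- (3 * n)) * 2^-1) by ring.
have -> : forall z, A * (P%:R * B) * z = (A * P%:R) * (B * z) by move=> z; ring.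
apply: ler_wpM2l; first by apply: mulr_ge0 => //; exact: ltW.
apply: ler_pM => //; rewrite ?expR_ge0 ?invr_ge0 //; move: hP; lra.
Qed.

End Lower.

(** * Choice of the scales *)

Section NumericChoices.
Variables (R : realType) (x s n C kap sb : R).
Hypothesis x6 : 1000 <= x.
Hypothesis xs : x ^+ 20 <= s.
Hypothesis ns : s ^+ 30 <= n.
Hypothesis nC : n <= C * s ^+ 30.
Hypothesis C1 : 1 <= C.
Hypothesis Cx : C ^+ 10 <= x.
Hypothesis kap0 : 0 <= kap.
Hypothesis kapx : kap <= x.
Hypothesis sb0 : 0 <= sb.
Hypothesis sbx : sb <= x.
Hypothesis nx : n <= expR (x / 20).

Let x0 : 0 < x. Proof. by have := x6; lra. Qed.
Let x1 : 1 <= x. Proof. by have := x6; lra. Qed.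

Lemma xpow (k : nat) : (k <= 20)%N -> x ^+ k <= s.
Proof. by move=> h; apply: le_trans xs; apply: ler_weXn2l. Qed.

Let s0 : 0 < s. Proof. by apply: lt_le_trans (xpow (isT : (0 <= 20)%N)); rewrite expr0. Qed.
Let s1 : 1 <= s. Proof. by have := xpow (isT : (0 <= 20)%N); rewrite expr0. Qed.
Let xs1 : x <= s. Proof. by have := xpow (isT : (1 <= 20)%N); rewrite expr1. Qed.
Let n0 : 0 < n. Proof. by apply: lt_le_trans ns; rewrite exprn_gt0. Qed.

Lemma absorb_s (c : R) (i j : nat) : c <= s -> (i < j)%N -> c * s ^+ i <= s ^+ j.
Proof.
move=> cs ij; apply: (@le_trans _ _ (s ^+ i.+1)); last exact: ler_weXn2l.
by rewrite exprS ler_wpM2r // exprn_ge0 // ltW.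
Qed.

Lemma absorb_x (c : R) (k : nat) : 0 <= c -> c <= x -> (k < 20)%N -> c * x ^+ k <= s.
Proof.
move=> c0 cx hk; apply: le_trans (xpow hk); rewrite exprS.
by rewrite ler_wpM2r // exprn_ge0 // ltW.
Qed.

(** The lower end of the range of degrees, whose random error is s^17. The other scales: stopping at
    s^29 free lines, initial tolerance s^-11 (still at most 1/x after growing by the factor
    (n/s^29)^10), potential parameter s^12, concentration parameter s^-14. *)
Definition dens : R := n * (1 - 4 * x^-1 ^+ 4) ^+ 3 - (s ^+ 17 + sb).

Lemma dens_ge : n - dens + s ^+ 29 <= n / x ^+ 3.
Proof.
pose y := x^-1 ^+ 4; have y0 : 0 <= y by rewrite exprn_ge0 // invr_ge0 ltW.
have y1 : y <= 100^-1.
  apply: (@le_trans _ _ x^-1); last by rewrite lef_pV2 ?posrE //; have := x6; lra.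
  rewrite /y exprS -[leRHS]mulr1; apply: ler_wpM2l; first by rewrite invr_ge0 ltW.
  by apply: exprn_ile1; rewrite ?invr_ge0 ?(ltW x0) // invf_le1.
have b3 : 1 - 12 * y <= (1 - 4 * y) ^+ 3.
  have -> : (1 - 4 * y) ^+ 3 = 1 - 12 * y + y ^+ 2 * (48 - 64 * y) by ring.
  by rewrite lerDl mulr_ge0 ?sqr_ge0 //; lra.
have h1 : n * (1 - 12 * y) <= n * (1 - 4 * y) ^+ 3 by rewrite ler_pM2l.
have h2 : 12 * y * n <= n / x ^+ 3 / 2.
  have -> : 12 * y * n = n / x ^+ 3 * (12 / x) by rewrite /y; field; rewrite gt_eqF.
  apply: ler_wpM2l; first by rewrite divr_ge0 ?exprn_ge0 ?ltW.
  by rewrite ler_pdivrMr //; have := x6; lra.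
have h3 : s ^+ 17 + sb + s ^+ 29 <= 3 * s ^+ 29.
  have a1 : s ^+ 17 <= s ^+ 29 by apply: ler_weXn2l.
  have a2 : s <= s ^+ 29 by rewrite -{1}[s]expr1; apply: ler_weXn2l.
  by have := sbx; have := xs1; lra.
have h4 : 6 * x ^+ 3 * s ^+ 29 <= n.
  apply: le_trans ns; apply: absorb_s => //; apply: absorb_x => //; have := x6; lra.
have h5 : 3 * s ^+ 29 <= n / x ^+ 3 / 2.
  rewrite !ler_pdivlMr ?exprn_gt0 //; move: h4; set a := s ^+ 29; set b := x ^+ 3 => h4.
  by have -> : 3 * a * 2 * b = 6 * b * a by ring.
rewrite /dens -/y; move: h1 h2 h3 h5; rewrite mulrBr mulr1.
move: (n * (1 - 4 * y) ^+ 3) (n / x ^+ 3) => a b; move: (s ^+ 17) (s ^+ 29) => c d.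
have -> : n * (12 * y) = 12 * y * n by ring.
move: (12 * y * n) => e; lra.
Qed.

Lemma dens_ge1 : (1 - x^-1) * n <= dens.
Proof.
have h := dens_ge.
have h2 : n / x ^+ 3 <= x^-1 * n.
  rewrite mulrC ler_pM2r // lef_pV2 ?posrE ?exprn_gt0 //.
  by rewrite -[leLHS]expr1; apply: ler_weXn2l.
have h3 : 0 <= s ^+ 29 by rewrite exprn_ge0 // ltW.
rewrite mulrBl mul1r; move: h h2 h3; move: (n / _) (x^-1 * n) (s ^+ 29) => a b c; lra.
Qed.

Let ix : x^-1 <= 100^-1. Proof. by rewrite lef_pV2 ?posrE //; have := x6; lra. Qed.

Lemma dens_half : n / 2 <= dens.
Proof.
apply: le_trans dens_ge1; rewrite mulrC; apply: ler_wpM2r; first exact: ltW.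
by have := ix; lra.
Qed.

Let Cs : forall k, (k <= 10)%N -> C ^+ k <= x.
Proof. by move=> k hk; apply: le_trans Cx; apply: ler_weXn2l. Qed.

Lemma dens_m : s ^+ 29 <= dens.
Proof.
apply: le_trans dens_half; rewrite ler_pdivlMr // mulrC; apply: le_trans ns.
by apply: absorb_s => //; have := xs1; have := x6; lra.
Qed.

Lemma dens_T : 4 * (s ^+ 17 + sb) <= s^-1 ^+ 11 * dens.
Proof.
apply: (@le_trans _ _ (s^-1 ^+ 11 * (s ^+ 30 / 2))); last first.
  apply: ler_wpM2l; first by rewrite exprn_ge0 // invr_ge0 ltW.
  by apply: le_trans dens_half; rewrite ler_pM2r ?invr_gt0.
have -> : s^-1 ^+ 11 * (s ^+ 30 / 2) = s ^+ 19 / 2 by field; rewrite gt_eqF.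
rewrite ler_pdivlMr //.
have a1 : 16 * s ^+ 17 <= s ^+ 19 by apply: absorb_s => //; have := xs1; have := x6; lra.
have a2 : s <= s ^+ 17 by rewrite -{1}[s]expr1; apply: ler_weXn2l.
have := sbx; have := xs1; move: a1 a2; move: (s ^+ 17) (s ^+ 19) => a b; lra.
Qed.

Lemma del_ok : s^-1 ^+ 11 * (n / s ^+ 29) ^+ 10 <= x^-1.
Proof.
have h : n / s ^+ 29 <= C * s.
  by rewrite ler_pdivrMr ?exprn_gt0 // -mulrA -exprS.
apply: (@le_trans _ _ (s^-1 ^+ 11 * (C * s) ^+ 10)).
  apply: ler_wpM2l; first by rewrite exprn_ge0 // invr_ge0 ltW.
  apply: lerXn2r => //; rewrite nnegrE; first by rewrite divr_ge0 ?exprn_ge0 ?ltW.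
  by rewrite mulr_ge0 ?(ltW s0) // (le_trans _ C1).
have -> : s^-1 ^+ 11 * (C * s) ^+ 10 = C ^+ 10 / s by field; rewrite gt_eqF.
rewrite ler_pdivrMr // mulrC ler_pdivlMr //.
apply: (@le_trans _ _ (x * x ^+ 1)); last by apply: absorb_x; rewrite // ltW.
by rewrite expr1 ler_wpM2r // ltW.
Qed.

Lemma cube_ok : 2 * s ^+ 25 <= dens * (s ^+ 29 / n) ^+ 3.
Proof.
have h : s ^+ 29 / (C * s ^+ 30) <= s ^+ 29 / n.
  rewrite ler_pM2l ?exprn_gt0 // lef_pV2 ?posrE //.
  by apply: lt_le_trans nC.
have C0 : 0 < C by apply: lt_le_trans C1.
have e : s ^+ 29 / (C * s ^+ 30) = (C * s)^-1 by field; rewrite !gt_eqF.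
apply: (@le_trans _ _ (s ^+ 30 / 2 * (C * s)^-1 ^+ 3)).
  have -> : s ^+ 30 / 2 * (C * s)^-1 ^+ 3 = s ^+ 27 / (2 * C ^+ 3) by field; rewrite !gt_eqF.
  rewrite ler_pdivlMr; last by rewrite mulr_gt0 // exprn_gt0.
  have -> : 2 * s ^+ 25 * (2 * C ^+ 3) = (4 * C ^+ 3) * s ^+ 25 by ring.
  apply: absorb_s => //; apply: (@le_trans _ _ (4 * x ^+ 1)); last by apply: absorb_x => //; have := x6; lra.
  by rewrite ler_wpM2l // expr1; exact: Cs.
apply: ler_pM.
- by rewrite divr_ge0 // exprn_ge0 // ltW.
- by rewrite exprn_ge0 // invr_ge0 mulr_ge0 // ltW.
- by apply: le_trans dens_half; rewrite ler_pM2r ?invr_gt0.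
- apply: lerXn2r; rewrite -?e ?nnegrE //; last by rewrite divr_ge0 ?exprn_ge0 ?ltW.
  by rewrite e invr_ge0 mulr_ge0 // ltW.
Qed.

Lemma small_ok : 25 / s ^+ 29 + 4 / (dens * (s ^+ 29 / n) ^+ 3) <= s^-1 ^+ 11.
Proof.
have h := cube_ok; have p25 : 0 < s ^+ 25 by rewrite exprn_gt0.
apply: (@le_trans _ _ (25 / s ^+ 29 + 4 / (2 * s ^+ 25))).
  have h0 : 0 < 2 * s ^+ 25 by rewrite mulr_gt0.
  by rewrite lerD2l ler_pM2l // lef_pV2 ?posrE // (lt_le_trans h0 h).
have -> : 25 / s ^+ 29 + 4 / (2 * s ^+ 25) = (25 + 2 * s ^+ 4) / s ^+ 29 by field; rewrite gt_eqF.
rewrite ler_pdivrMr ?exprn_gt0 //.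
have -> : s^-1 ^+ 11 * s ^+ 29 = s ^+ 18 by field; rewrite gt_eqF.
have a1 : 27 * s ^+ 4 <= s ^+ 18 by apply: absorb_s => //; have := xs1; have := x6; lra.
have a2 : 1 <= s ^+ 4 by exact: exprn_ege1.
move: a1 a2; move: (s ^+ 4) (s ^+ 18) => a b; lra.
Qed.

Lemma lam1_ok : 16 * s ^+ 12 <= dens * (s ^+ 29 / n) ^+ 3.
Proof.
apply: le_trans cube_ok; apply: (@le_trans _ _ (s ^+ 25)).
  by apply: absorb_s => //; have := xs1; have := x6; lra.
by have : 0 < s ^+ 25 by [rewrite exprn_gt0]; move: (s ^+ 25) => a; lra.
Qed.

Lemma lam2_ok : 128 * s ^+ 12 <= s^-1 ^+ 11 * dens ^+ 2 / n.
Proof.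
have h : n / 4 <= dens ^+ 2 / n.
  rewrite ler_pdivlMr //.
  have -> : n / 4 * n = (n / 2) ^+ 2 by field.
  apply: lerXn2r; rewrite ?nnegrE; [by rewrite divr_ge0 // ltW | | exact: dens_half].
  by apply: le_trans dens_half; rewrite divr_ge0 // ltW.
rewrite -mulrA; apply: (@le_trans _ _ (s^-1 ^+ 11 * (s ^+ 30 / 4))); last first.
  apply: ler_wpM2l; first by rewrite exprn_ge0 // invr_ge0 ltW.
  by apply: le_trans h; rewrite ler_pM2r ?invr_gt0.
have -> : s^-1 ^+ 11 * (s ^+ 30 / 4) = s ^+ 19 / 4 by field; rewrite gt_eqF.
rewrite ler_pdivlMr // mulrAC -natrM.
by apply: absorb_s => //; have := xs1; have := x6; lra.
Qed.

Lemma exp_16 : 16 <= expR 16 :> R.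
Proof. by apply: le_trans (expR_ge1Dx _); lra. Qed.

(** The potential parameter times the tolerance is s^12 s^-11 = s, well above log n. *)
Lemma phi_ok : 8 * n * expR (s ^+ 12 * (- (s^-1 ^+ 11 / 2))) <= 2^-1.
Proof.
have -> : s ^+ 12 * (- (s^-1 ^+ 11 / 2)) = - (s / 2) by field; rewrite gt_eqF.
rewrite expRN ler_pdivrMr ?expR_gt0 //.
have h : 16 * n <= expR (s / 2).
  apply: (@le_trans _ _ (expR 16 * expR (x / 20))).
    by apply: ler_pM => //; [exact: ltW | exact: exp_16].
  by rewrite -expRD ler_expR; have := xs1; have := x6; lra.
move: h; move: (expR _) => a; lra.
Qed.

Lemma nu_ok : s^-1 ^+ 14 * kap <= 2^-1.
Proof.
have a : s^-1 ^+ 14 * kap <= s^-1 ^+ 14 * s.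
  by apply: ler_wpM2l; [rewrite exprn_ge0 // invr_ge0 ltW | apply: le_trans xs1].
apply: le_trans a _; have -> : s^-1 ^+ 14 * s = (s ^+ 13)^-1 by field; rewrite gt_eqF.
rewrite lef_pV2 ?posrE ?exprn_gt0 //; apply: (@le_trans _ _ s); first by have := xs1; have := x6; lra.
by rewrite -{1}[s]expr1; apply: ler_weXn2l.
Qed.

(** The right exponent is s^3, while the variance term n s^-28 has only the order of s^2, with
    factors that are powers of x. *)
Lemma union_ok : (4 * n + n ^+ 6) * 2 * expR (2 * n * (2 * s^-1 ^+ 14 ^+ 2 * kap ^+ 2))
  < expR (s^-1 ^+ 14 * s ^+ 17).
Proof.
have -> : s^-1 ^+ 14 * s ^+ 17 = s ^+ 3 by field; rewrite gt_eqF.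
have n1 : 1 <= n by apply: le_trans ns; exact: exprn_ege1.
have a1 : (4 * n + n ^+ 6) * 2 <= expR (16 + x).
  have b1 : n <= n ^+ 6 by rewrite -{1}[n]expr1; apply: ler_weXn2l.
  apply: (@le_trans _ _ (16 * n ^+ 6)); first by move: b1; move: (n ^+ 6) => a; have := n1; lra.
  rewrite expRD; apply: ler_pM => //; [by rewrite exprn_ge0 // ltW | exact: exp_16 |].
  apply: (@le_trans _ _ (expR (x / 20) ^+ 6)).
    by apply: lerXn2r; rewrite ?nnegrE ?expR_ge0 // ltW.
  by rewrite -expRM_natl ler_expR; have := x0; lra.
have a2 : 2 * n * (2 * s^-1 ^+ 14 ^+ 2 * kap ^+ 2) <= s ^+ 2 * (4 * x ^+ 3).
  apply: (@le_trans _ _ (2 * (C * s ^+ 30) * (2 * s^-1 ^+ 14 ^+ 2 * x ^+ 2))).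
    apply: ler_pM.
    - by rewrite mulr_ge0 // ltW.
    - by rewrite mulr_ge0 ?sqr_ge0 // mulr_ge0 // sqr_ge0.
    - by rewrite ler_pM2l.
    - apply: ler_wpM2l; first by rewrite mulr_ge0 // sqr_ge0.
      by apply: lerXn2r; rewrite ?nnegrE // ltW.
  have -> : 2 * (C * s ^+ 30) * (2 * s^-1 ^+ 14 ^+ 2 * x ^+ 2) = s ^+ 2 * (4 * (C * x ^+ 2)).
    by field; rewrite gt_eqF.
  apply: ler_wpM2l; first exact: sqr_ge0.
  rewrite ler_pM2l // [x ^+ 3]exprS; apply: ler_wpM2r; first exact: sqr_ge0.
  by have := Cs (isT : (1 <= 10)%N); rewrite expr1.
apply: (@le_lt_trans _ _ (expR (16 + x) * expR (s ^+ 2 * (4 * x ^+ 3)))).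
  by apply: ler_pM; rewrite ?expR_ge0 ?ler_expR // mulr_ge0 // addr_ge0 ?mulr_ge0 ?exprn_ge0 ?(ltW n0).
rewrite -expRD ltr_expR.
have b1 : 2 * (4 * x ^+ 3) <= s.
  rewrite mulrA -natrM; apply: absorb_x => //; have := x6; lra.
have b2 : s ^+ 2 * (2 * (4 * x ^+ 3)) <= s ^+ 2 * s by apply: ler_wpM2l => //; exact: sqr_ge0.
have b3 : 100 * s <= s ^+ 2 * s.
  apply: ler_wpM2r; first exact: ltW.
  have : s * 1 <= s * s by rewrite ler_pM2l.
  by rewrite expr2; have := xs1; have := x6; lra.
rewrite [s ^+ 3]exprSr; move: b2 b3; rewrite [s ^+ 2 * (2 * _)]mulrCA.
move: (s ^+ 2 * (4 * x ^+ 3)) (s ^+ 2 * s) => a b; have := xs1; have := x6; lra.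
Qed.

End NumericChoices.

Section LowerBound.
Variables (R : realType) (K : finComUnitRingType).
Hypothesis u2 : (2 : K) \is a GRing.unit.
Hypothesis u3 : (3 : K) \is a GRing.unit.
Hypothesis hsol : forall (c : nat) (b : K), (0 < c)%N -> (#|[set t : K | t *+ c == b]| <= c)%N.
Variables (l p : nat) (C : R).
Hypothesis hcyc : forall x : K, exists2 k : nat, (k < 2 ^ l)%N & x = k%:R.
Hypothesis hl : (2 ^ l <= 2 * #|K|)%N.
Variables x s : R.
Hypothesis xE : x = p.+1%:R.
Hypothesis sE : s = x ^+ 600.
Local Notation n := (#|K|%:R : R).
Hypothesis x6 : 1000 <= x.
Hypothesis ns : s ^+ 30 <= n.
Hypothesis nC : n <= C * s ^+ 30.
Hypothesis C1 : 1 <= C.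
Hypothesis Cx : C ^+ 10 <= x.
Hypothesis kapx : kappa%:R <= x.
Hypothesis sbx : special_bound%:R <= x.
Hypothesis gbx : gad_bound%:R <= x.
Hypothesis gcbx : gad_coord_bound%:R <= x.
Hypothesis nx : n <= expR (x / 20).

Let x0 : 0 < x. Proof. by have := x6; lra. Qed.
Let x1 : 1 <= x. Proof. by have := x6; lra. Qed.
Let xk k : (k <= 600)%N -> x ^+ k <= s. Proof. by rewrite sE => h; apply: ler_weXn2l. Qed.
Let xs : x ^+ 20 <= s. Proof. exact: xk. Qed.
Let s1 : 1 <= s. Proof. by rewrite sE; exact: exprn_ege1. Qed.
Let s0 : 0 < s. Proof. exact: lt_le_trans s1. Qed.
Let n0 : 0 < n. Proof. by apply: lt_le_trans ns; rewrite exprn_gt0. Qed.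

Let xles : x <= s.
Proof. by rewrite -[leLHS]expr1; apply: xk. Qed.

Let s29n : 6 * s ^+ 29 <= n.
Proof.
apply: le_trans ns; rewrite [s ^+ 30]exprS; apply: ler_wpM2r; first by rewrite exprn_ge0 // ltW.
by apply: le_trans xles; have := x6; lra.
Qed.

Lemma two_le_expR1 : 2 <= expR 1 :> R.
Proof. by have := expR_ge1Dx (1 : R); lra. Qed.

Lemma log_le : l%:R <= x.
Proof.
have half2 : expR (2^-1) <= 2 :> R.
  have := expR_ge1Dx (- 2^-1 : R); rewrite expRN => h.
  have e0 := expR_gt0 (2^-1 : R).
  by rewrite -[leRHS]invrK -[leLHS]invrK lef_pV2 ?posrE ?invr_gt0 //; lra.
have h1 : expR (2^-1 * l%:R) <= 2 * n.
  rewrite mulrC expRM_natl; apply: (@le_trans _ _ (2 ^+ l)).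
    by apply: lerXn2r; rewrite ?nnegrE ?expR_ge0.
  by rewrite -natrX -natrM ler_nat.
have h2 : 2 * n <= expR (1 + x / 20).
  by rewrite expRD; apply: ler_pM => //; exact: two_le_expR1.
by have := le_trans h1 h2; rewrite ler_expR; have := x6; lra.
Qed.

Let m := ((p.+1 ^ 600) ^ 29)%N.
Let mE : m%:R = s ^+ 29 :> R. Proof. by rewrite /m !natrX -xE -sE. Qed.

Let Y := (gad_coord_bound * (8 * (32 * (m.+1 * (400 * l + 400))))).+1.

(** This fixes the exponent 600 in s. About x^5 s^29 gadget parameters are demanded and n x^-512 / 2
    are supplied, with n at least s^30; it is enough that s exceeds x^519. *)
Lemma Y_le : Y%:R <= (n - gad_bound%:R) * x^-1 ^+ 512 - s ^+ 17.
Proof.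
have S0 : 1 <= s ^+ 29 by exact: exprn_ege1.
have h1 : Y%:R <= x ^+ 5 * s ^+ 29.
  rewrite /Y -(addn1 (gad_coord_bound * _)) natrD (natrM _ gad_coord_bound).
  rewrite (natrM _ 8) (natrM _ 32) (natrM _ m.+1) -(addn1 m) natrD mE.
  have : (400 * l + 400)%N%:R <= x ^+ 2.
    rewrite natrD natrM; have := log_le; have := x6 => b1 b2.
    have : x * 1000 <= x * x by rewrite ler_pM2l.
    rewrite expr2; move: (x * x) (l%:R) b1 b2 => w z; lra.
  have : 0 <= (400 * l + 400)%N%:R :> R by exact: ler0n.
  move: (_%:R) => a a0 a1.
  have a2 : (s ^+ 29 + 1) * a <= (2 * s ^+ 29) * x ^+ 2.
    by apply: ler_pM => //; move: S0; move: (s ^+ 29) => w; lra.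
  have a20 : 0 <= (s ^+ 29 + 1) * a.
    by apply: mulr_ge0 => //; move: S0; move: (s ^+ 29) => w; lra.
  move: ((s ^+ 29 + 1) * a) a2 a20 => b a2 a20.
  have c0 : 0 <= 8 * 32 :> R by rewrite mulr_ge0 ?ler0n.
  have c1 : 8 * 32 <= x by have := x6; lra.
  have c2 := ler_pM c0 a20 c1 a2; rewrite -[8 * 32 * b]mulrA in c2.
  have c3 : 0 <= 8 * (32 * b) by rewrite mulr_ge0 ?ler0n // mulr_ge0 ?ler0n.
  have a3 := ler_pM (ler0n R gad_coord_bound) c3 gcbx c2.
  apply: le_trans (lerD a3 (lexx 1)) _.
  have -> : x * (x * (2 * s ^+ 29 * x ^+ 2)) = 2 * (x ^+ 4 * s ^+ 29) by ring.
  rewrite [x ^+ 5]exprS -mulrA.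
  have : 1 <= x ^+ 4 * s ^+ 29 by rewrite mulr_ege1 // exprn_ege1.
  move: (x ^+ 4 * s ^+ 29) => w w1.
  have : 3 * w <= x * w by apply: ler_wpM2r; [lra | have := x6; lra].
  lra.
have h2 : x ^+ 6 * s ^+ 29 <= n / 2 * x^-1 ^+ 512.
  rewrite exprVn ler_pdivlMr ?exprn_gt0 // ler_pdivlMr //.
  apply: le_trans ns; rewrite [s ^+ 30]exprS.
  have -> : x ^+ 6 * s ^+ 29 * x ^+ 512 * 2 = (x ^+ 6 * x ^+ 512 * 2) * s ^+ 29.
    by move: (x ^+ 6) (x ^+ 512) (s ^+ 29) => a b c; ring.
  apply: ler_wpM2r; first by apply: le_trans S0.
  apply: (@le_trans _ _ (x ^+ 519)); last exact: xk.
  rewrite -exprD -[(6 + 512)%N]/518%N [x ^+ 519]exprSr.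
  apply: ler_wpM2l; first by rewrite exprn_ge0 // ltW.
  by have := x6; lra.
have h3 : n / 2 <= n - gad_bound%:R.
  have := gbx; have := xles; have : s <= s ^+ 29 by rewrite -[leLHS]expr1; apply: ler_weXn2l.
  have := s29n; have := n0; move: (s ^+ 29) (gad_bound%:R : R) (#|K|%:R : R) => w z t; have := x6; lra.
have h4 : n / 2 * x^-1 ^+ 512 <= (n - gad_bound%:R) * x^-1 ^+ 512.
  by apply: ler_wpM2r; first by rewrite exprn_ge0 // invr_ge0 ltW.
have h5 : s ^+ 17 <= s ^+ 29 by apply: ler_weXn2l.
have h6 : 2 * (x ^+ 5 * s ^+ 29) <= x ^+ 6 * s ^+ 29.
  rewrite mulrA; apply: ler_wpM2r; first by apply: le_trans S0.
  rewrite [x ^+ 6]exprS; apply: ler_wpM2r; first by rewrite exprn_ge0 // ltW.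
  by have := x6; lra.
have h7 : s ^+ 29 <= x ^+ 5 * s ^+ 29.
  by rewrite -[leLHS]mul1r; apply: ler_wpM2r; [apply: le_trans S0 | exact: exprn_ege1].
have h8 := le_trans h2 h4; have h9 := le_trans h6 h8; have h10 := le_trans h5 h7.
rewrite lerBrDr; apply: le_trans h9; rewrite mulr_natl mulr2n; exact: lerD.
Qed.

(** Of the four factors (1 - 1/x)^n, two come from (1 - eta) D >= (1 - 1/x)^2 n, one pays for
    n^(2(n-k)) <= e^(n/x), and one for the factor 1/2. One power n^(n-k) comes from [extend_count],
    the other completes the exponent k to n. *)
Lemma lower_bound : ((1 - x^-1) ^+ 4 * (n / expR 3)) ^+ #|K| <= #|conf K|%:R.
Proof.
have p3 : (3 <= p)%N by have := x6; rewrite xE ler_nat => h; rewrite -ltnS; apply: leq_trans h.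
have bE : unc_mean R p = 1 - 4 * x^-1 ^+ 4 by rewrite /unc_mean xE.
have kap0 : 0 <= kappa%:R :> R by [].
have sb0 : 0 <= special_bound%:R :> R by [].
have ex : exists u : {ffun (bool * K) -> 'I_p.+1}, (forall v, v.2 != 0 ->
      `|degree_stat R v u - n * (1 - 4 * x^-1 ^+ 4) ^+ 3| <= s ^+ 17 + special_bound%:R)
    /\ (forall a r, rooted a r -> (n - gad_bound%:R) * x^-1 ^+ 512 - s ^+ 17 <=
       #|[set s | spread a r s && all (approved (in_tri u) (in_two u)) (gad_neg a r s)]|%:R).
  rewrite -bE xE; apply: (@good_colouring R K u2 u3 hsol p p3 (s^-1 ^+ 14)).
  - by rewrite exprn_gt0 // invr_gt0.
  - exact: (nu_ok x6 xs kapx).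
  - rewrite natrD natrX !natrM.
    exact: (union_ok x6 xs ns nC C1 Cx kap0 kapx nx).
have [u [hst hg]] := ex.
have hY a r : rooted a r ->
    (Y <= #|[set t | spread a r t && all (approved (in_tri u) (in_two u)) (gad_neg a r t)]|)%N.
  by move=> /hg h; rewrite -(ler_nat R); apply: le_trans Y_le h.
have D_ge := dens_ge x6 xs ns sbx; have D_ge1 := dens_ge1 x6 xs ns sbx.
have ixs : x^-1 <= 100^-1 by rewrite lef_pV2 ?posrE //; have := x6; lra.
have hnK : (100 < #|K|)%N.
  rewrite -(ltr_nat R); have := s29n; have : 100 <= s ^+ 29; last by move: (s ^+ 29) => w; lra.
  apply: (@le_trans _ _ s); first by apply: le_trans xles; have := x6; lra.
  by rewrite -[leLHS]expr1; apply: ler_weXn2l.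
have [|||||||||||||k [kn kD hk]] := @lower_count R K u2 u3 hsol hnK l hcyc p p3 u Y hY
  (n * (1 - 4 * x^-1 ^+ 4) ^+ 3) (s ^+ 17 + special_bound%:R) (s^-1 ^+ 11) (s ^+ 12) x^-1 m hst.
- rewrite mE; apply: (@le_trans _ _ s); first by apply: le_trans xles; have := x6; lra.
  by rewrite -[leLHS]expr1; apply: ler_weXn2l.
- by rewrite mE; exact: (dens_m x6 xs ns sbx).
- by rewrite exprn_gt0 // invr_gt0.
- by rewrite exprn_gt0.
- exact: (dens_T x6 xs ns sbx).
- by rewrite mE; exact: (del_ok x6 xs ns nC C1 Cx).
- exact: ixs.
- by rewrite mE; exact: (small_ok x6 xs ns nC C1 Cx sbx).
- by rewrite mE; exact: (lam1_ok x6 xs ns nC C1 Cx sbx).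
- exact: (lam2_ok x6 xs ns sbx).
- exact: (phi_ok x6 xs ns nx).
- rewrite -(ltr_nat R) natrD natrM mE; have := s29n.
  have : 1 <= s ^+ 29 by exact: exprn_ege1.
  by move: (s ^+ 29) => w; lra.
- by [].
set D := (n * _ ^+ 3 - _) in kD hk.
have kD' : n - k%:R <= n / x ^+ 3 by apply: le_trans kD _; rewrite mE.
set y := 1 - x^-1.
have y0 : 0 <= y by rewrite /y; lra.
have y1 : y <= 1 by rewrite /y lerBlDr lerDl invr_ge0 ltW.
have DE : y * n <= D by exact: D_ge1.
have h1 : expR (- (3 * n)) / 2 * (y ^+ 2 * n) ^+ k <= #|conf K|%:R * n ^+ (#|K| - k).
  apply: le_trans hk; apply: ler_wpM2l; first by rewrite divr_ge0 // expR_ge0.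
  apply: lerXn2r; rewrite ?nnegrE; [by rewrite mulr_ge0 ?sqr_ge0 // ltW | |].
    by rewrite mulr_ge0 // (le_trans _ DE) // mulr_ge0 // ltW.
  by rewrite expr2 -mulrA; apply: ler_wpM2l.
have nk0 : 0 < n ^+ (#|K| - k) by exact: exprn_gt0.
have h2 : expR (- (3 * n)) / 2 * (y ^+ 2) ^+ #|K| * n ^+ #|K|
    <= #|conf K|%:R * (n ^+ (#|K| - k) * n ^+ (#|K| - k)).
  rewrite [leRHS]mulrA; apply: le_trans _ (ler_wpM2r (ltW nk0) h1); 
  have -> : n ^+ #|K| = n ^+ k * n ^+ (#|K| - k) by rewrite -exprD subnKC.
  rewrite [(_ * n) ^+ k]exprMn.
  rewrite -!mulrA; apply: ler_wpM2l; first exact: expR_ge0.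
  rewrite ler_pM2l ?invr_gt0 //; apply: ler_wpM2r.
    by rewrite mulr_ge0 // exprn_ge0 // ltW.
  by rewrite -!exprM; apply: ler_wiXn2l => //; rewrite leq_mul2l kn orbT.
have h3 : n ^+ (#|K| - k) * n ^+ (#|K| - k) <= expR (n / x).
  rewrite -exprD; apply: (@le_trans _ _ (expR (x / 20) ^+ (#|K| - k + (#|K| - k)))).
    by apply: lerXn2r; rewrite ?nnegrE ?expR_ge0 // ltW.
  rewrite -expRM_natl ler_expR natrD natrB //.
  have e : n / x ^+ 3 * x ^+ 2 = n / x by field; rewrite gt_eqF.
  have x2 : x <= x ^+ 2 by rewrite -[leLHS]expr1; apply: ler_weXn2l.
  have nk : 0 <= n - k%:R by rewrite subr_ge0 ler_nat.
  rewrite -e; apply: (@le_trans _ _ ((n - k%:R) * x ^+ 2)).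
    have : (n - k%:R) * x <= (n - k%:R) * x ^+ 2 by apply: ler_wpM2l.
    have : 0 <= (n - k%:R) * x by rewrite mulr_ge0 // ltW.
    have -> : (n - k%:R + (n - k%:R)) * (x / 20) = (n - k%:R) * x / 10 by field.
    by move: ((n - k%:R) * x) ((n - k%:R) * x ^+ 2) => a b; lra.
  by apply: ler_wpM2r => //; exact: sqr_ge0.
have yn : y ^+ #|K| <= expR (- (n / x)).
  have : y <= expR (- x^-1) by have := expR_ge1Dx (- x^-1); rewrite /y.
  move=> h; apply: (@le_trans _ _ (expR (- x^-1) ^+ #|K|)).
    by apply: lerXn2r; rewrite ?nnegrE ?expR_ge0.
  by rewrite -expRM_natl mulrN.
have yhalf : y ^+ #|K| <= 2^-1.
  apply: le_trans yn _; rewrite expRN lef_pV2 ?posrE ?expR_gt0 //.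
  apply: le_trans two_le_expR1 _; rewrite ler_expR ler_pdivlMr // mul1r.
  apply: le_trans xles _; apply: (@le_trans _ _ (s ^+ 29)).
    by rewrite -[leLHS]expr1; apply: ler_weXn2l.
  by have := s29n; have : 0 < s ^+ 29 by [rewrite exprn_gt0]; move: (s ^+ 29) => w; lra.
have e0 := expR_gt0 (n / x).
have h4 : expR (- (n / x)) * (expR (- (3 * n)) / 2 * (y ^+ 2) ^+ #|K| * n ^+ #|K|) <= #|conf K|%:R.
  rewrite expRN mulrC ler_pdivrMr //; apply: le_trans h2 _.
  by apply: ler_wpM2l.
apply: le_trans h4.
rewrite exprMn [(n / expR 3) ^+ _]exprMn exprVn -expRM_natl [n * 3]mulrC -expRN.
have -> : (y ^+ 4) ^+ #|K| = y ^+ #|K| * (y ^+ #|K| * (y ^+ 2) ^+ #|K|).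
  by rewrite -!exprMn; congr (_ ^+ _); ring.
have P : 0 <= expR (- (3 * n)) * ((y ^+ 2) ^+ #|K| * n ^+ #|K|).
  by rewrite mulr_ge0 ?expR_ge0 // mulr_ge0 // exprn_ge0 ?sqr_ge0 // ltW.
have -> : y ^+ #|K| * (y ^+ #|K| * (y ^+ 2) ^+ #|K|) * (n ^+ #|K| * expR (- (3 * n)))
  = y ^+ #|K| * (y ^+ #|K| * (expR (- (3 * n)) * ((y ^+ 2) ^+ #|K| * n ^+ #|K|))) by ring.
have -> : expR (- (n / x)) * (expR (- (3 * n)) / 2 * (y ^+ 2) ^+ #|K| * n ^+ #|K|)
  = expR (- (n / x)) * (2^-1 * (expR (- (3 * n)) * ((y ^+ 2) ^+ #|K| * n ^+ #|K|))) by ring.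
have y0n : 0 <= y ^+ #|K| by exact: exprn_ge0.
apply: ler_pM => //; first by rewrite mulr_ge0.
exact: ler_wpM2r.
Qed.

End LowerBound.

(** * The upper bound *)

Section Jensen.
Variable R : realType.

Lemma ln_le_sub1 (y : R) : 0 < y -> ln y <= y - 1.
Proof. by move=> y0; have := expR_ge1Dx (ln y); rewrite lnK ?posrE //; lra. Qed.

(** The tangent of the logarithm at [b] lies above its graph. *)
Lemma jensen_ln (I : finType) (A : {set I}) (f : I -> R) (c b : R) :
  (forall i, i \in A -> 0 < f i) -> 0 < c -> c = #|A|%:R -> 0 < b ->
  \sum_(i in A) f i <= c * b -> \sum_(i in A) ln (f i) <= c * ln b.
Proof.
move=> f0 c0 cE b0 h.
apply: (@le_trans _ _ (\sum_(i in A) (f i / b - 1 + ln b))).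
  apply: ler_sum => i iA; have fb : 0 < f i / b by rewrite divr_gt0 ?f0.
  have := ln_le_sub1 fb; rewrite ln_div ?posrE ?f0 //; lra.
rewrite !big_split /= -mulr_suml sumrN !sumr_const -[ln b *+ _]mulr_natl -cE.
by rewrite gerDr subr_le0 ler_pdivrMr.
Qed.

End Jensen.

Section Draws.
Variables (I : finType) (Q : {set I}).
Local Notation n := #|Q|.

Definition draws k : {set {set I}} := [set U : {set I} | U \subset Q & #|U| == k].

Lemma card_drawsE k : #|draws k| = 'C(n, k).
Proof. by rewrite /draws cards_draws. Qed.

(** A set of size k arises by deleting one of the n-k elements outside it. *)
Lemma sum_draws (R : nmodType) k (f : {set I} -> R) : (k < n)%N ->
  \sum_(U in draws k.+1) \sum_(q in U) f (U :\ q) = (\sum_(U in draws k) f U) *+ (n - k).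
Proof.
move=> kn; rewrite (exchange_big_dep (mem Q)) /=; last first.
  by move=> U q; rewrite inE => /andP[/fintype.subsetP h _] /h.
rewrite -sumrMnl.
have e q : q \in Q -> \sum_(U in draws k.+1 | q \in U) f (U :\ q) = \sum_(U in draws k | q \notin U) f U.
  move=> qQ; rewrite (reindex_onto (fun U => q |: U) (fun U => U :\ q)) /=; last first.
    by move=> U /andP[_ qU]; rewrite finset.setD1K.
  apply: eq_big => [U|U /andP[_ /eqP ->]] //.
  rewrite !inE eqxx andbT finset.subUset finset.sub1set qQ /= cardsU1.
  case: (boolP (q \in U)) => qU /=; rewrite ?andbF ?andbT.
    apply/negbTE; rewrite negb_and; apply/orP; right; apply/eqP => e.
    by have : q \in (q |: U) :\ q; [rewrite e | rewrite !inE eqxx].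
  by rewrite finset.setU1K // eqxx andbT add1n eqSS.
rewrite (eq_bigr _ e) (exchange_big_dep (mem (draws k))) /=; last by move=> q U _ /andP[].
apply: eq_bigr => U; rewrite inE => /andP[UQ /eqP Uk].
rewrite (eq_bigl (mem (Q :\: U))) /=; last by move=> q; rewrite !inE UQ Uk eqxx /= andbC.
by rewrite sumr_const cardsD (finset.setIidPr UQ) Uk.
Qed.

(** A uniformly random k-subset contains [B] with probability at most (k/n)^|B|. *)
Lemma draws_sup (B : {set I}) k : B \subset Q -> (k <= n)%N ->
  (#|[set U in draws k | B \subset U]| * n ^ #|B| <= k ^ #|B| * 'C(n, k))%N.
Proof.
move=> BQ kn; case: (ltnP k #|B|) => hk.
  rewrite (_ : [set U in draws k | _] = finset.set0) ?cards0 //.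
  apply/setP => U; rewrite !inE; apply/negbTE/negP => /andP[/andP[_ /eqP Uk] /subset_leq_card].
  by rewrite Uk leqNgt hk.
apply: (@leq_trans ('C(n - #|B|, k - #|B|) * n ^ #|B|)%N).
  rewrite leq_mul2r; apply/orP; right.
  have -> : (n - #|B|)%N = #|Q :\: B| by rewrite cardsD (finset.setIidPr BQ).
  rewrite -cards_draws -[leqLHS](card_in_imset (f := fun U : {set I} => U :\: B)); last first.
    move=> U U'; rewrite !inE => /andP[_ h] /andP[_ h'] e.
    by rewrite -(finset.setID U B) -(finset.setID U' B) e (finset.setIidPr h) (finset.setIidPr h').
  apply: subset_leq_card; apply/fintype.subsetP => _ /imsetP[U + ->]; rewrite !inE.
  by case/andP => /andP[UQ /eqP Uk] BU; rewrite finset.setSD //= cardsD (finset.setIidPr BU) Uk.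
move: #|B| hk => b; elim: b => [|b IH] hb; first by rewrite !subn0 !expn0 muln1 mul1n.
apply: leq_trans (_ : 'C(n - b, k - b) * k * n ^ b <= _)%N; last first.
  by rewrite expnSr [leqLHS]mulnAC [leqRHS]mulnAC leq_mul2r IH ?orbT // ltnW.
rewrite expnS mulnA leq_mul2r; apply/orP; right.
have bn : (b < n)%N by exact: leq_trans hb kn.
have [kb kbE] : exists kb, (k - b = kb.+1)%N by exists (k - b.+1)%N; rewrite subnSK.
have [nb nbE] : exists nb, (n - b = nb.+1)%N by exists (n - b.+1)%N; rewrite subnSK.
rewrite !subnS kbE nbE /=.
have h := mul_bin_diag nb.+1 kb; rewrite /= in h.
rewrite -(leq_pmul2l (ltn0Sn nb)) mulnA h (mulnC kb.+1) -mulnA (mulnCA nb.+1) leq_mul2l.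
apply/orP; right; rewrite -kbE -nbE !mulnBl (mulnC n k) leq_sub2l //.
by rewrite leq_mul2l kn orbT.
Qed.

End Draws.

Section Upper.
Variables (R : realType) (K : finComUnitRingType).
Hypothesis u2 : (2 : K) \is a GRing.unit.
Local Notation line := ('I_4 * K)%type.
Local Notation queen := (K * K)%type.
Implicit Types (U Q : {set queen}) (F : {set line}) (v : line) (q : queen).

Definition cover U : {set line} := [set v | [exists q in U, phi v.1 q == v.2]].
Definition weight_den U : R := #|avail (cover U)|%:R.

(* The probability that the random greedy process fills exactly the lines of [U] with
   the queens of [U]. *)
Fixpoint greedy_weight (k : nat) U : R :=
  if k is k'.+1 then (\sum_(q in U) greedy_weight k' (U :\ q)) / weight_den U else 1.

Definition exact_on F : {set {set queen}} := [set U | [forall v, cov_count U v == (v \in F)]].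

Lemma greedy_weight_ge0 k U : 0 <= greedy_weight k U.
Proof.
elim: k U => [|k IH] U //=; apply: mulr_ge0; last by rewrite invr_ge0.
by apply: sumr_ge0 => q _; exact: IH.
Qed.

Lemma exact_cover F U : U \in exact_on F -> cover U = F.
Proof.
rewrite inE => /forallP h; apply/setP => v; rewrite inE.
apply/existsP/idP => [[q /andP[qU hq]]|vF].
  have := h v; case: (v \in F) => //; rewrite cards_eq0 => /eqP/setP/(_ q).
  by rewrite !inE qU hq.
have := h v; rewrite vF => /eqP h1.
have : (0 < cov_count U v)%N by rewrite h1.
by rewrite card_gt0 => /set0Pn[q]; rewrite inE => hq; exists q.
Qed.

Lemma exact_rem F U q : U \in exact_on F -> q \in U ->
  q \in avail F /\ U :\ q \in exact_on (F :\: lines q).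
Proof.
move=> hU qU; have hF := exact_cover hU; split.
  by apply/availP => j; rewrite -hF inE; apply/existsP; exists q; rewrite qU /=.
move: hU; rewrite !inE => /forallP h; apply/forallP => v; have := h v.
rewrite /cov_count (cardsD1 q) !inE qU /= => /eqP hv.
rewrite (_ : [set x in U :\ q | _] = [set x in U | phi v.1 x == v.2] :\ q); last first.
  by apply/setP => x; rewrite !inE andbA.
case: (phi v.1 q == v.2) hv => /=; rewrite ?add1n ?add0n; last by move=> ->.
by case: (v \in F) => //= -[->].
Qed.

(** Disjointness of the outcomes: conditioning on the first queen q reduces to the lines left by q,
    where induction bounds the total by 1. *)
Lemma greedy_weight_total k F : \sum_(U in exact_on F | #|U| == k) greedy_weight k U <= 1.
Proof.
elim: k F => [|k IH] F /=.
  apply: (@le_trans _ _ (\sum_(U in [set finset.set0 : {set queen}]) 1)); last by rewrite sumr_const cards1.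
  rewrite big_mkcond [leRHS]big_mkcond; apply: ler_sum => U _; rewrite !inE cards_eq0.
  by case: eqP => _; rewrite ?andbF //; case: ifP.
rewrite (eq_bigr (fun U => (\sum_(q in U) greedy_weight k (U :\ q)) / #|avail F|%:R)); last first.
  by move=> U /andP[/exact_cover h _]; rewrite /weight_den h.
rewrite -mulr_suml (exchange_big_dep (mem (avail F))) /=; last first.
  by move=> U q /andP[hU _] qU; have [] := exact_rem hU qU.
have h q : q \in avail F ->
    \sum_(U | (U \in exact_on F) && (#|U| == k.+1) && (q \in U)) greedy_weight k (U :\ q) <= 1.
  move=> qF; apply: le_trans (IH (F :\: lines q)).
  rewrite (reindex_onto (fun U => q |: U) (fun U => U :\ q)) /=; last first.
    by move=> U /andP[_ qU]; rewrite finset.setD1K.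
  rewrite big_mkcond [leRHS]big_mkcond; apply: ler_sum => U _.
  case: ifP => [/andP[/andP[/andP[hU /eqP Uk] _] /eqP e]|_]; last by case: ifP => // _; exact: greedy_weight_ge0.
  have qU : q \in q |: U by rewrite !inE eqxx.
  have [_] := exact_rem hU qU; rewrite e => -> /=.
  have -> : #|U| == k by move: Uk; rewrite (cardsD1 q) qU e add1n => -[->].
  by [].
case: (posnP #|avail F|) => [->|a0]; first by rewrite invr0 mulr0.
rewrite ler_pdivrMr ?ltr0n // mul1r; apply: le_trans (ler_sum _ h) _.
by rewrite sumr_const.
Qed.

Lemma conf_exact : conf K = exact_on [set: line].
Proof. by apply/setP => S; rewrite !inE; apply: eq_forallb => v; rewrite inE. Qed.

Section Fixed.
Variable Q : {set queen}.
Hypothesis hQ : Q \in conf K.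
Local Notation n := #|K|.

Let Qn : #|Q| = n. Proof. exact: conf_card. Qed.

Lemma conf_line v : exists2 q, q \in Q & phi v.1 q == v.2.
Proof.
move: hQ; rewrite conf_exact => /exact_cover /setP /(_ v); rewrite !inE.
by case/existsP => q /andP[]; exists q.
Qed.

Lemma conf_uniq v q q' : q \in Q -> q' \in Q -> phi v.1 q == v.2 -> phi v.1 q' == v.2 -> q = q'.
Proof.
move: hQ; rewrite inE => /forallP /(_ v) /eqP h qQ qQ' h1 h2.
have /card_le1_eqP : (cov_count Q v <= 1)%N by rewrite h.
by apply; rewrite inE ?qQ ?qQ'.
Qed.

Lemma cover_sub U v q : U \subset Q -> q \in Q -> phi v.1 q == v.2 -> (v \in cover U) = (q \in U).
Proof.
move=> /fintype.subsetP UQ qQ hq; rewrite inE; apply/existsP/idP => [[q' /andP[q'U hq']]|qU].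
  by rewrite (conf_uniq qQ (UQ q' q'U) hq hq').
by exists q; rewrite qU.
Qed.

(** A queen of [Q] is available only if it is missing, with probability k/n. Any other queen shares
    its four lines with four distinct queens of [Q], all of which must be missing, with probability
    at most (k/n)^4. There are n of the former and at most n^2 of the latter. *)
Lemma avail_total k : (k <= n)%N ->
  (\sum_(U in draws Q k) #|avail (cover U)| * n ^ 2 <= (k * n ^ 2 + k ^ 4) * 'C(n, k))%N.
Proof.
move=> kn; rewrite -big_distrl /=.
have e1 : (\sum_(U in draws Q k) #|avail (cover U)| =
    \sum_q #|[set U in draws Q k | q \in avail (cover U)]|)%N.
  rewrite (eq_bigr (fun U : {set queen} => \sum_q (q \in avail (cover U)))%N); last first.
    by move=> U _; rewrite -sum1_card big_mkcond; apply: eq_bigr => q _; case: (_ \in _).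
  rewrite exchange_big /=; apply: eq_bigr => q _.
  rewrite -sum1_card big_mkcond [RHS]big_mkcond; apply: eq_bigr => U _.
  by rewrite [in RHS]inE; case: (_ \in _); case: (_ \in _).
rewrite e1 (bigID (mem Q)) /= mulnDl mulnDl; apply: leq_add.
  have h q : q \in Q -> (#|[set U in draws Q k | q \in avail (cover U)]| * n <= k * 'C(n, k))%N.
    move=> qQ; have := @draws_sup _ Q [set q] k; rewrite finset.sub1set Qn cards1 !expn1 => /(_ qQ kn) h.
    apply: leq_trans h; rewrite leq_mul2r; apply/orP; right; apply: subset_leq_card.
    apply/fintype.subsetP => U; rewrite inE => /andP[hU /availP /(_ ord0)].
    rewrite inE hU finset.sub1set (@cover_sub _ _ q) //; first by move: hU; rewrite inE => /andP[].
  have s : (\sum_(q in Q) #|[set U in draws Q k | q \in avail (cover U)]| * n <= n * (k * 'C(n, k)))%N.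
    by rewrite -[X in (_ <= X * _)%N]Qn -sum_nat_const; apply: leq_sum.
  rewrite expnS expn1 mulnA big_distrl /= [leqRHS](_ : _ = n * (k * 'C(n, k)) * n)%N; last first.
    by move: n 'C(n, k) => a b; ring.
  by rewrite leq_mul2r s orbT.
have h q : q \notin Q -> (#|[set U in draws Q k | q \in avail (cover U)]| * n ^ 4 <= k ^ 4 * 'C(n, k))%N.
  move=> qQ; pose g (j : 'I_4) := odflt q [pick q' in Q | phi j q' == phi j q].
  have gP j : g j \in Q /\ phi j (g j) == phi j q.
    rewrite /g; case: pickP => [q' /andP[] //|h].
    by have [q' q'Q hq'] := conf_line (j, phi j q); have := h q'; rewrite /= q'Q hq'.
  have ginj : injective g.
    move=> i j e; apply/eqP; apply: contraT => ij.
    have [giQ /eqP gi] := gP i; have [_ /eqP gj] := gP j.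
    have eq : g i = q by apply: (line_inj u2 ij) => //; rewrite e.
    by rewrite eq in giQ; rewrite giQ in qQ.
  pose B := [set g j | j : 'I_4].
  have Bc : #|B| = 4%N by rewrite /B card_imset // card_ord.
  have BQ : B \subset Q by apply/fintype.subsetP => _ /imsetP[j _ ->]; have [] := gP j.
  have := @draws_sup _ Q B k BQ; rewrite Qn Bc => /(_ kn) h; apply: leq_trans h.
  rewrite leq_mul2r; apply/orP; right; apply: subset_leq_card.
  apply/fintype.subsetP => U; rewrite inE => /andP[hU /availP hq]; rewrite inE hU /=.
  have UQ : U \subset Q by move: hU; rewrite inE => /andP[].
  apply/fintype.subsetP => _ /imsetP[j _ ->]; have [gQ gh] := gP j.
  by rewrite -(@cover_sub U (j, phi j q) (g j)).
have n0 : (0 < n)%N by apply/card_gt0P; exists 0.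
rewrite -(@leq_pmul2r (n ^ 2)) ?expn_gt0 ?n0 // -mulnA -expnD big_distrl /=.
apply: (@leq_trans (\sum_(q | q \notin Q) k ^ 4 * 'C(n, k))%N); first exact: leq_sum.
rewrite sum_nat_const mulnC leq_mul2l; apply/orP; right.
by apply: leq_trans (max_card _) _; rewrite card_prod.
Qed.

(* The average number of choices left with [k] queens missing, divided by [k]. *)
Definition slack (k : nat) : R := 1 + k%:R ^+ 3 / n%:R ^+ 2.

Let n0 : 0 < n%:R :> R. Proof. by rewrite ltr0n; apply/card_gt0P; exists 0. Qed.

Lemma slack_gt0 k : 0 < slack k.
Proof. by rewrite /slack ltr_pwDl // divr_ge0 // exprn_ge0. Qed.

Lemma draw_avail k U : U \in draws Q k.+1 -> 0 < weight_den U.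
Proof.
rewrite inE => /andP[UQ /eqP Uk]; rewrite /weight_den ltr0n.
have /card_gt0P[q qU] : (0 < #|U|)%N by rewrite Uk.
apply/card_gt0P; exists q; apply/availP => j; rewrite inE.
by apply/existsP; exists q; rewrite qU /=.
Qed.

Lemma draw_rem k U q : U \in draws Q k.+1 -> q \in U -> U :\ q \in draws Q k.
Proof.
rewrite !inE => /andP[UQ /eqP Uk] qU; apply/andP; split.
  by apply: fintype.subset_trans UQ; exact: subD1set.
by move: Uk; rewrite (cardsD1 q) qU add1n => -[->].
Qed.

Lemma greedy_weight_gt0 k U : U \in draws Q k -> 0 < greedy_weight k U.
Proof.
elim: k U => [|k IH] U hU //=; rewrite divr_gt0 ?(draw_avail hU) //.
have /card_gt0P[q qU] : (0 < #|U|)%N by move: hU; rewrite inE => /andP[_ /eqP ->].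
rewrite (bigD1 q) //= ltr_wpDr ?IH ?(draw_rem hU) //.
by apply: sumr_ge0 => ? _; exact: greedy_weight_ge0.
Qed.

Lemma sum_ln_den k : (k < n)%N ->
  \sum_(U in draws Q k.+1) ln (weight_den U) <= 'C(n, k.+1)%:R * ln (k.+1%:R * slack k.+1).
Proof.
move=> kn; apply: jensen_ln.
- by move=> U; exact: draw_avail.
- by rewrite ltr0n bin_gt0.
- by rewrite card_drawsE Qn.
- by rewrite mulr_gt0 ?slack_gt0.
have h := avail_total kn; rewrite -big_distrl /= -(ler_nat R) in h.
have n2 : 0 < n%:R ^+ 2 :> R by rewrite exprn_gt0.
rewrite -(ler_pM2r n2) /weight_den -natr_sum -natrX -natrM.
apply: le_trans h _; rewrite natrM natrD natrM !natrX /slack.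
by rewrite le_eqVlt; apply/orP; left; apply/eqP; field; rewrite gt_eqF.
Qed.

(** Concavity is used twice: in [st] for the sum over the first queen, and in [sum_ln_den] for the
    number of choices. The term ln (k+1) gained from the first cancels the one lost in the second,
    and only the [slack] factors accumulate. *)
Lemma sum_ln_W k : (k <= n)%N ->
  - ('C(n, k)%:R * \sum_(i < k) ln (slack i.+1)) <= \sum_(U in draws Q k) ln (greedy_weight k U).
Proof.
elim: k => [|k IH] kn.
  by rewrite big_ord0 mulr0 oppr0 sumr_ge0 // => U _ /=; rewrite ln1.
have {}IH := IH (ltnW kn).
have k0 : 0 < k.+1%:R :> R by [].
(* Jensen's inequality for the k+1 possible first queens: a sum is k+1 times its mean. *)
have st U : U \in draws Q k.+1 ->
    k.+1%:R^-1 * (\sum_(q in U) ln (greedy_weight k (U :\ q))) + ln k.+1%:R - ln (weight_den U) <= ln (greedy_weight k.+1 U).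
  move=> hU; have aU := draw_avail hU.
  have cU : k.+1%:R = #|U|%:R :> R by move: hU; rewrite inE => /andP[_ /eqP ->].
  have pos : 0 < \sum_(q in U) greedy_weight k (U :\ q).
    by have := greedy_weight_gt0 hU; rewrite /= pmulr_lgt0 // invr_gt0.
  have h := @jensen_ln R _ U (fun q => greedy_weight k (U :\ q)) k.+1%:R
    ((\sum_(q in U) greedy_weight k (U :\ q)) / k.+1%:R) (fun q qU => greedy_weight_gt0 (draw_rem hU qU)) k0 cU.
  have {}h : \sum_(q in U) ln (greedy_weight k (U :\ q)) <= k.+1%:R * ln ((\sum_(q in U) greedy_weight k (U :\ q)) / k.+1%:R).
    by apply: h; [rewrite divr_gt0 | rewrite mulrC divfK ?gt_eqF].
  rewrite /= ln_div ?posrE // lerD2r; move: h; rewrite ln_div ?posrE //.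
  by rewrite -ler_pdivrMl // lerBrDr.
apply: le_trans (ler_sum _ st).
rewrite sumrB big_split /= -mulr_sumr (@sum_draws _ Q _ k (fun V => ln (greedy_weight k V))) ?Qn // sumr_const card_drawsE Qn.
have hb : (n - k)%N%:R * 'C(n, k)%:R = k.+1%:R * 'C(n, k.+1)%:R :> R.
  by rewrite -!natrM mul_bin_left.
have hl := sum_ln_den kn; rewrite lnM ?posrE ?slack_gt0 // in hl.
rewrite big_ord_recr /= -[ln _ *+ _]mulr_natl -[_ *+ (n - k)]mulr_natl.
move: IH hl; move: (\sum_(U in draws Q k) _) (\sum_(U in draws Q k.+1) _) (\sum_(i < k) _).
move: (ln k.+1%:R) (ln (slack k.+1)) => a b M L S IH hl.
have h2 : k.+1%:R^-1 * ((n - k)%N%:R * - ('C(n, k)%:R * S)) <= k.+1%:R^-1 * ((n - k)%N%:R * M).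
  by rewrite ler_pM2l ?invr_gt0 // ler_wpM2l.
have e : k.+1%:R^-1 * ((n - k)%N%:R * - ('C(n, k)%:R * S)) = - ('C(n, k.+1)%:R * S).
  rewrite mulrN mulrA hb mulrN; congr (- _); rewrite -mulrA mulKf ?gt_eqF //.
rewrite e in h2; move: h2 hl; rewrite !mulrDr.
move: ('C(n, k.+1)%:R * S) ('C(n, k.+1)%:R * a) ('C(n, k.+1)%:R * b) (k.+1%:R^-1 * _).
move=> y1 y2 y3 y4; lra.
Qed.

Lemma greedy_weight_lower : \prod_(i < n) (slack i.+1)^-1 <= greedy_weight n Q.
Proof.
have Qd : Q \in draws Q n by rewrite inE fintype.subxx Qn /=.
have h := sum_ln_W (leqnn n); rewrite binn mul1r in h.
have e : draws Q n = [set Q].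
  apply/setP => U; rewrite !inE -Qn eqEcard; case: (boolP (U \subset Q)) => //= /subset_leq_card h'.
  by rewrite eqn_leq h'.
rewrite e big_set1 in h.
rewrite -ler_ln ?posrE ?(greedy_weight_gt0 Qd) //; last by apply: prodr_gt0 => i _; rewrite invr_gt0 slack_gt0.
apply: le_trans h; rewrite -sumrN; elim: (n) => [|d IH]; first by rewrite !big_ord0 ln1.
rewrite !big_ord_recr /= lnM ?posrE ?invr_gt0 ?slack_gt0 //; last first.
  by apply: prodr_gt0 => i _; rewrite invr_gt0 slack_gt0.
by rewrite lnV ?posrE ?slack_gt0 // lerD2r.
Qed.

End Fixed.

Lemma upper_bound : #|conf K|%:R <= \prod_(i < #|K|) slack i.+1.
Proof.
have h := greedy_weight_total #|K| [set: line].
have p0 : 0 < \prod_(i < #|K|) slack i.+1 by apply: prodr_gt0 => i _; exact: slack_gt0.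
rewrite -[leRHS]mul1r -ler_pdivrMr //; apply: le_trans h.
rewrite -prodfV mulr_natl -sumr_const -conf_exact.
rewrite [leRHS](eq_bigl (mem (conf K))); last first.
  by move=> Q /=; apply: andb_idr => hQ; rewrite (conf_card hQ).
by apply: ler_sum => Q hQ; exact: greedy_weight_lower.
Qed.

End Upper.

(** * Asymptotics *)

Section Asymptotics.
Variable R : realType.

Lemma fact_le (n : nat) : n.+1`!%:R <= expR 1 * n.+1%:R * n.+1%:R ^+ n.+1 * expR (- n.+1%:R) :> R.
Proof.
elim: n => [|n IH].
  by rewrite factS fact0 muln1 expr1 !mulr1 -expRD subrr expR0.
rewrite factS natrM; set a : R := n.+1%:R in IH *.
have a0 : 0 < a by rewrite ltr0n.
have aE : n.+2%:R = a + 1 :> R by rewrite /a natr1.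
rewrite aE; clearbody a.
apply: le_trans (ler_wpM2l (addr_ge0 (ltW a0) ler01) IH) _.
have -> : (a + 1) * (expR 1 * a * a ^+ n.+1 * expR (- a)) = expR 1 * (a + 1) * (a ^+ n.+2 * expR (- a)).
  by rewrite [a ^+ n.+2]exprS; ring.
have -> : expR 1 * (a + 1) * (a + 1) ^+ n.+2 * expR (- (a + 1)) =
   expR 1 * (a + 1) * ((a + 1) ^+ n.+2 * expR (- (a + 1))) by ring.
rewrite ler_pM2l; last by rewrite mulr_gt0 ?expR_gt0 // addr_gt0.
rewrite opprD expRD [leRHS]mulrCA [leLHS]mulrC ler_pM2l ?expR_gt0 //.
have a1 : 0 < a + 1 by rewrite addr_gt0.
have h : a / (a + 1) <= expR (- (a + 1)^-1).
  have -> : a / (a + 1) = 1 + - (a + 1)^-1 by field; rewrite gt_eqF.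
  exact: expR_ge1Dx.
have h2 : (a / (a + 1)) ^+ n.+2 <= expR (-1).
  apply: (@le_trans _ _ (expR (- (a + 1)^-1) ^+ n.+2)).
    by apply: lerXn2r; rewrite ?nnegrE ?expR_ge0 // divr_ge0 ?ltW.
  by rewrite -expRM_natl ler_expR mulrN lerN2 aE divff // gt_eqF.
by move: h2; rewrite exprMn exprVn ler_pdivrMr ?exprn_gt0 // mulrC.
Qed.

Lemma prod_threshold (n m : nat) (A B : R) (f : nat -> R) : 1 <= A ->
  (forall i, (i < n)%N -> 0 <= f i) ->
  (forall i, (i < n)%N -> f i <= (if (i < m)%N then A else 1) * B) ->
  \prod_(i < n) f i <= A ^+ m * B ^+ n.
Proof.
move=> A1 f0 h; apply: (@le_trans _ _ (\prod_(i < n) ((if (i < m)%N then A else 1) * B))).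
  by apply: ler_prod => i _; rewrite f0 ?h.
have B0 : (0 < n)%N -> 0 <= B.
  move=> n0; have := le_trans (f0 0%N n0) (h 0%N n0); rewrite pmulr_rge0 //.
  by case: ifP => // _; apply: lt_le_trans A1.
rewrite big_split /= prodr_const card_ord.
have [->|n0] := posnP n; first by rewrite big_ord0 expr0 !mulr1; exact: exprn_ege1.
apply: ler_wpM2r; first by rewrite exprn_ge0 ?B0.
rewrite -big_mkcond /= prodr_const; apply: ler_weXn2l => //.
rewrite -[leqRHS]card_ord; pose g (i : 'I_n) : 'I_m.+1 := inord i.
case: m {h g} => [|m]; first by rewrite eq_card0.
rewrite -(card_in_imset (f := fun i : 'I_n => inord i : 'I_m.+1)); first exact: max_card.
move=> i j; rewrite !unfold_in => hi hj e; apply: val_inj.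
by have := congr1 val e; rewrite /= !inordK.
Qed.

(** Factoring i^3/n^2 out of each factor gives (n!)^3/n^(2n), which is (n/e^3)^n up to a small
    error. The remaining 1 + n^2/i^3 is large only for small i, so the product is cut at about
    n/x^2. *)
Lemma upper_asymptotics (n q : nat) (x := q%:R : R) : 1000 <= x -> x ^+ 8 <= n%:R ->
  n%:R <= expR (x / 20) ->
  \prod_(i < n) (1 + i.+1%:R ^+ 3 / n%:R ^+ 2) <= (n%:R / expR 3 * expR (2 / x)) ^+ n.
Proof.
move=> x6 nx8 nx; set N : R := n%:R in nx8 nx *.
have x0 : 0 < x by lra.
have x1 : 1 <= x by lra.
have N0 : 0 < N by apply: lt_le_trans nx8; rewrite exprn_gt0.
have n0 : (0 < n)%N by rewrite -(ltr_nat R).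
have N1 : 1 <= N by rewrite /N ler1n.
have absorb_x k : (k <= 8)%N -> x ^+ k <= N by move=> hk; apply: le_trans nx8; apply: ler_weXn2l.
(* Below [m] each factor is polynomial in n, hence at most e^(x/5), and m x/5 is about n/(5x). Above
   it the logarithms add up to at most n^3/m^3 <= x^6. Both fit into n/x. *)
pose m := (n %/ q ^ 2).+1; set M : R := m%:R.
have q0 : (0 < q ^ 2)%N by rewrite expn_gt0 -(ltr_nat R) x0.
have M1 : N <= M * x ^+ 2.
  by rewrite /N /M /x -natrX -natrM ler_nat ltnW // ltn_ceil.
have M2 : M <= N / x ^+ 2 + 1.
  rewrite /M /m -natr1 lerD2r ler_pdivlMr ?exprn_gt0 // /N /x -natrX -natrM ler_nat.
  exact: leq_trunc_div.
have M0 : 0 < M by rewrite ltr0n.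
clearbody x.
pose g (i : nat) : R := 1 + N ^+ 2 / i.+1%:R ^+ 3.
have e i : 1 + i.+1%:R ^+ 3 / N ^+ 2 = i.+1%:R ^+ 3 / N ^+ 2 * g i.
  rewrite /g; have : 0 < i.+1%:R :> R by [].
  by move: N0; move: (i.+1%:R : R) (N) => y z z0 y0; field; rewrite !gt_eqF.
rewrite (eq_bigr (fun i : 'I_n => i.+1%:R ^+ 3 / N ^+ 2 * g i)); last by move=> i _; exact: e.
have hfact : \prod_(i < n) (i.+1%:R : R) = n`!%:R.
  elim: (n) => [|k IH]; first by rewrite big_ord0 fact0.
  by rewrite big_ord_recr /= IH factS natrM mulrC.
rewrite big_split big_split /= prodr_const card_ord prodrXl hfact.
have hg : \prod_(i < n) g i <= expR (x / 5) ^+ m * expR (N ^+ 2 / M ^+ 3) ^+ n.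
  apply: (@prod_threshold n m _ _ g).
  - by rewrite -[leLHS]expR0 ler_expR; lra.
  - by move=> i _; rewrite /g addr_ge0 // divr_ge0 ?exprn_ge0 // ltW.
  - move=> i hi; rewrite /g; case: ltnP => him.
      rewrite -[leLHS]mulr1; apply: ler_pM => //.
      + by rewrite addr_ge0 // divr_ge0 ?exprn_ge0 // ltW.
      + apply: (@le_trans _ _ (expR 1 * expR (x / 20) ^+ 2)).
          apply: (@le_trans _ _ (2 * N ^+ 2)).
            have h1 : 1 <= N ^+ 2 by exact: exprn_ege1.
            have h2 : N ^+ 2 / i.+1%:R ^+ 3 <= N ^+ 2.
              rewrite ler_pdivrMr ?exprn_gt0 // ler_peMr ?exprn_ge0 ?(ltW N0) //.
              by rewrite exprn_ege1 // ler1n.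
            by rewrite [leRHS]mulr_natl mulr2n; exact: lerD.
          apply: ler_pM => //; first by rewrite exprn_ge0 // ltW.
            by have := expR_ge1Dx (1 : R); lra.
          by apply: lerXn2r; rewrite ?nnegrE ?expR_ge0 // ltW.
        by rewrite -expRM_natl -expRD ler_expR; lra.
      + by rewrite -[leLHS]expR0 ler_expR divr_ge0 ?exprn_ge0 ?(ltW N0) ?(ltW M0).
    rewrite mul1r; apply: le_trans (expR_ge1Dx _) _; rewrite ler_expR.
    rewrite ler_pM2l ?exprn_gt0 // lef_pV2 ?posrE ?exprn_gt0 //.
    by apply: lerXn2r; rewrite ?nnegrE ?(ltW M0) // /M ler_nat ltnW.
have hB : expR (x / 5) ^+ m * expR (N ^+ 2 / M ^+ 3) ^+ n <= expR (N / x).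
  rewrite -!expRM_natl -expRD ler_expR -/M -/N.
  have b1 : M * (x / 5) <= N / x / 5 + x / 5.
    have := ler_wpM2r (ltW x0) M2; rewrite mulrDl mul1r.
    have -> : N / x ^+ 2 * x = N / x by field; rewrite gt_eqF.
    by move: (N / x) => a; lra.
  have b2 : N * (N ^+ 2 / M ^+ 3) <= x ^+ 6.
    rewrite mulrA ler_pdivrMr ?exprn_gt0 //.
    have -> : N * N ^+ 2 = N ^+ 3 by ring.
    have -> : x ^+ 6 * M ^+ 3 = (M * x ^+ 2) ^+ 3 by ring.
    by apply: lerXn2r; rewrite ?nnegrE ?(ltW N0) // mulr_ge0 ?exprn_ge0 // ltW.
  have b3 : x ^+ 7 <= N / x by rewrite ler_pdivlMr // -exprSr.
  have b4 : 4 * x ^+ 6 <= x ^+ 7 by rewrite [x ^+ 7]exprS ler_wpM2r ?exprn_ge0 ?(ltW x0) //; lra.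
  have b5 : x <= x ^+ 6 by rewrite -[leLHS]expr1; apply: ler_weXn2l.
  move: b1 b2 b3 b4 b5; move: (M * _) (N / x) (N * _) (x ^+ 6) (x ^+ 7) => a b c d f; lra.
have hF : n`!%:R <= expR (x / 10) * (N ^+ n * expR (- N)).
  have := fact_le n.-1; rewrite prednK // -/N => h; apply: le_trans h _.
  rewrite -!mulrA; set z := N ^+ n * _; rewrite mulrA ler_pM2r.
    have -> : x / 10 = x / 20 + x / 20 by field.
    rewrite expRD; apply: ler_pM; rewrite ?expR_ge0 ?(ltW N0) ?ler_expR //; lra.
  by rewrite mulr_gt0 ?expR_gt0 ?exprn_gt0.
have hF3 : n`!%:R ^+ 3 <= (expR (x / 10) * (N ^+ n * expR (- N))) ^+ 3.
  by apply: lerXn2r; rewrite ?nnegrE // !mulr_ge0 ?expR_ge0 // exprn_ge0 // ltW.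
have hX : expR (x / 10) ^+ 3 <= expR (N / x).
  rewrite -expRM_natl ler_expR ler_pdivlMr //.
  have := absorb_x 3 isT; have : x * x <= x ^+ 3.
    by rewrite -expr2; apply: ler_weXn2l.
  have -> : 3%:R * (x / 10) * x = (x * x) * (3 / 10) by field.
  by have : 0 <= x * x by [rewrite mulr_ge0 // ltW]; move: (x * x) (x ^+ 3) => a b; lra.
apply: (@le_trans _ _ ((expR (x / 10) * (N ^+ n * expR (- N))) ^+ 3 / (N ^+ 2) ^+ n * expR (N / x))).
  rewrite -[((N ^+ 2) ^+ n)^-1]exprVn; apply: ler_pM.
  - by rewrite mulr_ge0 // exprn_ge0 // invr_ge0 exprn_ge0 // ltW.
  - by apply: prodr_ge0 => i _; rewrite /g addr_ge0 // divr_ge0 ?exprn_ge0 // ltW.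
  - by apply: ler_wpM2r; rewrite // exprn_ge0 // invr_ge0 exprn_ge0 // ltW.
  - exact: le_trans hg hB.
have e1 : (N / expR 3 * expR (2 / x)) ^+ n = N ^+ n * expR (- N) ^+ 3 * (expR (N / x) * expR (N / x)).
  rewrite !exprMn exprVn -!expRM_natl -expRN -/N -expRD; congr (_ * expR _ * expR _).
    by rewrite mulrN [3%:R * _]mulrC.
  by field; rewrite gt_eqF.
rewrite e1.
have e2 : (expR (x / 10) * (N ^+ n * expR (- N))) ^+ 3 / (N ^+ 2) ^+ n
   = N ^+ n * expR (- N) ^+ 3 * expR (x / 10) ^+ 3.
  have -> : (N ^+ 2) ^+ n = (N ^+ n) ^+ 2 by rewrite -!exprM mulnC.
  have : 0 < N ^+ n by exact: exprn_gt0.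
  move: (N ^+ n) (expR (- N)) (expR (x / 10)) => a b c a0.
  by field; rewrite gt_eqF.
rewrite e2 -[leLHS]mulrA; apply: ler_wpM2l.
  by rewrite mulr_ge0 ?exprn_ge0 ?expR_ge0 // ltW.
by apply: ler_wpM2r => //; exact: expR_ge0.
Qed.

Lemma growth (C : R) (k : nat) : 0 < C -> exists2 X : R, 0 < X & forall x, X <= x -> C * x ^+ k <= expR (x / 20).
Proof.
move=> C0; pose A : R := (20 * k.+1%:R) ^+ k.+1.
have A0 : 0 < A by rewrite exprn_gt0 // mulr_gt0.
exists (C * A); first by rewrite mulr_gt0.
move=> x hx; have x0 : 0 < x by apply: lt_le_trans hx; rewrite mulr_gt0.
have k1 : 0 < k.+1%:R :> R by [].
have e : expR (x / 20) = expR (x / (20 * k.+1%:R)) ^+ k.+1.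
  rewrite -expRM_natl; congr expR; move: k1; move: (k.+1%:R : R) => y y0.
  by field; rewrite gt_eqF.
have h : (x / (20 * k.+1%:R)) ^+ k.+1 <= expR (x / 20).
  rewrite e; apply: lerXn2r; rewrite ?nnegrE ?expR_ge0 ?divr_ge0 ?mulr_ge0 ?(ltW x0) //.
  by apply: le_trans (expR_ge1Dx _); rewrite lerDr.
apply: le_trans h; rewrite exprMn exprVn -/A ler_pdivlMr // [x ^+ k.+1]exprS mulrAC.
by apply: ler_wpM2r => //; rewrite exprn_ge0 // ltW.
Qed.

End Asymptotics.

Section Sandwich.
Variable R : realType.

Definition coprime6 (n : nat) := (n = 1 %[mod 6])%N \/ (n = 5 %[mod 6])%N.

Lemma coprime6P n : coprime6 n -> coprime n 2 /\ coprime n 3.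
Proof.
move=> h; have h2 : (n %% 2 = 1)%N by case: h => /=; lia.
have h3 : (n %% 3 != 0)%N by case: h => /=; lia.
split; first by rewrite coprime_sym prime_coprime // /dvdn h2.
by rewrite coprime_sym prime_coprime // /dvdn.
Qed.

Lemma nat_root (a n q0 : nat) : (0 < a)%N -> (q0 ^ a <= n)%N ->
  exists q : nat, [/\ (q0 <= q)%N, (q ^ a <= n)%N & (n < q.+1 ^ a)%N].
Proof.
move=> a0 h; have ex : exists q, (q ^ a <= n)%N by exists q0.
have bd q : (q ^ a <= n)%N -> (q <= n)%N.
  by apply: leq_trans; case: q => [|q] //; rewrite -{1}(expn1 q.+1) leq_pexp2l.
case: (ex_maxnP ex bd) => q hq hmax; exists q; split => //; first exact: hmax.
by rewrite ltnNge; apply/negP => /hmax; rewrite ltnn.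
Qed.

(** The number q of colours is the integer part of the 18000-th root of n. Then q+1 <= 2q gives n <=
    C q^18000 with C = 2^18000, and by [growth] this is below e^(q/20) for large q. *)
Lemma sandwich (Q : nat) : exists N : nat, forall n, (N <= n)%N -> coprime6 n ->
  exists q : nat, [/\ (0 < q)%N, (Q <= q)%N,
    ((1 - q%:R^-1) ^+ 4 * (n%:R / expR 3)) ^+ n <= (T n)%:R :> R
  & (T n)%:R <= (n%:R / expR 3 * expR (2 / q%:R)) ^+ n :> R].
Proof.
(* The exponent and [C] are kept abstract, so that no such power is ever evaluated. *)
have [e eE] : exists e, e = (600 * 30)%N by exists (600 * 30)%N.
have e0 : (0 < e)%N by rewrite eE.
have [C CE] : exists C : R, C = 2 ^+ e by exists (2 ^+ e).
have C1 : 1 <= C by rewrite CE; apply: exprn_ege1; rewrite ler1n.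
have C0 : 0 < C by apply: lt_le_trans C1.
have [X X0 hX] := growth e C0.
have C10 : 0 <= C ^+ 10 by rewrite exprn_ge0 // ltW.
have pos := ler0n R kappa; have pos1 := ler0n R special_bound.
have pos2 := ler0n R gad_bound; have pos3 := ler0n R gad_coord_bound; have pos4 := ler0n R Q.
have [Y Y0 hY] : exists2 Y : R, 0 <= Y & forall x, Y <= x ->
    [/\ 1000 <= x, Q%:R <= x, C ^+ 10 <= x, kappa%:R <= x & special_bound%:R <= x]
    /\ [/\ gad_bound%:R <= x, gad_coord_bound%:R <= x & X <= x].
  exists (1000 + Q%:R + C ^+ 10 + kappa%:R + special_bound%:R + gad_bound%:R + gad_coord_bound%:R + X).
    move: pos pos1 pos2 pos3 pos4 C10 X0; clear.
    move: (Q%:R : R) (C ^+ 10) (kappa%:R : R) (special_bound%:R : R) (gad_bound%:R : R) (gad_coord_bound%:R : R).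
    by move=> a b c d f g *; lra.
  move: pos pos1 pos2 pos3 pos4 C10 X0; clear.
  move: (Q%:R : R) (C ^+ 10) (kappa%:R : R) (special_bound%:R : R) (gad_bound%:R : R) (gad_coord_bound%:R : R).
  by move=> a b c d f g ? ? ? ? ? ? ? y ?; split; split; lra.
pose q0 := Num.bound Y; have hq0 : Y < q0%:R by exact: archi_boundP.
exists (q0 ^ e)%N => n hn n6; have [q [q0q qn nq]] := @nat_root e n q0 e0 hn.
pose x : R := q%:R; have Yx : Y <= x by apply: le_trans (ltW hq0) _; rewrite ler_nat.
have [[x6 Qx Cx kx sx] [gx gcx Xx]] := hY x Yx.
have q1 : (0 < q)%N by rewrite -(ltr_nat R) -/x; lra.
have ns : (x ^+ 600) ^+ 30 <= n%:R by rewrite -exprM -eE /x -natrX ler_nat.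
have nC : n%:R <= C * (x ^+ 600) ^+ 30.
  rewrite -exprM -eE CE -exprMn /x -natrM -natrX ler_nat.
  apply: leq_trans (ltnW nq) _; rewrite leq_exp2r //.
  by move: q1; clear; lia.
have nx : n%:R <= expR (x / 20).
  by apply: le_trans (hX x Xx); rewrite eE exprM.
have [c2 c3] := coprime6P n6.
have xn : x <= n%:R.
  apply: le_trans ns; rewrite -exprM -[leLHS]expr1; apply: ler_weXn2l => //; lra.
have n2 : (2 <= n)%N by rewrite -(ler_nat R); lra.
case: n n2 hn n6 qn nq ns nC nx c2 c3 xn => [|[|k]] // _ _ _ _ _ ns nC nx c2 c3 xn.
have u2 := residue_unit c2; have u3 := residue_unit c3.
exists q; split => //; first by rewrite -(ler_nat R).
  rewrite T_conf.
  pose l := (trunc_log 2 k.+2).+1.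
  have hl1 : (k.+2 <= 2 ^ l)%N by rewrite ltnW // trunc_log_ltn.
  have hl2 : (2 ^ l <= 2 * #|'Z_k.+2|)%N.
    by rewrite card_residues /l expnS leq_mul2l /= trunc_logP.
  have := @lower_bound R 'Z_k.+2 u2 u3 (@residue_solutions k) l q.-1 C (residue_cyclic hl1) hl2
    x (x ^+ 600).
  rewrite card_residues prednK //; apply => //.
rewrite T_conf; apply: le_trans (upper_bound R u2) _.
rewrite /slack card_residues; apply: upper_asymptotics => //.
apply: le_trans ns; rewrite -exprM; apply: ler_weXn2l => //; lra.
Qed.

End Sandwich.

Local Open Scope classical_set_scope.
Local Open Scope ring_scope.

Theorem theorem1p2 (R : realType) :
  exists eps : nat -> R,
    eps n @[n --> within [set m : nat | m = 1 %[mod 6] \/ m = 5 %[mod 6]] \oo]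
      --> (0 : R) /\
    forall n : nat, n = 1 %[mod 6] \/ n = 5 %[mod 6] ->
      (T n)%:R = ((1 + eps n) * (n%:R / expR 3)) ^+ n.
Proof.
(* Solving the required identity for [eps] makes it hold for every n in the two classes; only the
   convergence needs the two bounds. *)
pose root n : R := (T n)%:R `^ n%:R^-1.
exists (fun n => root n / (n%:R / expR 3) - 1); split; last first.
  move=> n h; have n0 : (0 < n)%N by case: n h => // -[].
  have c0 : 0 < n%:R / expR 3 :> R by rewrite divr_gt0 ?ltr0n ?expR_gt0.
  rewrite addrC subrK divfK ?gt_eqF // /root -powR_mulrn ?powR_ge0 // -powRrM mulVf ?powRr1 //.
  by rewrite pnatr_eq0 -lt0n.
apply/cvgrPdist_le => /= d d0; rewrite near_withinE.
(* This makes 1/q at most d/8 and at most 1/8; the relative errors of both bounds are at most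
   4/q. *)
pose Q := Num.bound (8 / d + 8).
have hQ : 8 / d + 8 < Q%:R by apply: archi_boundP; rewrite addr_ge0 // divr_ge0 // ltW.
have [N hN] := sandwich R Q.
near=> n => n6.
have Nn : (N <= n)%N by near: n; exact: nbhs_infty_ge.
have n0 : (0 < n)%N by case: (n) n6 => // -[].
have [q [q0 Qq lo up]] := hN n Nn n6.
set c : R := n%:R / expR 3 in lo up *; have c0 : 0 < c by rewrite divr_gt0 ?ltr0n ?expR_gt0.
have rE : root n ^+ n = (T n)%:R.
  by rewrite /root -powR_mulrn ?powR_ge0 // -powRrM mulVf ?powRr1 // pnatr_eq0 -lt0n.
have r0 : 0 <= root n by exact: powR_ge0.
have x0 : 0 < q%:R :> R by rewrite ltr0n.
have xQ : 8 / d + 8 <= q%:R by apply: le_trans (ltW hQ) _; rewrite ler_nat.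
have hd : 0 < 8 / d by rewrite divr_gt0.
have y1 : q%:R^-1 <= d / 8.
  rewrite -[d / 8]invrK invf_div lef_pV2 ?posrE //; move: xQ hd; lra.
have y8 : q%:R^-1 <= 8^-1 :> R by rewrite lef_pV2 ?posrE //; move: xQ hd; lra.
have y0 : 0 < q%:R^-1 :> R by rewrite invr_gt0.
rewrite -rE in lo up; move: lo up y1 y8 y0; set y := q%:R^-1 => lo up y1 y8 y0.
have lo' : (1 - y) ^+ 4 * c <= root n.
  by move: lo; rewrite ler_pXn2r // nnegrE // mulr_ge0 ?(ltW c0) // exprn_ge0 //; lra.
have up' : root n <= c * expR (2 * y).
  by move: up; rewrite ler_pXn2r // nnegrE // mulr_ge0 ?(ltW c0) ?expR_ge0.
have b1 : 1 - 4 * y <= (1 - y) ^+ 4.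
  have -> : (1 - y) ^+ 4 = 1 - 4 * y + y ^+ 2 * (6 - 4 * y + y ^+ 2) by ring.
  rewrite lerDl mulr_ge0 ?sqr_ge0 //; have := sqr_ge0 y; lra.
have b2 : expR (2 * y) <= 1 + 4 * y.
  have h : 1 - 2 * y <= expR (- (2 * y)) by exact: expR_ge1Dx.
  have p : 0 < 1 - 2 * y by lra.
  have : expR (2 * y) <= (1 - 2 * y)^-1.
    by rewrite -[expR _]invrK lef_pV2 ?posrE ?invr_gt0 ?expR_gt0 // -expRN.
  move=> h2; apply: le_trans h2 _; rewrite -[leLHS]mul1r ler_pdivrMr //.
  have -> : (1 + 4 * y) * (1 - 2 * y) = 1 + 2 * y * (1 - 4 * y) by ring.
  by rewrite lerDl; apply: mulr_ge0; lra.
rewrite distrC subr0 ler_norml; apply/andP; split.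
  rewrite lerBrDr ler_pdivlMr //; apply: le_trans lo'; apply: ler_wpM2r; [exact: ltW|].
  by apply: le_trans b1; lra.
rewrite lerBlDr ler_pdivrMr //; apply: le_trans up' _; rewrite mulrC; apply: ler_wpM2r; [exact: ltW|].
by apply: le_trans b2 _; lra.
Unshelve. all: by end_near.
Qed.
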